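(* Assume that for each route $l=1,\dots,L$: $E[(X^{(l)}_1)^2]<\infty$ and $E[(V^{(l)}_1)^q]<\infty$ for every $q>0$. Assume $$\sum_{l=1}^L \frac{E V_1^{(l)}}{E X_1^{(l)}}P_l(j)=C_j\quad\text{for each } j=1,\dots,J,$$ and that station $j$ of the $s$-th system has $C_j^s=sC_j+\beta_j\sqrt s$ servers with $\beta_j>0$. Then, provided the $\beta_j$ are large enough, for every $\delta>0$, $\log E_\pi^s|\tau'|=o(s^\delta)$ as $s\to\infty$.
   Context: A network has $J$ stations, station $j$ having $C_j$ servers (base system), and $L$ routes; route $l$ has a routing vector $P_l\in\{0,1\}^J$, where $P_l(j)=1$ means a route-$l$ job requires one server at station $j$, simultaneously at all such stations and for its whole service time. For each $l$, route-$l$ requests arrive according to a renewal process with i.i.d. interarrival times $X^{(l)}_n$ (CDF $G_l$, finite mean) and have i.i.d. service times $V^{(l)}_n$ (CDF $F_l$, finite mean), independent of arrivals; the $L$ streams are mutually independent. In the $s$-th system interarrival times are $X^{(l)}_n/s$ (service times unscaled) and station $j$ has $C_j^s$ servers. Consider the coupled network of infinite-server stations fed by the same stationary streams (no job ever blocked), in stationarity on $\mathbb R$. Let $Q_j(t,0)$ be the number of jobs at station $j$ at time $t$ and $R(t)$ the maximum remaining service time over all jobs in the network at time $t$ ($0$ if none). Define $$\tau'=\sup\{t<0:\ R(t)\le|t| \text{ and } Q_j(u,0)\le C_j^s \text{ for all } j \text{ and all } u\in[t,t+R(t)]\}.$$ $E_\pi^s$ denotes expectation for the stationary $s$-th system.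 *)

(* Defs.v *)
From HB Require Import structures.
From mathcomp Require Import all_boot all_order all_algebra.
From mathcomp Require Import all_classical all_reals all_analysis.
Set Implicit Arguments. Unset Strict Implicit. Unset Printing Implicit Defensive.
Import Order.TTheory GRing.Theory Num.Theory.
Import numFieldNormedType.Exports.
Local Open Scope classical_set_scope.
Local Open Scope ring_scope.

(** Mutual independence of a family of classes of events (indexed by the
    elements of D): for every finite family of distinct indices and every
    choice of events from the corresponding classes, the probability of the
    intersection is the product of the probabilities.  Independence of random
    elements is independence of the (π-system) classes of events they
    generate. *)
Definition mutual_indep {d} {Omega : measurableType d} {R : realType}
  (P : probability Omega R) {I : eqType} (D : set I) (G : I -> set (set Omega)) :=
  forall (s : seq I) (A : I -> set Omega), uniq s ->
    (forall i, i \in s -> D i /\ G i (A i)) ->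
    P (\big[setI/setT]_(i <- s) A i) = (\prod_(i <- s) fine (P (A i)))%:E.

Definition rv_events {d} {Omega : measurableType d} {R : realType}
  (X : Omega -> R) : set (set Omega) :=
  [set X @^-1` B | B in [set B : set R | measurable B]].

Definition rv2_events {d} {Omega : measurableType d} {R : realType}
  (X Y : Omega -> R) : set (set Omega) :=
  [set A | exists B C : set R, [/\ measurable B, measurable C &
       A = X @^-1` B `&` Y @^-1` C]].

(** Index type of the independent components of the input of the network:
    inl (inl l)      : the pair (T^{(l)}_0, T^{(l)}_1) (initial points),
    inl (inr (l,n))  : the gap T^{(l)}_{n+1} - T^{(l)}_n  (n <> 0),
    inr (l,n)        : the service time V^{(l)}_n. *)
Definition comp_idx (L : nat) : eqType := (('I_L + ('I_L * int)) + ('I_L * int))%type.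

Definition comp_dom (L : nat) : set (comp_idx L) :=
  fun i => match i with inl (inr (_, n)) => n != 0%R | _ => True end.

(** The input of the s-th stationary system: for every route l, arrival
    epochs T l n (n : int, with T l 0 <= 0 < T l 1) of the stationary
    (equilibrium) renewal process with interarrival times X^{(l)}/s, and i.i.d.
    service times V l n attached to them.  muX l, muV l are the laws of
    X^{(l)}_1 and V^{(l)}_1; mX l = E X^{(l)}_1. *)
Definition stationary_input {d} {Omega : measurableType d} {R : realType}
  (P : probability Omega R) (L : nat) (s : R)
  (muX muV : 'I_L -> probability R R) (mX : 'I_L -> R)
  (T V : 'I_L -> int -> Omega -> R) : Prop :=
  (forall l n, measurable_fun setT (T l n)) /\
  (forall l n, measurable_fun setT (V l n)) /\
  [/\
      (forall l (n : int) (B : set R), n != 0%R -> measurable B ->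
         P [set w | s * (T l (n + 1)%R w - T l n w) \in B] = muX l B),
      (forall l n (B : set R), measurable B ->
         P [set w | V l n w \in B] = muV l B),
      (* equilibrium joint law of backward/forward recurrence times at 0 *)
      (forall l (a b : R), 0 <= a -> 0 <= b ->
         P [set w | - T l 0%R w > a /\ T l 1%R w > b] =
         ((s / mX l)%:E * \int[lebesgue_measure]_(x in `](a + b)%R, +oo[%classic)
                            muX l `](s * x)%R, +oo[%classic)%E) &
      mutual_indep P (@comp_dom L)
        (fun i => match i with
                  | inl (inl l) => rv2_events (T l 0%R) (T l 1%R)
                  | inl (inr (l, n)) => rv_events (fun w => T l (n + 1)%R w - T l n w)
                  | inr (l, n) => rv_events (V l n)
                  end)].

(** Job (l,n) is present in the (infinite-server) network at time t. *)
Definition present {Omega : Type} {R : realType} {L : nat}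
  (T V : 'I_L -> int -> Omega -> R) (w : Omega) (t : R) (ln : 'I_L * int) :=
  T ln.1 ln.2 w <= t /\ t < T ln.1 ln.2 w + V ln.1 ln.2 w.

(** Q_j(u,0) <= c : every finite collection of distinct jobs present at
    station j at time u has at most c elements. *)
Definition Q_le {Omega : Type} {R : realType} {J L : nat}
  (Pr : 'I_L -> 'I_J -> bool) (T V : 'I_L -> int -> Omega -> R)
  (w : Omega) (j : 'I_J) (u c : R) :=
  forall js : seq ('I_L * int), uniq js ->
    (forall x, x \in js -> Pr x.1 j /\ present T V w u x) -> (size js)%:R <= c.

Definition Rmax {Omega : Type} {R : realType} {L : nat}
  (T V : 'I_L -> int -> Omega -> R) (w : Omega) (t : R) : \bar R :=
  ereal_sup ([set 0%E] `|`
     [set ((T x.1 x.2 w + V x.1 x.2 w - t)%:E) | x in present T V w t]).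

(** tau' = sup{t < 0 : R(t) <= |t| and Q_j(u,0) <= C^s_j for all j and all
    u in [t, t + R(t)]} (as an extended real; sup of the empty set = -oo). *)
Definition tau' {Omega : Type} {R : realType} {J L : nat}
  (Pr : 'I_L -> 'I_J -> bool) (Cs : 'I_J -> R)
  (T V : 'I_L -> int -> Omega -> R) (w : Omega) : \bar R :=
  ereal_sup [set t%:E | t in [set t : R | t < 0 /\
     (Rmax T V w t <= `|t|%:E)%E /\
     (forall u : R, t <= u -> (u%:E <= t%:E + Rmax T V w t)%E ->
        forall j, Q_le Pr T V w j u (Cs j))]].

(* Main.v *)
(** Time is reversed, so that the jobs of route [l] have ages [a_0 <= a_1 <= ...]
    with i.i.d. gaps [x_i / s].  Fix [M], put [K = s^(delta/2)], and let trial
    [k = 1, ..., M] ask that [t = - (k M + K)] witness the supremum: no job present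
    at [t] survives past [- k M], and the stations are not overloaded on
    [[t, - k M]].  Success of a trial forces [|tau'| <= k M + K], up to the rare
    event that some job older than [(k + 1) M] is still present.

    Given everything after [- k M], a trial succeeds with probability at least
    [exp (- c K)].  Indeed, measured in interarrival steps the horizon of length
    [K] consists of [O (K)] blocks of [~ s] indices.  On each block Kolmogorov's
    inequality keeps the arrival epochs within [O (sqrt s)] steps of their means,
    and fourth moments with chaining keep the number of jobs in service, seen from
    any index, below its mean plus [b sqrt s], with probability at least [1/2].
    The second family of events is decreasing in the service times, so Harris's
    inequality multiplies the [O (K)] probabilities.  This is where [beta] must be large.
    Hence the [M] trials fail together with probability at most
    [(1 - exp (- c K))^M], rare events cost [O (s^2 / M^3)], and summing over [M]
    gives [E |tau'| <= exp (O (K))].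

    Conversely [|tau'|] is at least the age of the last arrival whenever that job is
    still in service at time 0, so [E |tau'|] is at least of order [1 / s], unless all
    service times vanish almost surely, in which case [E |tau'| = 0]. *)
Require Import Defs.
From HB Require Import structures.
From mathcomp Require Import all_boot all_order all_algebra.
From mathcomp Require Import all_classical all_reals all_analysis.
From mathcomp Require Import measurable_realfun.
From mathcomp Require Import ring lra zify.
Set Implicit Arguments. Unset Strict Implicit. Unset Printing Implicit Defensive.
Import Order.TTheory GRing.Theory Num.Theory.
Import numFieldNormedType.Exports.
Local Open Scope ring_scope.

(** * Words of i.i.d. letters *)

(** The inequalities of Kolmogorov, Ville and Harris are proved for words over a finite alphabet,
    where each is an induction on the first letter. Real variables enter by quantization: gaps are
    rounded down and service times up, so that rounding errs on the safe side. Rounding and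
    fluctuations of the arrival walk slow the arrivals by [O (1 / r)] per gap, with [r ^ 2] of order
    [s]; the mean number in service then grows by [O (sqrt s)] only, with a constant free of
    [delta]. Hence the bound on [beta] can be chosen before [delta].

    A trial starts at random indices, the first arrivals older than [k M]. In place of a strong
    Markov property, the space is cut into cells according to these indices, one per route. On a
    cell the past is an event on the coordinates below the indices, hence independent of the windows
    above them.

    Measurability of [tau'] is never established: its integral is handled only through domination
    by, and of, measurable functions. *)

Section iterated_expectation.
Context {R : realFieldType}.
Variables (p : nat -> R) (m : nat).

(** Product expectation over words of [n] independent letters, letter [t] having weight [p t].
    Recursion on the first letter makes conditioning on it a reduction step, so no product measure
    is built. *)
Fixpoint Ex (n : nat) (F : seq nat -> R) : R :=
  if n is n'.+1 then \sum_(t < m) p t * Ex n' (fun s => F (val t :: s))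
  else F [::].

Definition supported n (s : seq nat) := (size s == n) && all (fun t => (t < m)%N) s.

Lemma eq_Ex n F G : (forall s, supported n s -> F s = G s) -> Ex n F = Ex n G.
Proof.
elim: n F G => [|n IH] F G FG /=; first exact: FG.
apply: eq_bigr => t _; congr (_ * _); apply: IH => s /andP[/eqP ss sm].
by apply: FG; rewrite /supported /= ss eqxx ltn_ord.
Qed.

Lemma Ex0 n : Ex n (fun=> 0) = 0.
Proof. by elim: n => //= n IH; rewrite big1// => t _; rewrite IH mulr0. Qed.

Lemma ExD n F G : Ex n (fun s => F s + G s) = Ex n F + Ex n G.
Proof.
elim: n F G => //= n IH F G; rewrite -big_split /=.
by apply: eq_bigr => t _; rewrite IH mulrDr.
Qed.

Lemma ExZ n c F : Ex n (fun s => c * F s) = c * Ex n F.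
Proof.
elim: n F => //= n IH F; rewrite mulr_sumr.
by apply: eq_bigr => t _; rewrite IH mulrCA.
Qed.

Lemma Ex_sum n (I : Type) (r : seq I) (Q : pred I) (F : I -> seq nat -> R) :
  Ex n (fun s => \sum_(i <- r | Q i) F i s) = \sum_(i <- r | Q i) Ex n (F i).
Proof.
elim: r => [|i r IH].
  rewrite big_nil -[RHS](Ex0 n); apply: eq_Ex => s _; exact: big_nil.
rewrite big_cons -IH; case: ifP => Qi.
  by rewrite -ExD; apply: eq_Ex => s _; rewrite big_cons Qi.
by apply: eq_Ex => s _; rewrite big_cons Qi.
Qed.

Lemma Ex_cat a b F : Ex (a + b) F = Ex a (fun s1 => Ex b (fun s2 => F (s1 ++ s2))).
Proof. by elim: a F => //= a IH F; apply: eq_bigr => t _; rewrite IH. Qed.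

Hypothesis p_ge0 : forall t, 0 <= p t.

Lemma le_Ex n F G : (forall s, supported n s -> F s <= G s) -> Ex n F <= Ex n G.
Proof.
elim: n F G => [|n IH] F G FG /=; first exact: FG.
apply: ler_sum => t _; apply: ler_wpM2l => //; apply: IH => s /andP[/eqP ss sm].
by apply: FG; rewrite /supported /= ss eqxx ltn_ord.
Qed.

Lemma Ex_ge0 n F : (forall s, supported n s -> 0 <= F s) -> 0 <= Ex n F.
Proof. by move=> F0; rewrite -(Ex0 n); apply: le_Ex. Qed.

Hypothesis p_sum : \sum_(t < m) p t = 1.

Lemma Ex_cst n c : Ex n (fun=> c) = c.
Proof. by elim: n => //= n IH; rewrite IH -mulr_suml p_sum mul1r. Qed.

Lemma Ex_prod a b F G :
  Ex (a + b) (fun s => F (take a s) * G (drop a s)) = Ex a F * Ex b G.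
Proof.
rewrite Ex_cat mulrC -ExZ; apply: eq_Ex => s1 /andP[/eqP s1a _].
rewrite mulrC -ExZ; apply: eq_Ex => s2 _.
by rewrite take_size_cat// drop_size_cat.
Qed.

Lemma Ex_nth n i (f : nat -> R) : (i < n)%N ->
  Ex n (fun s => f (nth 0%N s i)) = \sum_(t < m) p t * f t.
Proof.
elim: n i => //= n IH [|i] i_n.
  by apply: eq_bigr => t _ /=; rewrite Ex_cst.
under eq_bigr => t _ do rewrite /= (IH i i_n).
by rewrite -mulr_suml p_sum mul1r.
Qed.

Lemma Ex_indicatorC n (A : pred (seq nat)) :
  Ex n (fun s => (A s)%:R) = 1 - Ex n (fun s => (~~ A s)%:R).
Proof.
apply/eqP; rewrite eq_sym subr_eq -ExD -[X in X == _](Ex_cst n); apply/eqP.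
apply: eq_Ex => s _.
by case: (A s); rewrite /= ?addr0 ?add0r.
Qed.

Lemma Ex_union n (A B C : pred (seq nat)) :
  (forall s, supported n s -> A s -> B s || C s) ->
  Ex n (fun s => (A s)%:R) <= Ex n (fun s => (B s)%:R) + Ex n (fun s => (C s)%:R).
Proof.
move=> ABC; rewrite -ExD; apply: le_Ex => s ss; move: (ABC s ss).
by case: (A s); case: (B s); case: (C s) => //= h; rewrite ?mulr1n ?mulr0n; first [lra | by have := h isT].
Qed.

Lemma Ex_markov n (A : pred (seq nat)) F c : 0 < c ->
  (forall s, supported n s -> 0 <= F s) ->
  (forall s, supported n s -> A s -> c <= F s) ->
  Ex n (fun s => (A s)%:R) <= Ex n F / c.
Proof.
move=> c0 F0 AF; rewrite mulrC -ExZ; apply: le_Ex => s ss.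
case: (boolP (A s)) => As; last by rewrite mulr_ge0 ?F0// invr_ge0 ltW.
by rewrite mulrC ler_pdivlMr// mul1r AF.
Qed.

Fixpoint exits (xi : nat -> R) (lam w : R) (s : seq nat) : bool :=
  (lam <= `|w|) || (if s is t :: s' then exits xi lam (w + xi t) s' else false).

Lemma exitsN (xi : nat -> R) (lam w : R) s j : ~~ exits xi lam w s -> (j <= size s)%N ->
  `|w + \sum_(i < j) xi (nth 0%N s i)| < lam.
Proof.
elim: s w j => [|t s IH] w [|j] //=; rewrite negb_or -ltNge => /andP[wl hs] js.
- by rewrite big_ord0 addr0.
- by rewrite big_ord0 addr0.
by rewrite big_ord_recl /= addrA; apply: IH.
Qed.

(** Kolmogorov's maximal inequality. The free starting point [w] makes the induction close:
    averaging the bound for [n] steps over the first step gives the bound for [n + 1] steps, because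
    the steps are centred. *)
Lemma kolmogorov (xi : nat -> R) (sigma lam : R) n (w : R) : 0 < lam -> 0 <= sigma ->
  \sum_(t < m) p t * xi t = 0 -> \sum_(t < m) p t * xi t ^+ 2 <= sigma ->
  Ex n (fun s => (exits xi lam w s)%:R) <= (w ^+ 2 + n%:R * sigma) / lam ^+ 2.
Proof.
move=> lam0 sig0 xi1 xi2.
(* Once the walk has left the interval, the claimed bound is already trivial. *)
have stop k v : lam <= `|v| -> 1 <= (v ^+ 2 + k%:R * sigma) / lam ^+ 2.
  move=> h; rewrite ler_pdivlMr ?exprn_gt0// mul1r -[v ^+ 2]real_normK ?num_real//.
  have : 0 <= k%:R * sigma by rewrite mulr_ge0.
  by have := h; nra.
elim: n w => [|n IH] w /=.
  case: (leP lam `|w|) => h /=; first by have /= := stop 0%N w h.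
  by rewrite divr_ge0 ?sqr_ge0// mul0r addr0 sqr_ge0.
case: (leP lam `|w|) => h /=.
  rewrite (eq_bigr (fun t : 'I_m => p t * 1)) => [|t _]; last by rewrite Ex_cst.
  by rewrite -mulr_suml p_sum mul1r; apply: stop.
apply: (@le_trans _ _ (\sum_(t < m) p t * (((w + xi t) ^+ 2 + n%:R * sigma) / lam ^+ 2))).
  by apply: ler_sum => t _; apply: ler_wpM2l.
have -> : \sum_(t < m) p t * (((w + xi t) ^+ 2 + n%:R * sigma) / lam ^+ 2) =
  ((w ^+ 2 + n%:R * sigma) * (\sum_(t < m) p t) + 2 * w * (\sum_(t < m) p t * xi t)
   + \sum_(t < m) p t * xi t ^+ 2) / lam ^+ 2.
  rewrite !mulr_sumr -!big_split /= mulr_suml; apply: eq_bigr => t _.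
  by ring.
rewrite p_sum xi1 mulr0 addr0 mulr1 ler_wpM2r ?invr_ge0 ?sqr_ge0//.
by rewrite -natr1; lra.
Qed.

Fixpoint reaches (f : nat -> R) (lam w : R) (s : seq nat) : bool :=
  (lam <= w) || (if s is t :: s' then reaches f lam (w * f t) s' else false).

Lemma reachesN (f : nat -> R) (lam w : R) s j : ~~ reaches f lam w s -> (j <= size s)%N ->
  w * \prod_(i < j) f (nth 0%N s i) < lam.
Proof.
elim: s w j => [|t s IH] w [|j] //=; rewrite negb_or -ltNge => /andP[wl hs] js.
- by rewrite big_ord0 mulr1.
- by rewrite big_ord0 mulr1.
by rewrite big_ord_recl /= mulrA; apply: IH.
Qed.

(** Ville's inequality for the nonnegative supermartingale of products of [f], by the same induction
    with free initial value. The bound does not involve [n], which later gives control of infinitely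
    many indices at once. *)
Lemma ville (f : nat -> R) (lam : R) n (w : R) : 0 < lam -> (forall t, 0 <= f t) -> 0 <= w ->
  \sum_(t < m) p t * f t <= 1 ->
  Ex n (fun s => (reaches f lam w s)%:R) <= w / lam.
Proof.
move=> lam0 f0 + f1.
elim: n w => [|n IH] w w0 /=.
  case: (leP lam w) => h /=; first by rewrite ler_pdivlMr// mul1r.
  by rewrite divr_ge0// ltW.
case: (leP lam w) => h /=.
  rewrite (eq_bigr (fun t : 'I_m => p t * 1)) => [|t _]; last by rewrite Ex_cst.
  by rewrite -mulr_suml p_sum mul1r ler_pdivlMr// mul1r.
apply: (@le_trans _ _ (\sum_(t < m) p t * (w * f t / lam))).
  by apply: ler_sum => t _; apply: ler_wpM2l => //; apply: IH; rewrite mulr_ge0.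
have -> : \sum_(t < m) p t * (w * f t / lam) = w * (\sum_(t < m) p t * f t) / lam.
  by rewrite mulr_sumr mulr_suml; apply: eq_bigr => t _; ring.
by rewrite ler_wpM2r ?invr_ge0 ?(ltW lam0)// ler_piMr.
Qed.

Fixpoint blocks (ok : pred (seq nat)) (n k : nat) (s : seq nat) : bool :=
  if k is k'.+1 then ok (take n s) && blocks ok n k' (drop n s) else true.

Lemma Ex_blocks ok n k :
  Ex (k * n) (fun s => (blocks ok n k s)%:R) = (Ex n (fun s => (ok s)%:R)) ^+ k.
Proof.
elim: k => [|k IH] //=; rewrite mulSn exprS -IH.
rewrite -(Ex_prod n (k * n) (fun s => (ok s)%:R) (fun s => (blocks ok n k s)%:R)).
by apply: eq_Ex => s _; case: (ok _); rewrite /= ?mul1r ?mul0r.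
Qed.

Lemma blocksP ok n k s b : blocks ok n k s -> (b < k)%N -> ok (take n (drop (b * n) s)).
Proof.
elim: k s b => //= k IH s [|b] /andP[h1 h2] bk; first by rewrite mul0n drop0.
by rewrite mulSn addnC -drop_drop; apply: IH.
Qed.

(** Chebyshev's association inequality by symmetrization: twice the covariance is the double sum of
    [p t * p u * ((f t - f u) * (g t - g u))], whose terms are nonnegative. *)
Lemma chebyshev_sum (f g : nat -> R) :
  (forall t u, (t <= u)%N -> f u <= f t) -> (forall t u, (t <= u)%N -> g u <= g t) ->
  (\sum_(t < m) p t * f t) * (\sum_(t < m) p t * g t) <= \sum_(t < m) p t * (f t * g t).
Proof.
move=> fdec gdec.
set S := \sum_(t < m) p t * (f t * g t).
set A := \sum_(t < m) p t * f t; set B := \sum_(t < m) p t * g t.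
have e1 : 2 * (S - A * B) =
  \sum_(t < m) \sum_(u < m) p t * p u * ((f t - f u) * (g t - g u)).
  transitivity (\sum_(t < m) (p t * (f t * g t) + p t * S
      + (p t * f t * (- B) + p t * g t * (- A)))).
    by rewrite !big_split /= -!mulr_suml p_sum -/S -/A -/B; ring.
  apply: eq_bigr => t _.
  transitivity (p t * (f t * g t) * (\sum_(u < m) p u) + p t * S
      + (p t * f t * (- B) + p t * g t * (- A))); first by rewrite p_sum mulr1.
  rewrite /S /A /B -!sumrN !mulr_sumr -!big_split /=.
  by apply: eq_bigr => u _; ring.
suff : 0 <= 2 * (S - A * B) by lra.
rewrite e1; apply: sumr_ge0 => t _; apply: sumr_ge0 => u _.
apply: mulr_ge0; first exact: mulr_ge0.
case: (leqP t u) => tu.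
  by have := fdec _ _ tu; have := gdec _ _ tu; nra.
by have := fdec _ _ (ltnW tu); have := gdec _ _ (ltnW tu); nra.
Qed.

Definition decreasing (F : seq nat -> R) :=
  forall s s' : seq nat, size s = size s' ->
    (forall i, (nth 0%N s i <= nth 0%N s' i)%N) -> F s' <= F s.

(** Harris's inequality. After conditioning on the first letter, both conditional means are
    decreasing in that letter, so [chebyshev_sum] handles it and induction handles the rest of the
    word. *)
Lemma Ex_harris n F G : decreasing F -> decreasing G ->
  Ex n F * Ex n G <= Ex n (fun s => F s * G s).
Proof.
elim: n F G => [|n IH] F G dF dG //=.
have dcons H t : decreasing H -> decreasing (fun s => H (t :: s)).
  by move=> dH s s' ss' h; apply: dH => [|[|i]] //=; rewrite ss'.
have dEx H : decreasing H ->
    forall t u, (t <= u)%N -> Ex n (fun s => H (u :: s)) <= Ex n (fun s => H (t :: s)).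
  by move=> dH t u tu; apply: le_Ex => s _; apply: dH => // -[|i] //=.
apply: le_trans (chebyshev_sum (dEx _ dF) (dEx _ dG)) _.
by apply: ler_sum => t _; apply: ler_wpM2l => //; apply: IH; apply: dcons.
Qed.

Lemma Ex_harris_forall n k (A : nat -> pred (seq nat)) (q : R) : 0 <= q ->
  (forall b, decreasing (fun s => (A b s)%:R)) ->
  (forall b, (b < k)%N -> q <= Ex n (fun s => (A b s)%:R)) ->
  q ^+ k <= Ex n (fun s => ([forall b : 'I_k, A b s])%:R).
Proof.
move=> q0 dA; pose AA k s := all (A^~ s) (iota 0 k).
have dAA j : decreasing (fun s => (AA j s)%:R).
  move=> s s' ss' h; rewrite ler_nat; case: (boolP (AA j s')) => // /allP hs'.
  rewrite lt0b; apply/allP => b bj; have := dA b s s' ss' h.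
  by rewrite (hs' _ bj) ler_nat lt0b.
suff main : (forall b, (b < k)%N -> q <= Ex n (fun s => (A b s)%:R)) ->
    q ^+ k <= Ex n (fun s => (AA k s)%:R).
  move=> /main h; apply: le_trans h _; apply: le_Ex => s _; rewrite ler_nat.
  case: (boolP (AA k s)) => // /allP hs; rewrite lt0b; apply/forallP => b.
  by apply: hs; rewrite mem_iota /=.
elim: k => [|k IH] hA; first by rewrite expr0 Ex_cst.
rewrite exprSr; apply: le_trans (_ : Ex n (fun s => (AA k s)%:R * (A k s)%:R) <= _).
  apply: le_trans (Ex_harris n (dAA k) (dA k)).
  by apply: ler_pM; rewrite ?exprn_ge0 ?hA ?IH// => b bk; apply: hA; apply: ltnW.
apply: le_Ex => s _; rewrite /AA -(addn1 k) iotaD all_cat /= andbT add0n.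
by case: (all _ _); case: (A k s); rewrite /= ?mul1r ?mul0r ?mulr0.
Qed.

End iterated_expectation.

(** * Fourth moments and chaining *)

Section moments.
Context {R : realFieldType}.
Variables (p : nat -> R) (m : nat).
Hypothesis p_ge0 : forall t, 0 <= p t.
Hypothesis p_sum : \sum_(t < m) p t = 1.
Local Notation Ex := (Ex p m).
Local Notation E1 f := (\sum_(t < m) p t * f (val t)).

Definition lin (f : nat -> nat -> R) n (s : seq nat) := \sum_(i < n) f i (nth 0%N s i).

(** Expand the fourth power of first letter plus rest: the odd terms vanish by centring,
    [f ^ 4 <= f ^ 2] bounds the pure term, and the cross term [6 v W] is the increment of [3 V ^ 2]
    when [V = v + W]. *)
Lemma lin_moments n (f : nat -> nat -> R) :
  (forall i, \sum_(t < m) p t * f i t = 0) -> (forall i t, `|f i t| <= 1) ->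
  let V := \sum_(i < n) \sum_(t < m) p t * f i t ^+ 2 in
  [/\ Ex n (lin f n) = 0, Ex n (fun s => lin f n s ^+ 2) = V &
      Ex n (fun s => lin f n s ^+ 4) <= V + 3 * V ^+ 2].
Proof.
elim: n f => [|n IH] f f0 f1 V.
  by rewrite /V /= /lin !big_ord0 !expr0n /=; split=> //; lra.
pose g i := f i.+1.
have [I1 I2 I4] := IH g (fun i => f0 i.+1) (fun i => f1 i.+1).
set W := \sum_(i < n) _ in I2 I4.
set v := \sum_(t < m) p t * f 0%N t ^+ 2.
have VE : V = v + W by rewrite /V big_ord_recl.
have linE (t : nat) s : lin f n.+1 (t :: s) = f 0%N t + lin g n s.
  by rewrite /lin big_ord_recl.
have E1c c : \sum_(t < m) p t * c = c by rewrite -mulr_suml p_sum mul1r.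
have v0 : 0 <= v by apply: sumr_ge0 => t _; rewrite mulr_ge0 ?sqr_ge0.
have W0 : 0 <= W.
  by apply: sumr_ge0 => i _; apply: sumr_ge0 => t _; rewrite mulr_ge0 ?sqr_ge0.
split.
- rewrite /=; transitivity (\sum_(t < m) (p t * f 0%N t + p t * Ex n (lin g n))).
    apply: eq_bigr => t _; rewrite -mulrDr; congr (_ * _).
    by rewrite -[f 0%N t in RHS](Ex_cst p_sum n) -ExD; apply: eq_Ex => s _; apply: linE.
  by rewrite big_split /= f0 I1 E1c addr0.
- rewrite /=; transitivity (\sum_(t < m) (p t * f 0%N t ^+ 2 + (p t * f 0%N t * (2 * Ex n (lin g n))
     + p t * Ex n (fun s => lin g n s ^+ 2)))).
    apply: eq_bigr => t _; rewrite -mulrA -!mulrDr; congr (_ * _).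
    rewrite -[f 0%N t ^+ 2 in RHS](Ex_cst p_sum n) mulrA -!ExZ -!ExD.
    by apply: eq_Ex => s _; rewrite linE; ring.
  by rewrite !big_split /= I1 I2 E1c VE mulr0 -mulr_suml mulr0 add0r.
set S3 := Ex n (fun s => lin g n s ^+ 3).
set S4 := Ex n (fun s => lin g n s ^+ 4) in I4.
(* The third moment [S3] is never evaluated: its factor [f 0 t] averages to zero over [t]. *)
rewrite /=; apply: (@le_trans _ _ (\sum_(t < m) (p t * f 0%N t ^+ 2 * (1 + 6 * W) +
   (p t * f 0%N t * (4 * S3) + p t * S4)))); last first.
  rewrite !big_split /= -!mulr_suml f0 p_sum -/v VE mul0r add0r mul1r.
  by have := sqr_ge0 v; have := mulr_ge0 v0 W0; nra.
apply: ler_sum => t _; rewrite -!mulrA -!mulrDr; apply: ler_wpM2l => //.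
have -> : Ex n (fun s => lin f n.+1 (val t :: s) ^+ 4) =
    f 0%N t ^+ 4 + (4 * f 0%N t ^+ 3 * Ex n (lin g n) + (6 * f 0%N t ^+ 2 * W
     + (4 * f 0%N t * S3 + S4))).
  rewrite -I2 -[f 0%N t ^+ 4 in RHS](Ex_cst p_sum n) -!ExZ -!ExD.
  by apply: eq_Ex => s _; rewrite linE; ring.
have h : f 0%N t ^+ 4 <= f 0%N t ^+ 2.
  rewrite (_ : 4 = 2 + 2)%N// exprD ler_piMr ?sqr_ge0// -[_ ^+ 2]real_normK ?num_real//.
  by rewrite expr_le1.
by rewrite I1; nra.
Qed.

Definition center (d : nat -> R) t := d t - \sum_(u < m) p u * d u.

Lemma center_mean d : \sum_(t < m) p t * center d t = 0.
Proof.
rewrite (eq_bigr (fun t : 'I_m => p t * d t - p t * \sum_(u < m) p u * d u)).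
  by rewrite sumrB -mulr_suml p_sum mul1r subrr.
by move=> t _; rewrite mulrBr.
Qed.

Lemma mean_bounds (d : nat -> R) a b : (forall t, a <= d t <= b) ->
  a <= \sum_(u < m) p u * d u <= b.
Proof.
move=> dab; have E1c c : \sum_(t < m) p t * c = c by rewrite -mulr_suml p_sum mul1r.
apply/andP; split; [rewrite -(E1c a)|rewrite -(E1c b)];
  by apply: ler_sum => t _; apply: ler_wpM2l => //; case/andP: (dab t).
Qed.

(** The mean lies in the same interval of length one as the values. The two cases are the two signs
    of an increment of a presence indicator in [Z_incr4]. *)
Lemma center_le1 d : (forall t, 0 <= d t <= 1) \/ (forall t, -1 <= d t <= 0) ->
  forall t, `|center d t| <= 1.
Proof.
by case=> h t; rewrite /center ler_norml; have := h t; have := mean_bounds h; lra.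
Qed.

Lemma center_var (d : nat -> R) :
  \sum_(t < m) p t * center d t ^+ 2 <= \sum_(t < m) p t * d t ^+ 2.
Proof.
set mu := \sum_(u < m) p u * d u.
have -> : \sum_(t < m) p t * center d t ^+ 2 = \sum_(t < m) p t * d t ^+ 2 - mu ^+ 2.
  transitivity (\sum_(t < m) (p t * d t ^+ 2 + (p t * d t * (- 2 * mu) + p t * mu ^+ 2))).
    by apply: eq_bigr => t _; rewrite /center -/mu; ring.
  by rewrite !big_split /= -!mulr_suml p_sum -/mu; ring.
by rewrite lerBlDr lerDl sqr_ge0.
Qed.

Lemma lin4 n (d : nat -> nat -> R) V :
  (forall i, (forall t, 0 <= d i t <= 1) \/ (forall t, -1 <= d i t <= 0)) ->
  \sum_(t < m) p t * (\sum_(i < n) d i t ^+ 2) <= V ->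
  Ex n (fun s => lin (fun i => center (d i)) n s ^+ 4) <= V + 3 * V ^+ 2.
Proof.
move=> d1 dV.
have [_ _] := @lin_moments n (fun i => center (d i)) (fun i => center_mean (d i))
  (fun i => center_le1 (d1 i)).
move=> /le_trans; apply.
set W := \sum_(i < n) _.
have WV : W <= V.
  apply: (@le_trans _ _ (\sum_(i < n) \sum_(t < m) p t * d i t ^+ 2)).
    by apply: ler_sum => i _; apply: center_var.
  rewrite exchange_big /=; apply: le_trans dV.
  by apply: ler_sum => t _; rewrite -mulr_sumr.
have W0 : 0 <= W.
  by apply: sumr_ge0 => i _; apply: sumr_ge0 => t _; rewrite mulr_ge0 ?sqr_ge0.
by nra.
Qed.

Section chaining.
Variable Z : nat -> seq nat -> R.

(* Dominates [(Z (i + j) - Z i)^4] for all [j <= 2 ^ k], by bisection.  The weights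
   [1 + 2 < 4] keep its mean of order [4 ^ k], the fourth moment of one increment. *)
Fixpoint chain k i s : R :=
  if k is k'.+1 then
    chain k' i s + 2 * chain k' (i + 2 ^ k')%N s + 125 * (Z (i + 2 ^ k')%N s - Z i s) ^+ 4
  else (Z i.+1 s - Z i s) ^+ 4.

Lemma pow4_ge0 (x : R) : 0 <= x ^+ 4. Proof. exact: exprn_even_ge0. Qed.

(** Convexity of the fourth power at [x + y = (4/5) (5 y / 4) + (1/5) (5 x)]: the coefficients are
    [(5/4)^3 = 125/64 < 2] and [5^3]. The small factor on [y] is what matters, since [y] is the term
    bisected again. *)
Lemma pow4_split (x y : R) : (x + y) ^+ 4 <= 2 * y ^+ 4 + 125 * x ^+ 4.
Proof.
have jensen (u v : R) : (u * (4/5) + v * (1/5)) ^+ 4 <= u ^+ 4 * (4/5) + v ^+ 4 * (1/5).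
  have sq (a b : R) : (a * (4/5) + b * (1/5)) ^+ 2 <= a ^+ 2 * (4/5) + b ^+ 2 * (1/5).
    by have := sqr_ge0 (a - b); nra.
  rewrite (_ : 4 = 2 * 2)%N// !exprM; apply: le_trans (sq _ _).
  rewrite ler_sqr ?nnegrE ?sqr_ge0 ?sq//.
  by rewrite addr_ge0// mulr_ge0 ?sqr_ge0//; lra.
have := jensen (y * (5/4)) (x * 5).
have -> : y * (5/4) * (4/5) + x * 5 * (1/5) = x + y by field.
have -> : (y * (5/4)) ^+ 4 * (4/5) + (x * 5) ^+ 4 * (1/5) =
   y ^+ 4 * (125/64) + 125 * x ^+ 4 by field.
by have := pow4_ge0 y; lra.
Qed.

Lemma chain_ge0 k i s : 0 <= chain k i s.
Proof.
elim: k i => [|k IH] i /=; first exact: pow4_ge0.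
by have := IH i; have := IH (i + 2 ^ k)%N; have := pow4_ge0 (Z (i + 2 ^ k)%N s - Z i s); lra.
Qed.

Lemma chainP k i j s : (j <= 2 ^ k)%N -> (Z (i + j)%N s - Z i s) ^+ 4 <= chain k i s.
Proof.
elim: k i j => [|k IH] i j jk.
  case: j jk => [|[|j]]; rewrite ?addn0 ?addn1 ?subrr ?expr0n //=; first by rewrite pow4_ge0.
rewrite /=; set D := (2 ^ k)%N.
have c1 := chain_ge0 k i s; have c2 := chain_ge0 k (i + D)%N s.
have c3 := pow4_ge0 (Z (i + D)%N s - Z i s).
case: (leqP j D) => jD; first by have := IH i j jD; lra.
have jD' : (j - D <= 2 ^ k)%N by rewrite /D in jD *; move: jk; rewrite expnS; lia.
have := IH (i + D)%N (j - D)%N jD'; rewrite -addnA subnKC; last exact: ltnW.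
move=> h; have := pow4_split (Z (i + D)%N s - Z i s) (Z (i + j)%N s - Z (i + D)%N s).
have -> : Z (i + D)%N s - Z i s + (Z (i + j)%N s - Z (i + D)%N s) = Z (i + j)%N s - Z i s by ring.
by lra.
Qed.

(** The recursion closes exactly: two subchains of total weight [1 + 2] plus one increment weighted
    by 125 make [4 * (125 c 4^k)]. *)
Lemma chain_mean n (c : R) : 0 <= c ->
  (forall i k, Ex n (fun s => (Z (i + 2 ^ k)%N s - Z i s) ^+ 4) <= c * 4 ^+ k) ->
  forall k i, Ex n (chain k i) <= 125 * c * 4 ^+ k.
Proof.
move=> c0 hZ; elim=> [|k IH] i.
  by have := hZ i 0%N; rewrite /= addn1 expr0; lra.
rewrite /= !ExD !ExZ exprS.
have := IH i; have := IH (i + 2 ^ k)%N; have := hZ i k.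
have : 0 <= c * 4 ^+ k :> R by rewrite mulr_ge0// exprn_ge0//; lra.
by lra.
Qed.

End chaining.

End moments.

(** * Number of jobs in service *)

Section mains.
Context {R : realFieldType}.
Variables (p : nat -> R) (m : nat).
Hypothesis p_ge0 : forall t, 0 <= p t.
Hypothesis p_sum : \sum_(t < m) p t = 1.
Local Notation Ex := (Ex p m).

(* [nth 0 s j] is a service time counted in interarrival steps: in reversed time
   the job [j >= i] is present at index [i] when it is longer than [j - i]. *)
Definition occ N i (s : seq nat) : nat := \sum_(j < N) ((i <= j) && (j - i < nth 0 s j))%N.

Lemma sum_window N a D : (\sum_(j < N) ((a <= j) && (j < a + D)) <= D)%N.
Proof.
elim: N => [|N IH]; first by rewrite big_ord0.
(* Induction on [N] needs the exact size of the truncated window, not merely [D]. *)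
have aux : forall N, (\sum_(j < N) ((a <= j) && (j < a + D)) <= minn D (N - a))%N.
  elim=> [|M IHM]; first by rewrite big_ord0.
  rewrite big_ord_recr /=; move: IHM.
  by case: (leqP a M); case: (ltnP M (a + D)) => /=; lia.
by apply: leq_trans (aux N.+1) (geq_minl _ _).
Qed.

Lemma sum_occ N i t : (\sum_(j < N) ((i <= j) && (j - i < t)) <= t)%N.
Proof.
apply: leq_trans (sum_window N i t).
by apply: leq_sum => j _; case: (leqP i j) => //= ij; rewrite ltn_subLR.
Qed.

Let d i j t : R := ((i <= j) && (j - i < t))%N%:R.
Let Z N i := lin (fun j => center p m (d i j)) N.

Lemma occ_center N i s :
  (occ N i s)%:R = Z N i s + \sum_(t < m) p t * (\sum_(j < N) d i j t).
Proof.
rewrite /occ /Z /lin natr_sum.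
under [X in _ = _ + X]eq_bigr => t _ do rewrite mulr_sumr.
rewrite exchange_big -big_split /=; apply: eq_bigr => j _.
by rewrite /center subrK.
Qed.

Lemma sum_d N i t : \sum_(j < N) d i j t <= t%:R.
Proof. by rewrite -natr_sum ler_nat sum_occ. Qed.

Lemma Z_mean4 N i V : \sum_(t < m) p t * t%:R <= V ->
  Ex N (fun s => Z N i s ^+ 4) <= V + 3 * V ^+ 2.
Proof.
move=> hV; apply: lin4 => //.
  by move=> j; left => t; rewrite ler0n lern1 leq_b1.
apply: le_trans hV; apply: ler_sum => t _; apply: ler_wpM2l => //.
apply: le_trans (sum_d N i t); apply: ler_sum => j _.
by rewrite /d; case: (_ && _); rewrite ?expr1n ?expr0n.
Qed.

(** For a fixed service time [t], presence at [i] and at [i + D] differs only for jobs in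
    [[i, i + D)] or [[i + t, i + t + D)]. The variance is thus at most [2 D], and
    [2 D + 3 (2 D)^2 <= 14 D^2]. *)
Lemma Z_incr4 N i k :
  Ex N (fun s => (Z N (i + 2 ^ k)%N s - Z N i s) ^+ 4) <= 14 * 4 ^+ k.
Proof.
set D := (2 ^ k)%N.
pose e j t := d (i + D) j t - d i j t.
have -> : Ex N (fun s => (Z N (i + D)%N s - Z N i s) ^+ 4) =
    Ex N (fun s => lin (fun j => center p m (e j)) N s ^+ 4).
  apply: eq_Ex => s _; rewrite /Z /lin -sumrB; congr (_ ^+ 4).
  apply: eq_bigr => j _; rewrite /center /e.
  under [in RHS]eq_bigr => u _ do rewrite mulrBr.
  by rewrite sumrB; ring.
have D1 : 1 <= D%:R :> R by rewrite ler1n expn_gt0.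
have DE : D%:R ^+ 2 = 4 ^+ k :> R by rewrite /D natrX -exprM mulnC exprM; congr (_ ^+ k); ring.
apply: (@le_trans _ _ (2 * D%:R + 3 * (2 * D%:R) ^+ 2)); last by rewrite -DE; nra.
apply: lin4 => //.
  move=> j; rewrite /e /d; case: (leqP (i + D) j) => h.
    have h' : (i <= j)%N by lia.
    left => t; rewrite h' /=; case: ltnP => h1; case: ltnP => h2;
      rewrite ?mulr1n ?mulr0n; try lra.
    by exfalso; lia.
  right => t /=; case: ((i <= j)%N && _); rewrite ?mulr1n ?mulr0n; lra.
have -> : 2 * D%:R = \sum_(t < m) p t * (2 * D%:R) by rewrite -mulr_suml p_sum mul1r.
apply: ler_sum => t _; apply: ler_wpM2l => //.
have -> : 2 * D%:R = (D + D)%:R :> R by rewrite natrD; ring.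
apply: le_trans (_ : (\sum_(j < N) ((i <= j) && (j < i + D)) +
   \sum_(j < N) ((i + t <= j) && (j < i + t + D)))%N%:R <= _); last first.
  by rewrite ler_nat leq_add ?sum_window.
rewrite -big_split /= natr_sum; apply: ler_sum => j _.
have esq : e j t ^+ 2 = ((i + D <= j) && (j - (i + D) < t) != (i <= j) && (j - i < t))%N%:R.
  by rewrite /e /d; case: ((i + D <= j)%N && _); case: ((i <= j)%N && _); rewrite ?mulr1n ?mulr0n; ring.
rewrite esq ler_nat.
by lia.
Qed.

Lemma pow2_4 k : (2 ^+ k) ^+ 4 = 4 ^+ (k + k) :> R.
Proof.
transitivity ((2 ^+ 2) ^+ (k + k) : R); last by rewrite -natrX.
by rewrite -!exprM; congr (_ ^+ _); lia.
Qed.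

(* Each of the [Nb] blocks of length [n = r ^ 2] is good with probability at least [1/2];
   being decreasing in [s], these events are positively correlated. *)
Lemma occ_main k n (r EK : R) Nb m0 (A0 c b : R) :
  n = (4 ^ k)%N -> r = 2 ^+ k -> EK = \sum_(t < m) p t * t%:R ->
  125 * 14 <= A0 -> 0 <= c -> 0 < b -> EK <= c * r ^+ 2 ->
  16 * (A0 + c + 3 * c ^+ 2) / b ^+ 4 <= 1 / 4 ->
  n%:R * (\sum_(t < m) p t * (m0 <= t)%N%:R) <= 1 / 4 ->
  (1 / 2) ^+ Nb <= Ex (Nb * n) (fun s =>
    (all (fun j => ((occ (Nb * n) j s)%:R <= EK + b * r) && (nth 0%N s j < m0)%N)
       (iota 0 (Nb * n)))%:R).
Proof.
move=> n4 r2 EKE hA0 c0 b0 hEK hb htail; set N := (Nb * n)%N.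
pose A a s := all (fun j => ((occ N j s)%:R <= EK + b * r) && (nth 0%N s j < m0)%N)
                (iota (a * n) n).
have r1 : 1 <= r by rewrite r2 exprn_ege1// ler1n.
have rk : r ^+ 4 = 4 ^+ (k + k) by rewrite r2 pow2_4.
have n2k : n = (2 ^ (k + k))%N by rewrite n4 addnn -mul2n expnM.
have occ_mono i s s' : (forall j, nth 0%N s j <= nth 0%N s' j)%N -> (occ N i s <= occ N i s')%N.
  move=> h; apply: leq_sum => j _; case: (i <= j)%N => //=.
  case: (ltnP (j - i) (nth 0%N s j)) => //= h1.
  by rewrite (leq_trans h1 (h j)).
have dA a : decreasing (fun s => (A a s)%:R : R).
  move=> s s' _ h; rewrite ler_nat; case: (boolP (A a s')) => // /allP hs'.
  rewrite lt0b; apply/allP => j /hs' /andP[h1 h2].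
  rewrite (leq_ltn_trans (h j) h2) andbT (le_trans _ h1)// ler_nat.
  exact: occ_mono.
have br4 : (b * r / 2) ^+ 4 = b ^+ 4 * r ^+ 4 / 16 by field.
have r0 : 0 < r := lt_le_trans ltr01 r1.
have br0 : 0 < (b * r / 2) ^+ 4 by rewrite exprn_gt0// divr_gt0// mulr_gt0.
have hA a : (a < Nb)%N -> 1 / 2 <= Ex N (fun s => (A a s)%:R).
  move=> aN; rewrite (Ex_indicatorC p_sum).
  (* Three ways for a block to be bad: a too long service, a large occupancy at its first index, or
     a large oscillation within it. The first costs 1/4. The other two cost 1/4 together: both
     moments are of order [r ^ 4], the chain having [2 k] levels because [n = 2 ^ (2 k)]. *)
  pose B1 s := has (fun j => m0 <= nth 0%N s j)%N (iota (a * n) n).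
  pose B2 s := (b * r / 2) ^+ 4 <= Z N (a * n) s ^+ 4.
  pose B3 s := (b * r / 2) ^+ 4 <= chain (Z N) (k + k) (a * n) s.
  have u1 : Ex N (fun s => (~~ A a s)%:R) <=
      Ex N (fun s => (B1 s)%:R) + Ex N (fun s => (B2 s || B3 s)%:R).
    apply: (Ex_union p_ge0 (C := fun s => B2 s || B3 s)) => s _.
    apply: contraNT; rewrite !negb_or /B2 /B3 -!ltNge => /and3P[/hasPn h1 h2 h3].
    apply/allP => j jn; have := h1 _ jn; rewrite -ltnNge => ->; rewrite andbT.
    rewrite occ_center addrC EKE lerD//.
      apply: ler_sum => t _; apply: ler_wpM2l => //; exact: sum_d.
    move: jn; rewrite mem_iota => /andP[j1 j2].
    have jD : (j - a * n <= 2 ^ (k + k))%N by rewrite -n2k leq_subLR ltnW.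
    have := chainP (Z N) (a * n) s jD; rewrite subnKC// => /le_lt_trans /(_ h3).
    have lt4 (x y : R) : 0 <= y -> x ^+ 4 < y ^+ 4 -> x < y.
      move=> y0 h; rewrite ltNge; apply/negP => yx.
      by move: h; rewrite ltNge lerXn2r// nnegrE// (le_trans y0).
    have br2 : 0 <= b * r / 2 by rewrite divr_ge0// mulr_ge0 ?ltW.
    by move=> /(lt4 _ _ br2); move: h2 => /(lt4 _ _ br2); lra.
  have u2 : Ex N (fun s => (B2 s || B3 s)%:R) <= Ex N (fun s => (B2 s)%:R) + Ex N (fun s => (B3 s)%:R).
    exact: Ex_union.
  have e1 : Ex N (fun s => (B1 s)%:R) <= 1 / 4.
    apply: le_trans htail.
    apply: (@le_trans _ _ (Ex N (fun s => \sum_(j <- iota (a * n) n) (m0 <= nth 0%N s j)%N%:R))).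
      apply: le_Ex => // s _; rewrite /B1; elim: (iota _ _) => [|j l IH]; first by rewrite big_nil.
      rewrite big_cons /=; case: (m0 <= _)%N; rewrite /= ?add0r// lerDl.
      exact: sumr_ge0.
    rewrite Ex_sum big_seq (eq_bigr (fun=> \sum_(t < m) p t * (m0 <= t)%N%:R)).
      by rewrite -big_seq sumr_const_seq || rewrite -big_seq big_const_seq count_predT size_iota iter_addr_0 mulr_natl.
    move=> j; rewrite mem_iota => /andP[j1 j2].
    apply: (Ex_nth p_sum (fun x => (m0 <= x)%N%:R)).
    by apply: leq_trans j2 _; rewrite addnC -mulSn leq_mul2r aN orbT.
  have e2 : Ex N (fun s => (B2 s)%:R) <= (c + 3 * c ^+ 2) * r ^+ 4 / (b * r / 2) ^+ 4.
    apply: le_trans (Ex_markov p_ge0 (F := fun s => Z N (a * n) s ^+ 4) br0 _ _) _ => [s _|s _ //|].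
      exact: pow4_ge0.
    rewrite ler_pM2r ?invr_gt0//; apply: le_trans (Z_mean4 N (a * n) (V := c * r ^+ 2) _) _; first by rewrite -EKE.
    have rr : 1 <= r ^+ 2 by rewrite exprn_ege1.
    rewrite (_ : r ^+ 4 = (r ^+ 2) ^+ 2); last by ring.
    set q := r ^+ 2 in rr *.
    have : c * q <= c * q ^+ 2 by rewrite ler_wpM2l// expr2 ler_peMl//; lra.
    by lra.
  have e3 : Ex N (fun s => (B3 s)%:R) <= A0 * r ^+ 4 / (b * r / 2) ^+ 4.
    apply: le_trans (Ex_markov p_ge0 (F := chain (Z N) (k + k) (a * n)) br0 _ _) _ => [s _|s _ //|].
      exact: chain_ge0.
    rewrite ler_pM2r ?invr_gt0// rk.
    have c14 : 0 <= 14 :> R by rewrite ler0n.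
    apply: le_trans (chain_mean c14 (Z_incr4 N) (k + k) (a * n)) _.
    by rewrite ler_wpM2r// exprn_ge0// ler0n.
  have e23 : (c + 3 * c ^+ 2) * r ^+ 4 / (b * r / 2) ^+ 4 + A0 * r ^+ 4 / (b * r / 2) ^+ 4 =
      16 * (A0 + c + 3 * c ^+ 2) / b ^+ 4.
    by rewrite br4; field; rewrite (gt_eqF b0) (gt_eqF r0).
  by lra.
have := Ex_harris_forall p_ge0 p_sum (n := N) (k := Nb) (A := A) (q := 1 / 2) _ dA hA.
move=> /(_ ltac:(lra)) /le_trans; apply; apply: le_Ex => // s _; rewrite ler_nat.
case: (boolP [forall _, _]) => // /forallP hs; rewrite lt0b; apply/allP => j.
rewrite mem_iota add0n => /andP[_ jN].
have n0 : (0 < n)%N by rewrite n4 expn_gt0.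
have jb : (j %/ n < Nb)%N by rewrite ltn_divLR.
have /allP := hs (Ordinal jb); apply; rewrite mem_iota /=.
by rewrite leq_divM {1}(divn_eq j n) ltn_add2l ltn_pmod.
Qed.

End mains.

(** * Block control of the arrival walk *)

Section walk.
Context {R : realFieldType}.
Variables (p : nat -> R) (m : nat).
Hypothesis p_ge0 : forall t, 0 <= p t.
Hypothesis p_sum : \sum_(t < m) p t = 1.
Local Notation Ex := (Ex p m).

Definition steady (xi : nat -> R) lam n k s := blocks (fun s' => ~~ exits xi lam 0 s') n k s.

(** The walk is restarted from 0 in each block, so the blocks are independent and the probabilities
    multiply. This replaces Harris's inequality, since a two-sided exit is not a monotone event. *)
Lemma steady_prob (xi : nat -> R) (sigma lam : R) n k : 0 < lam -> 0 <= sigma ->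
  \sum_(t < m) p t * xi t = 0 -> \sum_(t < m) p t * xi t ^+ 2 <= sigma ->
  n%:R * sigma / lam ^+ 2 <= 1 / 2 ->
  (1 / 2) ^+ k <= Ex (k * n) (fun s => (steady xi lam n k s)%:R).
Proof.
move=> lam0 sig0 xi1 xi2 hl; rewrite Ex_blocks//.
have h : 1 / 2 <= Ex n (fun s => (~~ exits xi lam 0 s)%:R).
  rewrite (Ex_indicatorC p_sum); under eq_Ex => s _ do rewrite negbK.
  have := kolmogorov p_ge0 p_sum n 0 lam0 sig0 xi1 xi2.
  rewrite expr0n add0r => h0; rewrite lerBrDr -lerBrDl.
  by apply: le_trans (le_trans h0 hl) _; lra.
by apply: lerXn2r h; rewrite nnegrE; [lra|apply: Ex_ge0].
Qed.

(** Each full block costs [lam]. The constant 3 counts the two partial blocks at the ends and one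
    block lost in rounding [(j - i) / n]. The loss is linear in [j - i], and is later absorbed as a
    small decrease of the mean gap. *)
Lemma steady_increment (xi : nat -> R) lam n k s i j : (0 < n)%N -> 0 < lam ->
  size s = (k * n)%N -> steady xi lam n k s -> (i <= j)%N -> (j < k * n)%N ->
  - (lam * ((j - i)%:R / n%:R + 3)) <= \sum_(i <= l < j) xi (nth 0%N s l).
Proof.
move=> n0 lam0 ss hs ij jN.
pose W a := \sum_(0 <= l < a) xi (nth 0%N s l).
have blk a b : (a < k)%N -> (b <= n)%N -> `|W (a * n + b)%N - W (a * n)%N| < lam.
  move=> ak bn; have := blocksP hs ak; set s' := take n _.
  have ss' : size s' = n.
    rewrite /s' size_takel// size_drop ss -mulnBl leq_pmull// subn_gt0//.
  move=> he; have := exitsN (j := b) he; rewrite ss' => /(_ bn); rewrite add0r.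
  congr (`|_| < _); rewrite /W (big_cat_nat (n := (a * n)%N))//= ?leq_addr// addrAC subrr add0r.
  rewrite -{1}[(a * n)%N]add0n big_addn addKn big_mkord; apply: eq_bigr => l _.
  by rewrite /s' nth_take ?nth_drop 1?addnC// (leq_trans (ltn_ord l)).
have grid a c : (a + c <= k)%N -> `|W ((a + c) * n)%N - W (a * n)%N| <= lam * c%:R.
  elim: c => [|c IH] ac; first by rewrite addn0 subrr normr0 mulr0.
  have h1 : (a + c < k)%N by lia.
  have := IH (ltnW h1); have := blk _ n h1 (leqnn n).
  rewrite addnS mulSn [(n + _)%N]addnC -natr1 mulrDr mulr1.
  set w1 := W _; set w2 := W _; set w3 := W _.
  by rewrite !(ler_norml, ltr_norml); lra.
have iN : (i < k * n)%N by lia.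
have bk a : (a < k * n)%N -> (a %/ n < k)%N by rewrite ltn_divLR.
have rem a : (a < k * n)%N -> `|W a - W (a %/ n * n)%N| < lam.
  by move=> aN; have := blk _ (a %% n)%N (bk a aN) (ltnW (ltn_pmod _ n0)); rewrite -divn_eq.
have ijn : (i %/ n <= j %/ n)%N by apply: leq_div2r.
have := grid (i %/ n)%N (j %/ n - i %/ n)%N; rewrite subnKC// => /(_ (ltnW (bk _ jN))).
have := rem _ iN; have := rem _ jN.
have -> : \sum_(i <= l < j) xi (nth 0%N s l) = W j - W i.
  have -> : W j = W i + \sum_(i <= l < j) xi (nth 0%N s l) by exact: big_cat_nat.
  by rewrite addrC addKr.
have c1 : (j %/ n - i %/ n)%:R <= (j - i)%:R / n%:R + 1 :> R.
  rewrite -lerBlDr ler_pdivlMr ?ltr0n// mulrBl mul1r -natrM lerBlDr -natrD ler_nat.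
  have := divn_eq i n; have := divn_eq j n; have := ltn_pmod i n0; have := ltn_pmod j n0.
  by rewrite mulnBl; lia.
have : lam * (j %/ n - i %/ n)%:R <= lam * ((j - i)%:R / n%:R + 1) by rewrite ler_pM2l.
set w1 := W _; set w2 := W _; set w3 := W _; set w4 := W _.
by rewrite !(ler_norml, ltr_norml); lra.
Qed.

End walk.

Local Open Scope classical_set_scope.
Local Open Scope ring_scope.

(** * Independence of generated sigma-algebras *)

Section probability.
Context {d} {Omega : measurableType d} {R : realType} (P : probability Omega R).

Definition pr (A : set Omega) : R := fine (P A).

Lemma prE A : measurable A -> P A = (pr A)%:E.
Proof. by move=> mA; rewrite /pr fineK// fin_num_measure. Qed.

Lemma pr_ge0 A : 0 <= pr A. Proof. exact: fine_ge0. Qed.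

Lemma pr_le1 A : measurable A -> pr A <= 1.
Proof. by move=> mA; rewrite -lee_fin -prE// probability_le1. Qed.

Lemma prT : pr setT = 1. Proof. by rewrite /pr probability_setT. Qed.

Lemma pr0 : pr set0 = 0. Proof. by rewrite /pr measure0. Qed.

Lemma le_pr A B : measurable A -> measurable B -> A `<=` B -> pr A <= pr B.
Proof. by move=> mA mB AB; rewrite -lee_fin -!prE// le_measure// inE. Qed.

Lemma prU A B : measurable A -> measurable B -> A `&` B = set0 ->
  pr (A `|` B) = pr A + pr B.
Proof.
move=> mA mB AB; apply: EFin_inj; rewrite EFinD -!prE//; last exact: measurableU.
by rewrite measureU.
Qed.

Lemma prC A : measurable A -> pr (~` A) = 1 - pr A.
Proof.
move=> mA; apply: EFin_inj; rewrite EFinB -!prE//; last exact: measurableC.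
by rewrite probability_setC.
Qed.

Lemma pr_setD A B : measurable A -> measurable B -> B `<=` A -> pr (A `\` B) = pr A - pr B.
Proof.
move=> mA mB BA; have mD := measurableD mA mB.
apply/eqP; rewrite eq_sym subr_eq -prU//; last by rewrite setDE -setIA setICl setI0.
by rewrite setDE setUIl setUCl setIT (setUidl BA).
Qed.

Lemma pr_leU A B : measurable A -> measurable B -> pr (A `|` B) <= pr A + pr B.
Proof.
move=> mA mB; rewrite -(setDUK (@subsetUl _ A B)) prU ?setDIK//.
- rewrite lerD2l; apply: le_pr => //; first by apply: measurableD => //; exact: measurableU.
  by move=> w [[]].
- by apply: measurableD => //; exact: measurableU.
Qed.

Lemma pr_big_le (I : Type) (r : seq I) (A : I -> set Omega) :
  (forall i, measurable (A i)) ->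
  pr (\big[setU/set0]_(i <- r) A i) <= \sum_(i <- r) pr (A i).
Proof.
move=> mA; elim: r => [|i r IH]; first by rewrite !big_nil pr0.
rewrite !big_cons; apply: le_trans (pr_leU _ _) _ => //; first exact: bigsetU_measurable.
by rewrite lerD2l.
Qed.

Lemma pr_bigcup_le (A : nat -> set Omega) (c : R) : (forall i, measurable (A i)) ->
  (forall n, pr (\big[setU/set0]_(i < n) A i) <= c) -> pr (\bigcup_i A i) <= c.
Proof.
move=> mA h; have mb : measurable (\bigcup_i A i) by exact: bigcup_measurable.
rewrite -lee_fin -prE// -bigcup_bigsetU_bigcup.
have nd : nondecreasing_seq (fun n => \big[setU/set0]_(i < n.+1) A i).
  move=> a b ab; apply/subsetPset => w; rewrite -!bigcup_mkord => -[i /= ia Aw].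
  by exists i => //=; apply: leq_trans ia _; rewrite ltnS.
have mF n : measurable (\big[setU/set0]_(i < n.+1) A i).
  by apply: bigsetU_measurable => i _.
have cv := nondecreasing_cvg_mu (mu := P) mF _ nd.
rewrite -(cvg_lim _ (cv _))//; last by rewrite bigcup_bigsetU_bigcup.
apply: lime_le; first by apply/cvg_ex; eexists; apply: cv; rewrite bigcup_bigsetU_bigcup.
by near=> n; move: (h n.+1); rewrite -lee_fin -prE.
Unshelve. all: by end_near. Qed.

End probability.

Section independence.
Context {d} {Omega : measurableType d} {R : realType} (P : probability Omega R).
Context {I : eqType} (D : set I) (G : I -> set (set Omega)).
Hypothesis Gm : forall i A, G i A -> measurable A.
Hypothesis GI : forall i, setI_closed (G i).
Hypothesis GT : forall i, G i setT.
Hypothesis indep : mutual_indep P D G.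

Definition gens (S : set I) : set (set Omega) := \bigcup_(i in S) G i.
Local Notation sig S := (<<s gens S >>).

Let cyl (S : set I) : set (set Omega) := [set B | exists s A, [/\ uniq s,
  (forall i, i \in s -> S i /\ G i (A i)) & B = \big[setI/setT]_(i <- s) A i]].

Lemma sig_measurable S A : sig S A -> measurable A.
Proof.
apply: (@smallest_sub _ _ _ (@measurable _ Omega)).
  by split; [exact: measurable0|move=> B mB; rewrite setTD; exact: measurableC|
             move=> F mF; exact: bigcup_measurable].
by move=> B [i Si GB]; apply: Gm GB.
Qed.

Lemma sub_sig S T : S `<=` T -> sig S `<=` sig T.
Proof. move=> ST; apply: sub_smallest2r; first exact: smallest_sigma_algebra.
by move=> A [i /ST Ti GA]; exists i. Qed.

Let bigI_all (s : seq I) (A B : I -> set Omega) :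
  \big[setI/setT]_(i <- s) A i `&` \big[setI/setT]_(i <- s) B i =
  \big[setI/setT]_(i <- s) (A i `&` B i).
Proof. by rewrite big_split. Qed.

Let cyl_ext (s t : seq I) (A : I -> set Omega) : uniq s -> uniq t -> {subset s <= t} ->
  \big[setI/setT]_(i <- s) A i = \big[setI/setT]_(i <- t) (if i \in s then A i else setT).
Proof.
move=> us ut st; rewrite -big_mkcond /=.
transitivity (\big[setI/setT]_(i <- [seq i <- t | i \in s]) A i); last by rewrite big_filter.
apply: perm_big.
apply: uniq_perm => //; first exact: filter_uniq.
by move=> i; rewrite mem_filter; case: (boolP (i \in s)) => // /st.
Qed.

Let cylI S : setI_closed (cyl S).
Proof.
move=> B C [s [A [us hA ->]]] [t [A' [ut hA' ->]]].
set u := undup (s ++ t).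
exists u, (fun i => (if i \in s then A i else setT) `&` (if i \in t then A' i else setT)).
split; first exact: undup_uniq.
  move=> i; rewrite mem_undup mem_cat => st; split.
    by move: st => /orP[/hA []|/hA' []].
  apply: GI; [case: ifP => [/hA []//|_]|case: ifP => [/hA' []//|_]]; exact: GT.
rewrite -bigI_all; congr (_ `&` _); apply: cyl_ext => //; try exact: undup_uniq.
  by move=> i si; rewrite mem_undup mem_cat si.
by move=> i si; rewrite mem_undup mem_cat si orbT.
Qed.

Let sig_cyl S : sig S `<=` <<d cyl S >>.
Proof.
rewrite (setI_closed_g_dynkin_g_sigma_algebra (@cylI S)); apply: sub_smallest2r; first exact: smallest_sigma_algebra.
move=> A [i Si GA]; exists [:: i], (fun=> A); split=> //; last by rewrite big_seq1.
by move=> j; rewrite inE => /eqP ->.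
Qed.

Let cyl_measurable S : cyl S `<=` measurable.
Proof.
move=> _ [s [A [us hA ->]]]; rewrite big_seq; apply: bigsetI_measurable => i si.
by apply: Gm (hA i si).2.
Qed.

Let indep_dynkin (B : set Omega) : measurable B ->
  dynkin [set A | measurable A /\ P (A `&` B) = (P A * P B)%E].
Proof.
move=> mB; split.
- by split=> //; rewrite setTI probability_setT mul1e.
- move=> A [mA AB]; split; first exact: measurableC.
  have mAB := measurableI _ _ mA mB; have mC := measurableC mA.
  rewrite (prE P (measurableI _ _ mC mB)) (prE P mC) (prE P mB) -EFinM; congr (_%:E).
  have -> : ~` A `&` B = B `\` (A `&` B).
    by rewrite setDE setCI setIUr setICr setU0 setIC.
  rewrite pr_setD//.
  rewrite prC// mulrBl mul1r; congr (_ - _).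
  by apply: EFin_inj; rewrite EFinM -(prE P mA) -(prE P mB) -(prE P mAB).
- move=> F tF hF; split; first by apply: bigcup_measurable => k _; apply: (hF k).1.
  rewrite setI_bigcupl measure_semi_bigcup; first last.
  + by apply: bigcup_measurable => k _; apply: measurableI => //; apply: (hF k).1.
  + by apply/trivIsetP => i j _ _ ij; move/trivIsetP: tF => /(_ i j Logic.I Logic.I ij) h;
       rewrite setIACA h set0I.
  + by move=> i; apply: measurableI => //; apply: (hF i).1.
  rewrite measure_semi_bigcup//; last by apply: bigcup_measurable => k _; apply: (hF k).1.
    rewrite (prE P mB) muleC -nneseriesZl//; apply: eq_eseriesr => i _.
    by have [_ /= ->] := hF i; rewrite muleC (prE P mB).
  by move=> i; apply: (hF i).1.
Qed.

(** The pi-lambda argument run twice: [A], then [B], is reduced to a finite intersection of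
    generators, and there the definition of independence applies to the concatenated index list. *)
Lemma indep_sig S T A B : S `<=` D -> T `<=` D -> S `&` T = set0 ->
  sig S A -> sig T B -> P (A `&` B) = (P A * P B)%E.
Proof.
move=> SD TD ST sA sB.
suff {A sA} step1 A : cyl S A -> P (A `&` B) = (P A * P B)%E.
  have mB := sig_measurable sB.
  have : [set A | measurable A /\ P (A `&` B) = (P A * P B)%E] A; last by case.
  apply: (smallest_sub (indep_dynkin mB)) (sig_cyl sA) => C cC; split; last exact: step1.
  exact: cyl_measurable cC.
move=> cA; have mA := cyl_measurable cA.
suff {B sB} step2 B : cyl T B -> P (A `&` B) = (P A * P B)%E.
  have : [set B | measurable B /\ P (B `&` A) = (P B * P A)%E] B.
    apply: (smallest_sub (indep_dynkin mA)) (sig_cyl sB) => C cC; split.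
      exact: cyl_measurable cC.
    by rewrite setIC step2// muleC.
  by rewrite setIC muleC => -[].
case: cA => s [A' [us hA' ->]] [t [B' [ut hB' ->]]].
have dst i : i \in s -> i \in t -> False.
  move=> /hA' [Si _] /hB' [Ti _]; have : (S `&` T) i by split.
  by rewrite ST.
(* One family of events for both lists; consistent because the lists are disjoint. *)
pose C i := if i \in s then A' i else B' i.
have eA : \big[setI/setT]_(i <- s) A' i = \big[setI/setT]_(i <- s) C i.
  by rewrite big_seq [RHS]big_seq; apply: eq_bigr => i si; rewrite /C si.
have eB : \big[setI/setT]_(i <- t) B' i = \big[setI/setT]_(i <- t) C i.
  rewrite big_seq [RHS]big_seq; apply: eq_bigr => i ti; rewrite /C.
  by case: ifP => // si; case: (dst i).
have hs i : i \in s -> D i /\ G i (C i).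
  by move=> si; have [/SD Di] := hA' i si; rewrite /C si.
have ht i : i \in t -> D i /\ G i (C i).
  move=> ti; have [/TD Di] := hB' i ti; rewrite /C; case: ifP => // si; by case: (dst i).
rewrite eA eB -big_cat (indep (s := s ++ t)).
- by rewrite big_cat EFinM (indep us hs) (indep ut ht).
- rewrite cat_uniq us ut /= andbT; apply/hasPn => i ti; apply/negP => si; exact: (dst i).
- by move=> i; rewrite mem_cat => /orP[/hs|/ht].
Qed.

End independence.

(** * From the probability space to finite words *)

Section bridge.
Context {d} {Omega : measurableType d} {R : realType} (P : probability Omega R).

Lemma pr_split (q : Omega -> nat) m (B : set Omega) : (forall w, (q w < m)%N) ->
  (forall t, measurable (q @^-1` [set t])) -> measurable B ->
  pr P B = \sum_(t < m) pr P (q @^-1` [set nat_of_ord t] `&` B).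
Proof.
move=> qm mq mB.
have mle k : measurable (q @^-1` [set t | (t < k)%N]).
  rewrite (_ : _ @^-1` _ = \big[setU/set0]_(t < k) (q @^-1` [set nat_of_ord t])).
    exact: bigsetU_measurable.
  rewrite -(bigcup_mkord k (fun t => q @^-1` [set t])); apply/seteqP; split=> w /=; first by exists (q w).
  by move=> [t /= tk ->].
have main k : pr P (q @^-1` [set t | (t < k)%N] `&` B) = \sum_(t < k) pr P (q @^-1` [set nat_of_ord t] `&` B).
  elim: k => [|k IH].
    by rewrite big_ord0 (_ : _ `&` _ = set0) ?pr0//; apply/seteqP; split => w // [].
  rewrite big_ord_recr /= -IH -prU; first last.
  - by apply/seteqP; split => w // [[/= h1 _] [h2 _]]; move: h1; rewrite h2 ltnn.
  - exact: measurableI.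
  - exact: measurableI.
  rewrite -setIUl; congr (pr P (_ `&` B)); apply/seteqP; split => w /=.
    by rewrite ltnS leq_eqVlt => /orP[/eqP|]; [right|left].
  by move=> [h|->]; rewrite ?ltnS ?leqnn// ltnW.
by rewrite -main; congr (pr P _); apply/seteqP; split=> w; [move=> Bw; split=> //=|case].
Qed.

Context {I : eqType} (D : set I) (G : I -> set (set Omega)).
Hypothesis Gm : forall i A, G i A -> measurable A.
Hypothesis GI : forall i, setI_closed (G i).
Hypothesis GT : forall i, G i setT.
Hypothesis indep : mutual_indep P D G.
Local Notation sig S := (<<s gens G S >>).

Lemma sig_setT S : sig S setT.
Proof.
have [h0 hC _] := smallest_sigma_algebra setT (gens G S).
by have := hC _ h0; rewrite setTD setC0.
Qed.

Lemma sigC S A : sig S A -> sig S (~` A).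
Proof.
have [h0 hC _] := smallest_sigma_algebra setT (gens G S).
by move=> /hC; rewrite setTD.
Qed.

Lemma sig_bigcup S (A : nat -> set Omega) : (forall i, sig S (A i)) -> sig S (\bigcup_i A i).
Proof. by have [h0 hC hU] := smallest_sigma_algebra setT (gens G S); apply: hU. Qed.

Lemma sig_bigcap S (A : nat -> set Omega) : (forall i, sig S (A i)) -> sig S (\bigcap_i A i).
Proof.
move=> h; rewrite -[\bigcap_i _]setCK setC_bigcap; apply: sigC; apply: sig_bigcup => i.
exact: sigC.
Qed.

Lemma sigI S A B : sig S A -> sig S B -> sig S (A `&` B).
Proof. by move=> sA sB; rewrite -bigcap2E; apply: sig_bigcap => -[|[|i]] //=; exact: sig_setT. Qed.

(** The events [A k] are absorbed into [H] one at a time while [T] grows by [S k]. In use, [H] is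
    the past of a trial and [A k] is the window of one route. *)
Lemma indep_sig_big (K : eqType) (c : seq K) (S : K -> set I) (T : set I)
    (A : K -> set Omega) (H : set Omega) :
  uniq c -> (forall k, S k `<=` D) -> T `<=` D ->
  (forall k l, k != l -> S k `&` S l = set0) -> (forall k, k \in c -> T `&` S k = set0) ->
  (forall k, sig (S k) (A k)) -> sig T H ->
  pr P (H `&` \big[setI/setT]_(k <- c) A k) = pr P H * \prod_(k <- c) pr P (A k).
Proof.
move=> uc SD + SS + sA.
elim: c T H uc => [|k c IH] T H uc TD TS sH.
  by rewrite !big_nil setIT mulr1.
move: uc => /= /andP[kc uc]; rewrite !big_cons setIA mulrA.
have sHA : sig (T `|` S k) (H `&` A k).
  by apply: sigI; [apply: (sub_sig (@subsetUl _ T (S k)))|apply: (sub_sig (@subsetUr _ T (S k)))].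
have e : pr P (H `&` A k) = pr P H * pr P (A k).
  rewrite /pr (indep_sig Gm GI GT indep TD (SD k) (TS k (mem_head _ _)) sH (sA k)) fineM//.
    exact: fin_num_measure (sig_measurable Gm sH).
  exact: fin_num_measure (sig_measurable Gm (sA k)).
rewrite -e; apply: (IH (T `|` S k)) => //; first by rewrite subUset.
move=> j jc; rewrite setIUl TS ?inE ?jc ?orbT// SS ?setU0//.
by apply: contraNneq kc => ->.
Qed.

Lemma pr_indep S T A B : S `<=` D -> T `<=` D -> S `&` T = set0 ->
  sig S A -> sig T B -> pr P (A `&` B) = pr P A * pr P B.
Proof.
move=> SD TD ST sA sB; rewrite /pr (indep_sig Gm GI GT indep SD TD ST sA sB) fineM//.
  exact: fin_num_measure (sig_measurable Gm sA).
exact: fin_num_measure (sig_measurable Gm sB).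
Qed.

(* Reduces events on finitely many quantized coordinates to the finite model [Ex]. *)
Lemma pr_Ex n (c : nat -> I) (q : nat -> Omega -> nat) (p : nat -> R) m (A : pred (seq nat)) :
  injective c -> (forall i, D (c i)) -> (forall i w, (q i w < m)%N) ->
  (forall i B, sig [set c i] (q i @^-1` B)) ->
  (forall i t, pr P (q i @^-1` [set t]) = p t) ->
  let E := [set w | A (mkseq (q^~ w) n)] in
  sig [set c i | i in [set i | (i < n)%N]] E /\ pr P E = Ex p m n (fun s => (A s)%:R).
Proof.
elim: n c q A => [|n IH] c q A cI cD qm sq pq /=.
  case: (A [::]); rewrite /=.
    rewrite (_ : [set _ | true] = setT); last by apply/seteqP.
    by split; [exact: sig_setT|exact: prT].
  rewrite (_ : [set _ | false] = set0); last by apply/seteqP; split.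
  by split; [rewrite -setCT; apply: sigC; exact: sig_setT|exact: pr0].
have mq i B : measurable (q i @^-1` B).
  exact: (sig_measurable Gm (sq i B)).
pose E' (t : nat) := [set w | A (t :: mkseq (fun i => q i.+1 w) n)].
have hE' t := IH (c \o S) (q \o S) (fun s => A (t :: s))
  (inj_comp cI succn_inj) (fun i => cD _) (fun i => qm _) (fun i => sq _) (fun i => pq _).
have EE t : q 0%N @^-1` [set t] `&` [set w | A (mkseq (q^~ w) n.+1)] = q 0%N @^-1` [set t] `&` E' t.
  have ms w : mkseq (q^~ w) n.+1 = q 0%N w :: mkseq (fun i => q i.+1 w) n.
    by rewrite /mkseq /= (iotaDl 1 0) -map_comp.
  by apply/seteqP; split => w /= -[h1]; rewrite /E' /= ms h1.
have sub1 : [set c 0%N] `<=` [set c i | i in [set i | (i < n.+1)%N]].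
  by move=> _ ->; exists 0%N.
have sub2 : [set (c \o S) i | i in [set i | (i < n)%N]] `<=` [set c i | i in [set i | (i < n.+1)%N]].
  by move=> _ [i /= ilt <-]; exists i.+1.
have sE : sig [set c i | i in [set i | (i < n.+1)%N]] [set w | A (mkseq (q^~ w) n.+1)].
  rewrite (_ : [set w | _] = \bigcup_t (q 0%N @^-1` [set t] `&` E' t)).
    apply: sig_bigcup => t; apply: sigI; first exact: (sub_sig sub1 (sq 0%N _)).
    exact: (sub_sig sub2 (hE' t).1).
  apply/seteqP; split=> w.
    by move=> Aw; exists (q 0%N w) => //; rewrite -EE.
  by move=> [t _]; rewrite -EE => -[].
have cDn k : [set c i | i in [set i | (i < k)%N]] `<=` D by move=> _ [i _ <-].
split=> //; rewrite (pr_split (qm 0%N) (fun t => mq 0%N [set t])); last exact: (sig_measurable Gm sE).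
apply: eq_bigr => t _; rewrite EE.
rewrite (pr_indep (S := [set c 0%N]) (T := [set (c \o S) i | i in [set i | (i < n)%N]]) _ _ _ (sq 0%N _) (hE' t).1).
- by rewrite pq (hE' t).2.
- by move=> _ ->.
- by move=> _ [i _ <-]; apply: cD.
- by apply/seteqP; split => // _ [-> [i _ /cI]].
Qed.

End bridge.

(** * Quantization *)

Section quantizer.
Context {R : realType}.

Definition quant (theta : nat -> R) (cap : nat) (x : R) : nat :=
  \sum_(k < cap) (theta k < x)%R.

Lemma quant_lt theta cap x : (quant theta cap x < cap.+1)%N.
Proof.
rewrite ltnS /quant -[leqRHS]card_ord -sum1_card.
by apply: leq_sum => k _; case: (_ < _).
Qed.

(** Monotone thresholds turn events on the letter into half-lines in [x]. This yields measurability,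
    and allows the letter to be read as a rounding of [x] in either direction. *)
Lemma quantE theta cap x : {homo theta : i j / (i <= j)%N >-> i <= j} ->
  forall i, (i < quant theta cap x)%N = (i < cap)%N && (theta i < x).
Proof.
move=> th; rewrite /quant; elim: cap => [|cap IH] i; first by rewrite big_ord0.
rewrite big_ord_recr /=; case: (ltP (theta cap) x) => h; last first.
  rewrite addn0 IH ltnS; case: (ltnP i cap) => ic; first by rewrite (ltnW ic).
  rewrite /=; case: leqP => //= ic'.
  by have -> : i = cap; [lia|rewrite ltNge h].
have -> : (\sum_(k < cap) (theta k < x)%R = cap)%N.
  rewrite -[RHS]card_ord -sum1_card; apply: eq_bigr => k _.
  by rewrite (le_lt_trans (th _ _ (ltnW (ltn_ord k))) h).
rewrite addn1; case: ltnP => //= ic; rewrite (le_lt_trans _ h)//.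
exact: th.
Qed.

Lemma quant_measurable theta cap (B : set nat) : {homo theta : i j / (i <= j)%N >-> i <= j} ->
  measurable (quant theta cap @^-1` B).
Proof.
move=> th.
have mle i : measurable (quant theta cap @^-1` [set t | (i < t)%N]).
  rewrite (_ : _ @^-1` _ = if (i < cap)%N then `]theta i, +oo[%classic else set0).
    by case: ifP.
  apply/seteqP; split => x /=; rewrite quantE//; case: ifP => //= _.
    by rewrite in_itv /= andbT.
  by rewrite in_itv /= andbT.
rewrite (_ : _ @^-1` B = \bigcup_(t in B) (quant theta cap @^-1` [set t])); last first.
  by apply/seteqP; split => [x Bx|x [t Bt /= ->]//]; exists (quant theta cap x).
apply: bigcup_measurable => t _.
rewrite (_ : _ @^-1` _ = (if t is t'.+1 then quant theta cap @^-1` [set u | (t' < u)%N] else setT)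
   `\` quant theta cap @^-1` [set u | (t < u)%N]); last first.
  case: t => [|t]; apply/seteqP; split => x /=.
  - by move=> ->.
  - by move=> [_ /negP]; rewrite -leqNgt leqn0 => /eqP.
  - by move=> ->; rewrite ltnSn ltnn.
  - by move=> [h1 /negP]; lia.
by apply: measurableD => //; case: t.
Qed.

Variable mu : probability R R.

Lemma quant_integral (q : R -> nat) m (f : nat -> R) :
  (forall x, (q x < m)%N) -> (forall t, measurable (q @^-1` [set t])) -> (forall t, 0 <= f t) ->
  (\int[mu]_x (f (q x))%:E)%E = (\sum_(t < m) pr mu (q @^-1` [set nat_of_ord t]) * f t)%:E.
Proof.
move=> qm mq f0.
have -> : (fun x => (f (q x))%:E) =
    (fun x => \sum_(t < m) ((f t)%:E * (\1_(q @^-1` [set nat_of_ord t]) x)%:E)%E)%E.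
  apply/funext => x; rewrite (bigD1 (Ordinal (qm x)))//= big1 ?adde0.
    by rewrite indicE mem_set// mule1.
  move=> t; rewrite -val_eqE /= => tq; rewrite indicE memNset ?mule0//= => qt.
  by move: tq; rewrite -qt eqxx.
have m1 (t : 'I_m) : measurable_fun setT (EFin \o (\1_(q @^-1` [set nat_of_ord t]) : R -> R)).
  by apply/measurable_EFinP; exact: measurable_indic.
rewrite ge0_integral_sum//; first last.
- by move=> t x _; rewrite -EFinM lee_fin mulr_ge0// indicE.
- by move=> t; exact: (measurable_funeM _ (m1 t)).
rewrite -sumEFin; apply: eq_bigr => t _.
rewrite ge0_integralZl_EFin => //; try exact: m1.
by rewrite integral_indic// setIT muleC EFinM -prE.
Qed.

Lemma measurable_quant (q : R -> nat) m (f : nat -> R) :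
  (forall x, (q x < m)%N) -> (forall t, measurable (q @^-1` [set t])) ->
  measurable_fun setT (fun x => f (q x)).
Proof.
move=> qm mq _ B mB; rewrite setTI.
rewrite (_ : _ @^-1` B = \bigcup_(t in [set t | B (f t)]) (q @^-1` [set t])).
  exact: bigcup_measurable.
by apply/seteqP; split => [x Bx|x [t Bt /= ->]//]; exists (q x).
Qed.

Lemma quant_mean_le (q : R -> nat) m (f : nat -> R) (A : set R) (phi : R -> R) (c : R) :
  (forall x, (q x < m)%N) -> (forall t, measurable (q @^-1` [set t])) -> (forall t, 0 <= f t) ->
  measurable A -> mu (~` A) = 0%E -> measurable_fun setT phi -> (forall x, 0 <= phi x) ->
  (\int[mu]_x (phi x)%:E <= c%:E)%E -> (forall x, A x -> f (q x) <= phi x) ->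
  \sum_(t < m) pr mu (q @^-1` [set nat_of_ord t]) * f t <= c.
Proof.
move=> qm mq f0 mA A0 mphi phi0 hc h.
rewrite -lee_fin -quant_integral//; apply: le_trans hc.
apply: ae_ge0_le_integral => //.
- by move=> x _; rewrite lee_fin.
- by apply/measurable_EFinP; exact: measurable_quant qm mq.
- by move=> x _; rewrite lee_fin.
- exact/measurable_EFinP.
exists (~` A); split=> //; first exact: measurableC.
by move=> x /= hx Ax; apply: hx => _; rewrite lee_fin h.
Qed.

(** [psi] pays for what rounding and truncation remove from [phi]; [A] discards a null set. *)
Lemma quant_mean_ge (q : R -> nat) m (f : nat -> R) (A : set R) (phi psi : R -> R) (a c : R) :
  (forall x, (q x < m)%N) -> (forall t, measurable (q @^-1` [set t])) -> (forall t, 0 <= f t) ->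
  measurable A -> mu (~` A) = 0%E -> measurable_fun setT phi -> (forall x, 0 <= phi x) ->
  measurable_fun setT psi -> (forall x, 0 <= psi x) ->
  (a%:E <= \int[mu]_x (phi x)%:E)%E -> (\int[mu]_x (psi x)%:E <= c%:E)%E ->
  (forall x, A x -> phi x <= f (q x) + psi x) ->
  a <= \sum_(t < m) pr mu (q @^-1` [set nat_of_ord t]) * f t + c.
Proof.
move=> qm mq f0 mA A0 mphi phi0 mpsi psi0 ha hc h.
rewrite -lee_fin EFinD -quant_integral//; apply: le_trans ha _.
apply: le_trans (leeD2l _ hc).
rewrite -ge0_integralD//; first last.
- exact/measurable_EFinP.
- by move=> x _; rewrite lee_fin.
- by apply/measurable_EFinP; exact: measurable_quant qm mq.
- by move=> x _; rewrite lee_fin.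
have mf := measurable_quant f qm mq.
apply: ae_ge0_le_integral => //.
- by move=> x _; rewrite lee_fin.
- exact/measurable_EFinP.
- by move=> x _; rewrite -EFinD lee_fin addr_ge0.
- by apply/measurable_EFinP; exact: measurable_funD.
exists (~` A); split=> //; first exact: measurableC.
by move=> x /= hx Ax; apply: hx => _; rewrite -EFinD lee_fin h.
Qed.

Lemma tail_moment (n : nat) (c y : R) : 0 < y ->
  (\int[mu]_x (`|x| ^+ n)%:E <= c%:E)%E -> pr mu `]y, +oo[%classic <= c / y ^+ n.
Proof.
move=> y0 hc; rewrite ler_pdivlMr ?exprn_gt0// -lee_fin; apply: le_trans hc.
rewrite EFinM -prE// muleC -[X in (_ * mu X)%E]setIT -integral_indic//.
have m1 : measurable_fun setT (EFin \o (\1_`]y, +oo[%classic : R -> R)).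
  by apply/measurable_EFinP; exact: measurable_indic.
rewrite -ge0_integralZl_EFin ?exprn_ge0 ?(ltW y0)//.
apply: ge0_le_integral => //.
- by move=> x _; rewrite -EFinM lee_fin mulr_ge0 ?exprn_ge0 ?(ltW y0)// indicE.
- exact: (measurable_funeM _ m1).
- apply/measurable_EFinP; apply: measurable_funX.
  exact: normr_measurable.
move=> x _; rewrite -EFinM lee_fin indicE; case: (boolP (_ \in _)) => xy; last first.
  by rewrite mulr0 exprn_ge0.
rewrite mulr1; move: xy; rewrite inE /= in_itv /= andbT => xy.
by apply: lerXn2r; rewrite ?nnegrE ?(ltW y0)// (le_trans (ltW xy))// ler_norm.
Qed.

End quantizer.

(** * One route after its passage time *)

Section laws.
Context {R : realType} (mu : probability R R).

Lemma quant_law_sum theta cap : {homo theta : i j / (i <= j)%N >-> i <= j} ->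
  \sum_(t < cap.+1) pr mu (quant theta cap @^-1` [set nat_of_ord t]) = 1 :> R.
Proof.
move=> th; rewrite -(prT mu).
rewrite (pr_split (q := quant theta cap) mu (m := cap.+1)) //; first last.
- by move=> t; exact: quant_measurable.
- by move=> x; exact: quant_lt.
by apply: eq_bigr => t _; rewrite setIT.
Qed.

Lemma integral_affine (phi : R -> R) (a b c : R) : 0 <= a -> 0 <= b ->
  measurable_fun setT phi -> (forall x, 0 <= phi x) -> (\int[mu]_x (phi x)%:E <= c%:E)%E ->
  (\int[mu]_x (a + b * phi x)%:E <= (a + b * c)%:E)%E.
Proof.
move=> a0 b0 mphi phi0 hc.
have mphiE : measurable_fun setT (EFin \o phi) by exact/measurable_EFinP.
have -> : (fun x => (a + b * phi x)%:E) = (fun x => (cst a%:E) x + b%:E * (phi x)%:E)%E.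
  by apply/funext => x; rewrite EFinD EFinM.
rewrite ge0_integralD//; first last.
- exact: (measurable_funeM _ mphiE).
- by move=> x _; rewrite -EFinM lee_fin mulr_ge0.
have -> : (\int[mu]_x (cst a%:E : R -> \bar R) x = a%:E)%E.
  by rewrite integral_cst// -[RHS]mule1; congr (_ * _)%E; exact: probability_setT.
rewrite EFinD leeD2l//.
rewrite ge0_integralZl_EFin//; last by move=> x _; rewrite lee_fin.
by rewrite EFinM lee_wpmul2l ?lee_fin.
Qed.

End laws.

Section windows.
Context {d} {Omega : measurableType d} {R : realType} (P : probability Omega R).
Context {I : eqType} (D : set I) (G : I -> set (set Omega)).
Hypothesis Gm : forall i A, G i A -> measurable A.
Hypothesis GI : forall i, setI_closed (G i).
Hypothesis GT : forall i, G i setT.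
Hypothesis indep : mutual_indep P D G.
Local Notation sig S := (<<s gens G S >>).

Variables (mu : probability R R) (c : nat -> I) (x : nat -> Omega -> R).
Hypothesis c_inj : injective c.
Hypothesis cD : forall i, D (c i).
Hypothesis x_sig : forall i B, measurable B -> sig [set c i] (x i @^-1` B).
Hypothesis x_law : forall i B, measurable B -> P (x i @^-1` B) = mu B.

Lemma pr_quant theta cap n (A : pred (seq nat)) :
  {homo theta : i j / (i <= j)%N >-> i <= j} ->
  let E := [set w | A (mkseq (fun i => quant theta cap (x i w)) n)] in
  sig [set c i | i in [set i | (i < n)%N]] E /\
  pr P E = Ex (fun t => pr mu (quant theta cap @^-1` [set t])) cap.+1 n (fun s => (A s)%:R).
Proof.
move=> th; apply: (pr_Ex Gm GI GT indep n (q := fun i w => quant theta cap (x i w))) => //.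
- by move=> i w; exact: quant_lt.
- by move=> i B; exact: (x_sig (quant_measurable cap B th)).
- by move=> i t; rewrite /pr (x_law i (B := quant theta cap @^-1` [set t]))//; exact: quant_measurable.
Qed.

(** The loss per step is [(1 + m2) / r] twice: once as the bias of the quantized mean, once as the
    walk's deviation [(1 + m2) r] spread over a block of [r ^ 2] steps. The last term comes from the
    ends in [steady_increment]. Absolute values avoid a null set where gaps are not positive. *)
Lemma walk_event (m m2 r : R) n Nb : (0 < n)%N -> 1 <= r -> r ^+ 2 = n%:R -> 0 <= m2 ->
  mu `]-oo, 0%R]%classic = 0%E ->
  (\int[mu]_x `|x|%:E = m%:E)%E -> (\int[mu]_x (x ^+ 2)%:E <= m2%:E)%E ->
  exists E, [/\ sig [set c i | i in [set i | (i < Nb * n)%N]] E, (1 / 2) ^+ Nb <= pr P E &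
    forall w, E w -> forall i j, (i <= j)%N -> (j < Nb * n)%N ->
      (j - i)%:R * (m - 2 * (1 + m2) / r) - 3 * (1 + m2) * r <= \sum_(i <= l < j) `|x l w|].
Proof.
move=> n0 r1 rn m20 mu0 hm hm2; set La := 1 + m2.
have r0 : 0 < r by lra.
have n1 : 0 < n%:R :> R by rewrite ltr0n.
(* Mesh [1 / r], and [n = r ^ 2] thresholds, so values are rounded down to the grid and cut at [r].
   Below the cut the error is at most [1 / r]; above it, [y r <= r ^ 2 + y ^ 2] bounds it by
   [y ^ 2 / r]. *)
pose theta (k : nat) : R := k.+1%:R / r.
have th : {homo theta : i j / (i <= j)%N >-> i <= j}.
  by move=> i j ij; rewrite /theta ler_pM2r ?invr_gt0// ler_nat ltnS.
pose q := quant theta n; pose p t := pr mu (q @^-1` [set t]).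
pose va (t : nat) : R := t%:R / r.
have va0 t : 0 <= va t by rewrite /va divr_ge0// ltW.
have qm y : (q y < n.+1)%N by exact: quant_lt.
have mq t : measurable (q @^-1` [set t]) by exact: quant_measurable.
have p0 t : 0 <= p t by exact: pr_ge0.
have p1 : \sum_(t < n.+1) p t = 1 by exact: quant_law_sum.
pose mv := \sum_(t < n.+1) p t * va t.
have va_le y : va (q y) <= `|y|.
  case E : (q y) => [|j]; first by rewrite /va mul0r.
  have := quantE n y th j; rewrite -/q E ltnSn => /esym /andP[_ h].
  by apply: ltW; apply: lt_le_trans h (ler_norm _).
have va_ge y : 0 < y -> y <= va (q y) + (1 + y ^+ 2) / r.
  move=> y0; case: (ltnP (q y) n) => qn.
    have := quantE n y th (q y); rewrite -/q ltnn qn /= => /esym /negbT; rewrite -leNgt => h.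
    apply: le_trans h _; rewrite /theta /va -mulrDl ler_pM2r ?invr_gt0// -natr1.
    by have := sqr_ge0 y; lra.
  have qE : q y = n by apply/eqP; rewrite eqn_leq qn andbT -ltnS.
  have vq : va (q y) = r by rewrite /va qE -rn expr2 mulfK// gt_eqF.
  rewrite vq -(ler_pM2r r0) mulrDl divfK ?gt_eqF//.
  have := sqr_ge0 (y - r); have := sqr_ge0 y; have := sqr_ge0 r; nra.
pose A0 : set R := `]0%R, +oo[%classic.
have mA : measurable A0 by exact: measurable_itv.
have A00 : mu (~` A0) = 0%E by rewrite setCitvr.
have msq : measurable_fun setT (fun y : R => y ^+ 2) by exact: measurable_funX.
have mnorm : measurable_fun setT (fun y : R => `|y|) by exact: normr_measurable.
have mv_ge : m <= mv + (1 + m2) / r.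
  apply: (quant_mean_ge (mu := mu) (q := q) (f := va) (A := A0)
    (phi := fun y => `|y|) (psi := fun y => (1 + 1 * y ^+ 2) / r)) => //.
  - by apply: measurable_funM => //; apply: measurable_funD => //; exact: measurable_funM.
  - by move=> y; apply: divr_ge0; [rewrite mul1r addr_ge0 ?sqr_ge0|exact: ltW].
  - by rewrite hm.
  - under eq_integral => y _ do rewrite mulrC mulrDr mulr1 mul1r.
    rewrite [leRHS](_ : _ = (r^-1 + r^-1 * m2)%:E); last by congr EFin; field; rewrite gt_eqF.
    by apply: integral_affine; rewrite ?invr_ge0 ?(ltW r0)// => y; exact: sqr_ge0.
  - by move=> y; rewrite /A0 /= in_itv /= andbT mul1r => y0; rewrite gtr0_norm//; exact: va_ge.
have m2_ge : \sum_(t < n.+1) p t * va t ^+ 2 <= m2.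
  apply: (quant_mean_le (mu := mu) (q := q) (f := fun t => va t ^+ 2) (A := setT)
    (phi := fun y => y ^+ 2)) => //.
  - by move=> t; exact: sqr_ge0.
  - by rewrite setCT measure0.
  - by move=> y; exact: sqr_ge0.
  - by move=> y _; rewrite -[leRHS]real_normK ?num_real// lerXn2r ?nnegrE// va_le.
pose xi t := va t - mv.
have xi1 : \sum_(t < n.+1) p t * xi t = 0.
  by under eq_bigr do rewrite mulrBr; rewrite sumrB -mulr_suml p1 mul1r subrr.
have xi2 : \sum_(t < n.+1) p t * xi t ^+ 2 <= m2.
  rewrite (eq_bigr (fun t : 'I_n.+1 => p t * va t ^+ 2 + (p t * va t * (- 2 * mv) + p t * mv ^+ 2))).
    by rewrite !big_split /= -!mulr_suml p1 -/mv; have := sqr_ge0 mv; lra.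
  by move=> t _; rewrite /xi; ring.
have La0 : 0 < La by rewrite /La; lra.
have lam0 : 0 < La * r by rewrite mulr_gt0.
have hl : n%:R * m2 / (La * r) ^+ 2 <= 1 / 2.
  rewrite exprMn rn ler_pdivrMr; last by rewrite mulr_gt0// exprn_gt0.
  have : 2 * m2 <= La ^+ 2 by rewrite /La; have := sqr_ge0 m2; nra.
  by have := ltW n1; nra.
have pst := steady_prob p0 p1 Nb lam0 m20 xi1 xi2 hl.
have [sE pE] := pr_quant n (Nb * n)%N (steady xi (La * r) n Nb) th.
exists [set w | steady xi (La * r) n Nb (mkseq (fun i => quant theta n (x i w)) (Nb * n))].
split=> //; first by rewrite pE.
move=> w /= sw i j ij jN.
have := steady_increment n0 lam0 (size_mkseq _ _) sw ij jN.
rewrite (_ : \sum_(i <= l < j) xi _ = \sum_(i <= l < j) va (q (x l w)) - (j - i)%:R * mv); last first.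
  rewrite big_nat [in RHS]big_nat.
  rewrite (eq_bigr (fun l => va (q (x l w)) - mv)) => [|l /andP[_ lj]].
    by rewrite sumrB -!big_nat big_const_nat iter_addr_0 mulr_natl.
  by rewrite /xi nth_mkseq//; apply: ltn_trans lj jN.
have : \sum_(i <= l < j) va (q (x l w)) <= \sum_(i <= l < j) `|x l w|.
  by apply: ler_sum => l _; exact: va_le.
have -> : La * r * ((j - i)%:R / n%:R + 3) = (j - i)%:R * (La / r) + 3 * La * r.
  by rewrite -rn; field; rewrite gt_eqF.
have : (j - i)%:R * m <= (j - i)%:R * (mv + La / r) by rewrite ler_wpM2l.
have -> : (j - i)%:R * (m - 2 * La / r) = (j - i)%:R * m - 2 * ((j - i)%:R * (La / r)) by ring.
have -> : (j - i)%:R * (mv + La / r) = (j - i)%:R * mv + (j - i)%:R * (La / r) by ring.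
by lra.
Qed.

(* The weights [expR (eta - eta0)] and [expR eta] have mean at most 1, so that Ville's
   inequality applies to their products. *)
Lemma walk_tail (eta0 eta y : R) J : 0 < eta0 ->
  pr mu `]eta0, +oo[%classic * expR (eta - eta0) + (1 - pr mu `]eta0, +oo[%classic) * expR eta <= 1 ->
  exists E, [/\ sig [set c i | i in [set i | (i < J)%N]] E, 1 - expR (- y) <= pr P E &
    forall w, E w -> forall j, (j <= J)%N -> eta * j%:R - y <= \sum_(0 <= l < j) `|x l w|].
Proof.
move=> eta00 he.
(* A single threshold is enough: each gap is replaced by [eta0] or by 0, and the product of [f] is
   the exponential of [eta j] minus the reduced sum. *)
pose theta (k : nat) : R := eta0.
have th : {homo theta : i j / (i <= j)%N >-> i <= j} by move=> i j _; exact: lexx.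
pose q := quant theta 1; pose p t := pr mu (q @^-1` [set t]).
pose f (t : nat) : R := expR (eta - eta0 * t%:R).
have q1 : q @^-1` [set 1%N] = `]eta0, +oo[%classic.
  apply/seteqP; split => z /=; rewrite in_itv /= andbT /q /quant big_ord1 /theta;
  by case: (eta0 < z).
have p0 t : 0 <= p t by exact: pr_ge0.
have p1 : \sum_(t < 2) p t = 1 by exact: quant_law_sum.
have f1 : \sum_(t < 2) p t * f t <= 1.
  move: p1 he; rewrite !big_ord_recl !big_ord0 /= !addr0.
  rewrite -q1 -/(p 1%N) /f /bump /= mulr0 subr0 mulr1 addn0 => h.
  by rewrite (_ : 1 - p 1%N = p 0%N) 1?addrC//; lra.
have [sE pE] := pr_quant 1 J (fun s => ~~ reaches f (expR y) 1 s) th.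
exists [set w | ~~ reaches f (expR y) 1 (mkseq (fun i => quant theta 1 (x i w)) J)].
split=> //.
  rewrite pE (Ex_indicatorC p1) lerD2l lerN2.
  under eq_Ex => s _ do rewrite negbK.
  have f0 t : 0 <= f t by exact: expR_ge0.
  have := ville p0 p1 J (expR_gt0 y) f0 ler01 f1.
  by rewrite div1r -expRN.
move=> w /= hw j jJ.
have := reachesN (j := j) hw; rewrite size_mkseq => /(_ jJ).
rewrite mul1r -expR_sum ltr_expR => h.
have e : \sum_(i < j) (eta - eta0 * (nth 0%N (mkseq (fun i => quant theta 1 (x i w)) J) i)%:R) =
   eta * j%:R - \sum_(0 <= i < j) eta0 * (q (x i w))%:R.
  rewrite sumrB sumr_const card_ord mulr_natr big_mkord; congr (_ - _).
  by apply: eq_bigr => i _; rewrite nth_mkseq// (leq_trans (ltn_ord i)).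
move: h; rewrite e => h.
have : \sum_(0 <= i < j) eta0 * (q (x i w))%:R <= \sum_(0 <= l < j) `|x l w|.
  apply: ler_sum => i _; rewrite /q /quant big_ord1 /theta; case: ltP => hx; last by rewrite mulr0.
  by rewrite mulr1 (le_trans (ltW hx))// ler_norm.
by lra.
Qed.

End windows.

Section windows.
Context {d} {Omega : measurableType d} {R : realType} (P : probability Omega R).
Context {I : eqType} (D : set I) (G : I -> set (set Omega)).
Hypothesis Gm : forall i A, G i A -> measurable A.
Hypothesis GI : forall i, setI_closed (G i).
Hypothesis GT : forall i, G i setT.
Hypothesis indep : mutual_indep P D G.
Local Notation sig S := (<<s gens G S >>).

Variables (mu : probability R R) (c : nat -> I) (x : nat -> Omega -> R).
Hypothesis c_inj : injective c.
Hypothesis cD : forall i, D (c i).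
Hypothesis x_sig : forall i B, measurable B -> sig [set c i] (x i @^-1` B).
Hypothesis x_law : forall i B, measurable B -> P (x i @^-1` B) = mu B.

Lemma service_tail (theta : nat -> R) J :
  exists E, [/\ sig [set c i | i in [set i | (i < J)%N]] E,
    1 - \sum_(j < J) pr mu `]theta j, +oo[%classic <= pr P E &
    forall w, E w -> forall j, (j < J)%N -> x j w <= theta j].
Proof.
pose F j := x j @^-1` `]theta j, +oo[%classic.
have mF j : measurable (F j).
  by apply: (sig_measurable Gm (S := [set c j])); apply: x_sig; exact: measurable_itv.
have mU : measurable (\big[setU/set0]_(j < J) F j) by exact: bigsetU_measurable.
exists (~` \big[setU/set0]_(j < J) F j); split.
- apply: sigC; rewrite -(bigcup_mkord J F) bigcup_mkcond; apply: sig_bigcup => j.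
  case: ifPn => [|_]; last by rewrite -setCT; apply: sigC; exact: sig_setT.
  rewrite inE => /= jJ; apply: (sub_sig (S := [set c j])); first by move=> _ ->; exists j.
  by apply: x_sig; exact: measurable_itv.
- rewrite prC// lerD2l lerN2; apply: le_trans (pr_big_le _ _ _) _ => //.
  by apply: ler_sum => j _; rewrite /pr (x_law j (B := `]theta j, +oo[%classic))//; exact: measurable_itv.
- move=> w; rewrite -(bigcup_mkord J F) => hw j jJ; rewrite leNgt; apply/negP => h.
  by apply: hw; exists j => //; rewrite /F /= in_itv /= h.
Qed.

(** [theta i = i h - e] is the time that [i] arrivals are guaranteed to take by [walk_event]. A
    service time is thus rounded up to a number of arrivals, and [occ] dominates the true occupancy.
    The mean letter is at most [1 + (EV + e) / h]. The top threshold lies in [[K / 2, K]], so a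
    letter below [m0] forces a service time at most [K]. *)
Lemma service_event (h e K EV b A0 ck r : R) (k n m0 Nb : nat) :
  n = (4 ^ k)%N -> r = 2 ^+ k -> 0 < h -> 0 <= e -> 0 <= EV ->
  (\int[mu]_x `|x|%:E <= EV%:E)%E -> (0 < m0)%N ->
  K / 2 <= m0.-1%:R * h - e -> m0.-1%:R * h - e <= K ->
  n%:R * pr mu `]K / 2, +oo[%classic <= 1 / 4 ->
  1 + (EV + e) / h <= ck * r ^+ 2 -> 0 <= ck -> 0 < b ->
  125 * 14 <= A0 -> 16 * (A0 + ck + 3 * ck ^+ 2) / b ^+ 4 <= 1 / 4 ->
  exists E, [/\ sig [set c i | i in [set i | (i < Nb * n)%N]] E, (1 / 2) ^+ Nb <= pr P E &
    forall w, E w -> (forall j, (j < Nb * n)%N -> x j w <= K) /\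
      (forall i0 js, uniq js -> (forall j, j \in js -> (i0 <= j < Nb * n)%N /\ (j - i0)%:R * h - e < x j w) ->
        (size js)%:R <= 1 + (EV + e) / h + b * r)].
Proof.
move=> n4 r2 h0 e0 EV0 hEV m00 thK1 thK2 htail hck ck0 b0 hA0 hb.
pose theta (i : nat) : R := i%:R * h - e.
have th : {homo theta : i j / (i <= j)%N >-> i <= j}.
  by move=> i j ij; rewrite /theta lerD2r ler_pM2r// ler_nat.
pose q := quant theta m0; pose p t := pr mu (q @^-1` [set t]).
have qm y : (q y < m0.+1)%N by exact: quant_lt.
have mq t : measurable (q @^-1` [set t]) by exact: quant_measurable.
have p0 t : 0 <= p t by exact: pr_ge0.
have p1 : \sum_(t < m0.+1) p t = 1 by exact: quant_law_sum.
pose EK := \sum_(t < m0.+1) p t * t%:R.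
have mnorm : measurable_fun setT (fun y : R => `|y|) by exact: normr_measurable.
have hEK : EK <= 1 + (EV + e) / h.
  apply: (quant_mean_le (mu := mu) (q := q) (f := fun t => t%:R) (A := setT)
    (phi := fun y => (1 + e / h) + h^-1 * `|y|)) => //.
  - by rewrite setCT measure0.
  - by apply: measurable_funD => //; apply: measurable_funM.
  - by move=> y; rewrite !addr_ge0 ?mulr_ge0 ?invr_ge0// ltW.
  - rewrite [leRHS](_ : _ = (1 + e / h + h^-1 * EV)%:E); last by congr EFin; field; rewrite gt_eqF.
    by apply: integral_affine; rewrite ?addr_ge0 ?mulr_ge0 ?invr_ge0 ?(ltW h0).
  - move=> y _; case E : (q y) => [|j].
      by rewrite !addr_ge0 ?mulr_ge0 ?invr_ge0// ltW.
    have := quantE m0 y th j; rewrite -/q E ltnSn => /esym /andP[_].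
    rewrite /theta -natr1 => hj; have := ler_norm y.
    suff : j%:R <= e / h + h^-1 * `|y| by lra.
    by rewrite mulrC -mulrDr mulrC ler_pdivlMr//; have := ler_norm y; lra.
have htail' : n%:R * (\sum_(t < m0.+1) p t * (m0 <= t)%N%:R) <= 1 / 4.
  apply: le_trans htail; rewrite ler_wpM2l//.
  rewrite big_ord_recr /= leqnn mulr1 big1 ?add0r; last first.
    by move=> t _; rewrite leqNgt ltn_ord /= mulr0.
  apply: le_pr; [exact: mq|exact: measurable_itv|].
  move=> y /= qy; rewrite in_itv /= andbT; have := quantE m0 y th m0.-1.
  rewrite -/q qy !prednK// leqnn /= => hy; apply: le_lt_trans thK1 _.
  by rewrite -/(theta _) -hy.
have [sE pE] := pr_quant Gm GI GT indep c_inj cD x_sig x_law m0 (Nb * n)%N (fun s =>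
  all (fun j => ((occ (Nb * n) j s)%:R <= EK + b * r) && (nth 0%N s j < m0)%N) (iota 0 (Nb * n))) th.
have hck' : EK <= ck * r ^+ 2 by apply: le_trans hck.
have om := occ_main p0 p1 Nb n4 r2 (erefl EK) hA0 ck0 b0 hck' hb htail'.
eexists; split; [exact: sE|by rewrite pE|].
move=> w /= /allP hw.
have key j : (j < Nb * n)%N -> (occ (Nb * n) j (mkseq (fun i => q (x i w)) (Nb * n)))%:R <= EK + b * r
    /\ (q (x j w) < m0)%N.
  by move=> jN; have := hw j; rewrite mem_iota jN nth_mkseq// => /(_ isT) /andP.
have below j : (j < Nb * n)%N -> x j w <= theta (q (x j w)).
  move=> jN; have [_ qj] := key j jN; have := quantE m0 (x j w) th (q (x j w)).
  by rewrite -/q ltnn qj /= leNgt => <-.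
split=> [j jN|i0 js ujs hjs].
  apply: le_trans (below j jN) _; apply: le_trans _ thK2; apply: th.
  by have [_ qj] := key j jN; rewrite -ltnS prednK.
have c0 : 0 <= 1 + (EV + e) / h + b * r.
  by rewrite !addr_ge0 ?divr_ge0 ?addr_ge0 ?mulr_ge0 ?(ltW h0) ?(ltW b0)// r2 exprn_ge0.
case: (ltnP i0 (Nb * n)) => i0N; last first.
  case: js ujs hjs => [|j js] // _ /(_ j (mem_head _ _)) [/andP[h1 h2] _].
  by have := leq_ltn_trans (leq_trans i0N h1) h2; rewrite ltnn.
have [hocc _] := key i0 i0N.
apply: (le_trans _ (le_trans hocc _)); last by rewrite lerD2r.
rewrite ler_nat.
have sub : {subset js <= [seq j <- iota 0 (Nb * n) | (i0 <= j) && (j - i0 < q (x j w))]%N}.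
  move=> j /hjs [/andP[i0j jN] hj]; rewrite mem_filter mem_iota add0n jN i0j /= andbT.
  rewrite ltnNge; apply/negP => /th h1; have := below j jN.
  by move: hj; rewrite -/(theta (j - i0)%N); lra.
apply: leq_trans (uniq_leq_size ujs sub) _.
rewrite size_filter -sum1_count /occ big_mkcond /= -[X in iota 0 X]subn0 -/(index_iota 0 _) big_mkord.
by apply: leq_sum => j _; rewrite nth_mkseq//; case: ifP.
Qed.

End windows.

Section route_window.
Context {d} {Omega : measurableType d} {R : realType} (P : probability Omega R).
Context {I : eqType} (D : set I) (G : I -> set (set Omega)).
Hypothesis Gm : forall i A, G i A -> measurable A.
Hypothesis GI : forall i, setI_closed (G i).
Hypothesis GT : forall i, G i setT.
Hypothesis indep : mutual_indep P D G.
Local Notation sig S := (<<s gens G S >>).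

Variables (muX muV : probability R R) (c e : nat -> I) (x v : nat -> Omega -> R).
Hypothesis c_inj : injective c.
Hypothesis e_inj : injective e.
Hypothesis ce : forall i j, c i <> e j.
Hypothesis cD : forall i, D (c i).
Hypothesis eD : forall i, D (e i).
Hypothesis x_sig : forall i B, measurable B -> sig [set c i] (x i @^-1` B).
Hypothesis v_sig : forall i B, measurable B -> sig [set e i] (v i @^-1` B).
Hypothesis x_law : forall i B, measurable B -> P (x i @^-1` B) = muX B.
Hypothesis v_law : forall i B, measurable B -> P (v i @^-1` B) = muV B.

(** Four events on disjoint coordinates. The first [Nb * n] indices, of total duration at least
    [3 K], receive the fine analysis, at the price of two factors [(1/2) ^ Nb]. For the next [J]
    indices crude linear bounds suffice, at the price of 1/2 each: these jobs need only be gone by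
    age [S j - K]. *)
Lemma route_window (s K M m m2 EV eta0 eta b A0 ck r cl : R) (k n m0 Nb J : nat) :
  let La := 1 + m2 in
  let h := (m - 2 * La / r) / s in let ep := 3 * La * r / s in
  n = (4 ^ k)%N -> r = 2 ^+ k -> 1 <= s -> 1 <= K -> 0 <= m2 -> 0 <= EV -> 0 < h ->
  muX `]-oo, 0%R]%classic = 0%E ->
  (\int[muX]_x `|x|%:E = m%:E)%E -> (\int[muX]_x (x ^+ 2)%:E <= m2%:E)%E ->
  (\int[muV]_x `|x|%:E <= EV%:E)%E ->
  0 < eta0 ->
  pr muX `]eta0, +oo[%classic * expR (eta - eta0) + (1 - pr muX `]eta0, +oo[%classic) * expR eta <= 1 ->
  (0 < m0)%N -> K / 2 <= m0.-1%:R * h - ep -> m0.-1%:R * h - ep <= K ->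
  n%:R * pr muV `]K / 2, +oo[%classic <= 1 / 4 ->
  \sum_(j < J) pr muV `](K + eta * j%:R / s), +oo[%classic <= 1 / 2 ->
  1 + (EV + ep) / h <= ck * r ^+ 2 -> 0 <= ck -> 0 < b ->
  125 * 14 <= A0 -> 16 * (A0 + ck + 3 * ck ^+ 2) / b ^+ 4 <= 1 / 4 ->
  1 + (EV + ep) / h + b * r <= cl -> (0 < Nb)%N ->
  3 * K <= (Nb * n).-1%:R * h - ep -> M <= eta * J%:R / s ->
  exists E, [/\ sig (range c `|` range e) E, (1 / 2) ^+ (2 * Nb + 2) <= pr P E &
    forall w, E w -> let S j := (\sum_(0 <= l < j) `|x l w|) / s in
    [/\ forall j, (j < Nb * n)%N -> v j w <= K,
        forall j, (Nb * n <= j < Nb * n + J)%N -> v j w <= S j - K,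
        M <= S (Nb * n + J)%N &
        forall i0 js, uniq js ->
          (forall j, j \in js -> (i0 <= j < Nb * n)%N /\ S j - S i0 < v j w) -> (size js)%:R <= cl]].
Proof.
move=> La h ep n4 r2 s1 K1 m20 EV0 h0 muX0 hm hm2 hEV eta00 heta m00 th1 th2 htail hVt hck ck0 b0 hA0 hb hcl Nb0 hNb hJ.
have s0 : 0 < s by lra.
have n0 : (0 < n)%N by rewrite n4 expn_gt0.
have r1 : 1 <= r by rewrite r2 exprn_ege1// ler1n.
have rn : r ^+ 2 = n%:R.
  by rewrite r2 n4 -natrX -natrX -expnM mulnC expnM.
have La0 : 0 < La by rewrite /La; lra.
have ep0 : 0 <= ep.
  by rewrite /ep divr_ge0 ?(ltW s0)// !mulr_ge0// ?(ltW La0)//; lra.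
set I0 := (Nb * n)%N.
have I00 : (0 < I0)%N by rewrite muln_gt0 Nb0.
have [E1 [sE1 pE1 hE1]] := walk_event Gm GI GT indep c_inj cD x_sig x_law Nb n0 r1 rn m20 muX0 hm hm2.
have c'_inj : injective (fun i => c (I0 + i)%N) by move=> i j /c_inj /addnI.
have e'_inj : injective (fun i => e (I0 + i)%N) by move=> i j /e_inj /addnI.
have [E2 [sE2 pE2 hE2]] := walk_tail Gm GI GT indep c'_inj (fun i => cD _)
  (fun i => @x_sig (I0 + i)%N) (fun i => @x_law (I0 + i)%N) s J eta00 heta.
have [E3 [sE3 pE3 hE3]] := service_event Gm GI GT indep e_inj eD v_sig v_law Nb n4 r2 h0 ep0 EV0 hEV
  m00 th1 th2 htail hck ck0 b0 hA0 hb.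
have [E4 [sE4 pE4 hE4]] := service_tail Gm (fun i => @v_sig (I0 + i)%N) (fun i => @v_law (I0 + i)%N)
  (fun j => K + eta * j%:R / s) J.
have subD (f : nat -> I) (A : set nat) : (forall i, D (f i)) -> [set f i | i in A] `<=` D.
  by move=> fD _ [i _ <-].
have split4 : pr P (E1 `&` E2 `&` (E3 `&` E4)) = pr P E1 * pr P E2 * (pr P E3 * pr P E4).
  have s12 := sigI (sub_sig (@subsetUl _ _ _) sE1) (sub_sig (@subsetUr _ _ _) sE2).
  have s34 := sigI (sub_sig (@subsetUl _ _ _) sE3) (sub_sig (@subsetUr _ _ _) sE4).
  rewrite (pr_indep Gm GI GT indep _ _ _ s12 s34); first last.
  - by apply/seteqP; split => // _ [[[i _ <-]|[i _ <-]] [[j _ /esym]|[j _ /esym]]] /ce.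
  - by rewrite subUset; split; apply: subD.
  - by rewrite subUset; split; apply: subD.
  rewrite (pr_indep Gm GI GT indep _ _ _ sE1 sE2); first last.
  - by apply/seteqP; split => // _ [[i /= iI <-] [j _ /c_inj ij]]; move: iI; rewrite -ij ltnNge leq_addr.
  - exact: subD.
  - exact: subD.
  rewrite (pr_indep Gm GI GT indep _ _ _ sE3 sE4)//; first last.
  - by apply/seteqP; split => // _ [[i /= iI <-] [j _ /e_inj ij]]; move: iI; rewrite -ij ltnNge leq_addr.
  - exact: subD.
  - exact: subD.
have imc (f : nat -> I) (g : nat -> nat) (A : set nat) : [set f (g i) | i in A] `<=` range f.
  by move=> _ [i _ <-]; exists (g i).
exists (E1 `&` E2 `&` (E3 `&` E4)); split.
- apply: sigI; apply: sigI.
  + by apply: sub_sig sE1 => z /(imc c id); left.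
  + by apply: sub_sig sE2 => z /(imc c (addn I0)); left.
  + by apply: sub_sig sE3 => z /(imc e id); right.
  + by apply: sub_sig sE4 => z /(imc e (addn I0)); right.
- rewrite split4 exprD mulnC muln2 -addnn exprD expr2.
  have e1 : 1 / 2 <= pr P E2.
    apply: le_trans pE2; suff : expR (- s) <= 1 / 2 by lra.
    have := expR_ge1Dx s; rewrite expRN => hs.
    by rewrite -[1 / 2]invrK lef_pV2 ?posrE ?expR_gt0 ?invr_gt0 ?divr_gt0//; lra.
  have e2 : 1 / 2 <= pr P E4 by apply: le_trans pE4; lra.
  have h2 : 0 <= 1 / 2 :> R by lra.
  rewrite mulrACA; apply: ler_pM; rewrite ?mulr_ge0 ?exprn_ge0//.
    by apply: ler_pM; rewrite ?exprn_ge0.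
  by apply: ler_pM.
move=> w [[w1 w2] [w3 w4]] S.
have [h3a h3b] := hE3 w w3.
have incr i j : (i <= j)%N -> (j < I0)%N -> (j - i)%:R * h - ep <= S j - S i.
  move=> ij jI; have hh := hE1 w w1 i j ij jI.
  rewrite /S -mulrBl; have -> : \sum_(0 <= l < j) `|x l w| - \sum_(0 <= l < i) `|x l w| = \sum_(i <= l < j) `|x l w|.
    by apply/eqP; rewrite subr_eq addrC -big_cat_nat.
  by rewrite /h /ep mulrA -mulrBl ler_pM2r ?invr_gt0.
have S0 : S 0%N = 0 by rewrite /S big_nil mul0r.
have SI0 : 3 * K <= S I0.
  apply: le_trans hNb _; have := incr 0%N I0.-1 (leq0n _); rewrite prednK// => /(_ (leqnn _)).
  rewrite S0 !subr0 subn0 => /le_trans; apply.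
  by rewrite /S ler_pM2r ?invr_gt0// -[in leRHS](prednK I00) big_nat_recr//= lerDl.
(* The [- 1] is the slack [y = s] of [walk_tail] after division by [s]; with [K >= 1] it leaves
   [2 K], one [K] for the service bound and one for the margin. *)
have tail j : (j <= J)%N -> 3 * K + eta * j%:R / s - 1 <= S (I0 + j)%N.
  move=> jJ; have := hE2 w w2 j jJ.
  have -> : S (I0 + j)%N = S I0 + (\sum_(0 <= l < j) `|x (I0 + l)%N w|) / s.
    rewrite /S -mulrDl (big_cat_nat (n := I0))//= ?leq_addr//; congr ((_ + _) / s).
    by rewrite -{1}[I0]add0n big_addn addKn; apply: eq_bigr => l _; rewrite addnC.
  rewrite -(ler_pM2r (x := s^-1)) ?invr_gt0// mulrBl divff ?gt_eqF//; lra.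
split.
- exact: h3a.
- move=> j /andP[Ij jIJ]; have jJ : (j - I0 < J)%N by rewrite ltn_subLR.
  have := hE4 w w4 _ jJ; rewrite subnKC// => hv.
  by have := tail _ (ltnW jJ); rewrite subnKC//; lra.
- by have := tail J (leqnn J); lra.
- move=> i0 js ujs hjs; apply: le_trans hcl; apply: (h3b i0 js ujs) => j /hjs [h1 h2].
  split=> //; apply: le_lt_trans h2; case/andP: h1 => i0j jI; exact: incr.
Qed.

End route_window.

(** * Summable tails and the drift exponent *)

Section tails.
Context {R : realType} (mu : probability R R).

Lemma inv_square_sum J : \sum_(j < J) (1 + j%:R : R) ^- 2 <= 2.
Proof.
case: J => [|J]; first by rewrite big_ord0.
suff : \sum_(j < J.+1) (1 + j%:R : R) ^- 2 <= 2 - (1 + J%:R)^-1.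
  by move=> /le_trans; apply; rewrite gerBl invr_ge0 addr_ge0.
elim: J => [|J IH]; first by rewrite big_ord_recl big_ord0 !addr0 expr1n invr1; lra.
rewrite big_ord_recr /=; apply: le_trans (lerD IH (lexx _)) _.
rewrite -[J.+1%:R]natr1; set y : R := J%:R; have y0 : 0 <= y by [].
have -> : 2 - (1 + y)^-1 + (1 + (y + 1)) ^- 2 =
    2 - (1 + (y + 1))^-1 - ((1 + y) * (1 + (y + 1)) ^+ 2)^-1.
  by field; apply/andP; split; rewrite gt_eqF//; lra.
by rewrite gerBl invr_ge0 mulr_ge0 ?sqr_ge0//; lra.
Qed.

(** Of the [q + 2] powers in the tail bound, [q] are spent on the uniform lower bound [A] and two on
    the linear one, which makes the sum converge. *)
Lemma tail_sum (theta : nat -> R) (cq A u : R) q J : 0 < A -> 0 < u -> 0 <= cq ->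
  (forall y, 0 < y -> pr mu `]y, +oo[%classic <= cq / y ^+ (q + 2)) ->
  (forall j, A <= theta j) -> (forall j, u * (1 + j%:R) <= theta j) ->
  \sum_(j < J) pr mu `]theta j, +oo[%classic <= 2 * cq / (A ^+ q * u ^+ 2).
Proof.
move=> A0 u0 cq0 hq hA hu.
have j0 j : 0 < 1 + j%:R :> R by rewrite ltr_pwDl.
apply: (@le_trans _ _ (\sum_(j < J) cq / (A ^+ q * u ^+ 2) * (1 + j%:R) ^- 2)).
  apply: ler_sum => j _; have th0 : 0 < theta j by apply: lt_le_trans (hA j).
  apply: le_trans (hq _ th0) _; rewrite -mulrA -invfM ler_wpM2l// lef_pV2 ?posrE ?exprn_gt0//; last first.
    by rewrite !mulr_gt0 ?exprn_gt0.
  rewrite exprD -mulrA -exprMn; apply: ler_pM; rewrite ?exprn_ge0 ?(ltW A0)//.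
  + by rewrite mulr_ge0// ltW.
  + by apply: lerXn2r; rewrite ?nnegrE ?(ltW A0) ?(ltW th0).
  + by apply: lerXn2r; rewrite ?nnegrE ?mulr_ge0 ?(ltW u0) ?(ltW th0) ?(ltW (j0 _)).
rewrite -mulr_sumr -[2 * cq / _]mulrA [leRHS]mulrC; apply: ler_wpM2l (inv_square_sum J).
by rewrite divr_ge0// mulr_ge0 ?exprn_ge0 ?ltW.
Qed.

Lemma positive_tail : 0 < pr mu `]0%R, +oo[%classic ->
  exists2 y, 0 < y & 0 < pr mu `]y, +oo[%classic.
Proof.
move=> mu0; have [n hn] : exists n : nat, 0 < pr mu `]n.+1%:R^-1, +oo[%classic; last first.
  by exists n.+1%:R^-1; rewrite // invr_gt0.
apply: contrapT => /forallNP hn.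
have h0 n : pr mu `]n.+1%:R^-1, +oo[%classic = 0.
  by apply/eqP; rewrite eq_le pr_ge0 andbT leNgt; apply/negP; exact: hn.
have : pr mu (\bigcup_n `]n.+1%:R^-1, +oo[%classic) <= 0.
  apply: pr_bigcup_le => [i|n]; first exact: measurable_itv.
  apply: le_trans (pr_big_le _ _ _) _; first by move=> i; exact: measurable_itv.
  by rewrite big1.
have -> : \bigcup_n `](n.+1%:R^-1 : R), +oo[%classic = `]0%R, +oo[%classic.
  apply/seteqP; split => y /=; rewrite !in_itv /= andbT.
    by move=> [n _ /=]; rewrite in_itv /= andbT; apply: lt_trans; rewrite invr_gt0.
  move=> y0; exists (Num.truncn y^-1) => //=; rewrite in_itv /= andbT.
  by rewrite invf_plt ?posrE ?ltr0n// truncnS_gt.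
by rewrite leNgt mu0.
Qed.

(** [- eta] is the logarithm of the Laplace transform at 1 of a gap reduced to the values 0 and
    [eta0]. It is negative because gaps exceed some [eta0 > 0] with positive probability. *)
Lemma drift_exists : mu `]-oo, 0%R]%classic = 0%E ->
  exists eta0 eta : R, [/\ 0 < eta0, 0 < eta &
   pr mu `]eta0, +oo[%classic * expR (eta - eta0) + (1 - pr mu `]eta0, +oo[%classic) * expR eta <= 1].
Proof.
move=> mu0; have [|eta0 e0 hn] := positive_tail.
  by rewrite -setCitvl prC /pr ?mu0 ?subr0//; exact: measurable_itv.
set p := pr mu _ in hn.
have p1 : p <= 1 by apply: pr_le1; exact: measurable_itv.
have ex1 : expR (- eta0) < 1 by rewrite expR_lt1 oppr_lt0.
have ex0 := expR_gt0 (- eta0).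
pose f := p * expR (- eta0) + (1 - p).
have f0 : 0 < f by rewrite /f; nra.
have f1 : f < 1 by rewrite /f; nra.
exists eta0, (- ln f); split=> //; first by rewrite oppr_gt0 ln_lt0// f0 f1.
have -> : expR (- ln f - eta0) = f^-1 * expR (- eta0) by rewrite expRD expRN lnK.
have -> : expR (- ln f) = f^-1 by rewrite expRN lnK.
by rewrite mulrCA [(1 - p) * _]mulrC -mulrDr mulVf ?gt_eqF.
Qed.

End tails.

(** * Choice of scales *)

Section numerics.
Context {R : realType}.

Lemma spacing_bounds (s r m La : R) : 0 < m -> 1 <= La -> 1 <= r -> r ^+ 2 <= s ->
  4 * La / m <= r -> 12 * La <= r -> 4 * m <= s ->
  let h := (m - 2 * La / r) / s in let ep := 3 * La * r / s in
  [/\ m / (2 * s) <= h, h <= m / s, 0 <= ep, ep <= 1 / 4 & h <= 1 / 4].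
Proof.
move=> m0 La1 r1 rs rm rL sm h ep.
have r0 : 0 < r by lra.
have s0 : 0 < s by apply: lt_le_trans rs; rewrite exprn_gt0.
have x0 : 0 <= 2 * La / r by rewrite divr_ge0 ?mulr_ge0//; lra.
have xm : 2 * La / r <= m / 2.
  by move: rm; rewrite !ler_pdivrMr//; lra.
have hm : h <= m / s by rewrite /h ler_pM2r ?invr_gt0//; lra.
split=> //.
- by rewrite /h invfM mulrA ler_pM2r ?invr_gt0//; lra.
- by rewrite /ep divr_ge0 ?mulr_ge0//; lra.
- rewrite /ep ler_pdivrMr//; have : 12 * La * r <= r * r by rewrite ler_pM2r.
  by move: rs; rewrite expr2; lra.
- by apply: le_trans hm _; rewrite ler_pdivrMr//; lra.
Qed.

(** To first order [1 / (m - u) <= 1 / m + 2 u / m ^ 2], with [u] of order [1 / r]. Multiplied by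
    [s <= 4 r ^ 2] the error is [O (r)], so the excess over the balanced load [EV / m * s] is a
    fixed multiple of [sqrt s]. *)
Lemma occupancy_bound (s r m La EV b h ep : R) : 0 < m -> 1 <= La -> 1 <= r -> r ^+ 2 <= s ->
  s <= 4 * r ^+ 2 -> 4 * La / m <= r -> 0 <= EV -> 0 <= b ->
  h = (m - 2 * La / r) / s -> ep = 3 * La * r / s ->
  1 + (EV + ep) / h + b * r <=
    EV / m * s + (1 + 16 * La * EV / m ^+ 2 + 6 * La / m + b) * Num.sqrt s.
Proof.
move=> m0 La1 r1 rs sr rm EV0 b0 hE epE.
have r0 : 0 < r by lra.
have s0 : 0 < s by apply: lt_le_trans rs; rewrite exprn_gt0.
have La0 : 0 < La by lra.
set u := 2 * La / r.
have u0 : 0 <= u by rewrite /u divr_ge0 ?mulr_ge0//; lra.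
have um : u <= m / 2 by move: rm; rewrite /u !ler_pdivrMr//; lra.
have mu0 : 0 < m - u by lra.
have inv : (m - u)^-1 <= m^-1 + 2 * u / m ^+ 2.
  rewrite -(ler_pM2l mu0) divff ?gt_eqF//.
  have -> : (m - u) * (m^-1 + 2 * u / m ^+ 2) = 1 + u * (m - 2 * u) / m ^+ 2.
    by field; rewrite gt_eqF.
  by rewrite lerDl divr_ge0 ?sqr_ge0// mulr_ge0//; lra.
have rsq : r <= Num.sqrt s by rewrite -(ger0_norm (ltW r0)) -sqrtr_sqr ler_wsqrtr.
have -> : (EV + ep) / h = EV * s * (m - u)^-1 + 3 * La * r * (m - u)^-1.
  by rewrite hE epE -/u; field; rewrite !gt_eqF.
have t1 : EV * s * (m - u)^-1 <= EV / m * s + 16 * La * EV / m ^+ 2 * r.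
  apply: le_trans (ler_wpM2l _ inv) _; first by rewrite mulr_ge0 // ltW.
  have -> : EV * s * (m^-1 + 2 * u / m ^+ 2) = EV / m * s + (EV * La / m ^+ 2) * (4 * s / r).
    by rewrite /u; field; rewrite !gt_eqF.
  rewrite lerD2l [leRHS](_ : _ = (EV * La / m ^+ 2) * (16 * r)); last by ring.
  apply: ler_wpM2l; first by rewrite divr_ge0 ?sqr_ge0// mulr_ge0// ltW.
  by rewrite ler_pdivrMr//; move: sr; rewrite expr2; lra.
have t2 : 3 * La * r * (m - u)^-1 <= 6 * La / m * r.
  have i2 : (m - u)^-1 <= 2 / m.
    by rewrite -(ler_pM2l mu0) divff ?gt_eqF// mulrA ler_pdivlMr//; lra.
  apply: le_trans (ler_wpM2l _ i2) _; first by rewrite !mulr_ge0 ?(ltW r0)//; lra.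
  by rewrite le_eqVlt; apply/orP; left; apply/eqP; field; rewrite gt_eqF.
set c1 := 16 * La * EV / m ^+ 2 in t1 *; set c2 := 6 * La / m in t2 *.
have c10 : 0 <= c1 by rewrite /c1 divr_ge0 ?sqr_ge0// !mulr_ge0//; lra.
have c20 : 0 <= c2 by rewrite /c2 divr_ge0 ?mulr_ge0//; lra.
have : (1 + c1 + c2 + b) * r <= (1 + c1 + c2 + b) * Num.sqrt s.
  by apply: ler_wpM2l => //; lra.
by lra.
Qed.

(** Chaining needs blocks whose length is a power of two, and [r] must be its exact square root; a
    power of 4 within a factor 4 of [s] serves both. *)
Lemma nat_scale (s : nat) : (0 < s)%N -> exists k, ((2 ^+ k) ^+ 2 <= s%:R :> R) /\ (s%:R <= 4 * (2 ^+ k) ^+ 2 :> R).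
Proof.
move=> s0; exists (trunc_log 4 s).
have e k : (2 ^+ k) ^+ 2 = (4 ^ k)%N%:R :> R.
  by rewrite -!natrX -expnM mulnC expnM.
rewrite !e -natrM !ler_nat -expnS; split; first exact: trunc_logP.
by apply: ltnW; exact: trunc_log_ltn.
Qed.

End numerics.

(** * One route: a good window has probability at least [exp (- c K)] *)

Section route.
Context {R : realType} (muX muV : probability R R) (m m2 EV eta0 eta : R).
Hypothesis m_gt0 : 0 < m.
Hypothesis m2_ge0 : 0 <= m2.
Hypothesis EV_ge0 : 0 <= EV.
Hypothesis muX0 : muX `]-oo, 0%R]%classic = 0%E.
Hypothesis muXm : (\int[muX]_x `|x|%:E = m%:E)%E.
Hypothesis muXm2 : (\int[muX]_x (x ^+ 2)%:E <= m2%:E)%E.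
Hypothesis muVm : (\int[muV]_x `|x|%:E <= EV%:E)%E.
Hypothesis eta0_gt0 : 0 < eta0.
Hypothesis eta_gt0 : 0 < eta.
Hypothesis drift : pr muX `]eta0, +oo[%classic * expR (eta - eta0) +
  (1 - pr muX `]eta0, +oo[%classic) * expR eta <= 1.
Hypothesis muV_tail : forall q : nat, exists2 cq : R, 0 <= cq &
  forall y, 0 < y -> pr muV `]y, +oo[%classic <= cq / y ^+ q.

Lemma powR_pow (s del : R) q n : 1 <= s -> n%:R <= del * q%:R -> s ^+ n <= (s `^ del) ^+ q.
Proof.
move=> s1 h; have s0 : 0 <= s := le_trans ler01 s1.
have -> : (s `^ del) ^+ q = s `^ (del * q%:R) by rewrite powRrM powR_mulrn ?powR_ge0.
by rewrite -powR_mulrn// ler_powR.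
Qed.

(** The order of quantifiers is the point: [b0] depends on the laws only, while [s0] and [Cc] may
    follow [del]. Nothing depends on [M], so the same bound serves all lengths of trials. *)
Lemma route_trial : exists2 b0 : R, 0 <= b0 & forall del, 0 < del ->
  exists s0 : nat, exists Cc : R, forall s : nat, (s0 <= s)%N -> forall M : R,
  forall d (Omega : measurableType d) (P : probability Omega R) (I : eqType) (D : set I)
    (G : I -> set (set Omega)),
  (forall i A, G i A -> measurable A) -> (forall i, setI_closed (G i)) -> (forall i, G i setT) ->
  mutual_indep P D G ->
  forall (c e : nat -> I) (x v : nat -> Omega -> R),
  injective c -> injective e -> (forall i j, c i <> e j) ->
  (forall i, D (c i)) -> (forall i, D (e i)) ->
  (forall i B, measurable B -> <<s gens G [set c i] >> (x i @^-1` B)) ->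
  (forall i B, measurable B -> <<s gens G [set e i] >> (v i @^-1` B)) ->
  (forall i B, measurable B -> P (x i @^-1` B) = muX B) ->
  (forall i B, measurable B -> P (v i @^-1` B) = muV B) ->
  let K := s%:R `^ del in
  exists I0 J E, [/\ <<s gens G (range c `|` range e) >> E, expR (- (Cc * K)) <= pr P E &
    forall w, E w -> let S j := (\sum_(0 <= l < j) `|x l w|) / s%:R in
    [/\ forall j, (j < I0)%N -> v j w <= K,
        forall j, (I0 <= j < I0 + J)%N -> v j w <= S j - K,
        M <= S (I0 + J)%N &
        forall i0 js, uniq js ->
          (forall j, j \in js -> (i0 <= j < I0)%N /\ S j - S i0 < v j w) ->
          (size js)%:R <= EV / m * s%:R + b0 * Num.sqrt (s%:R)]].
Proof.
pose La := 1 + m2; pose ck := 1 + 8 * (EV + 1) / m.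
have La1 : 1 <= La by rewrite /La lerDl.
have La0 : 0 < La by apply: lt_le_trans La1.
have m_ge0 := ltW m_gt0.
have ck0 : 0 <= ck by rewrite /ck !addr_ge0// divr_ge0// mulr_ge0// addr_ge0.
have [A0 A0E] : exists A0 : R, A0 = 125 * 14 by eexists.
have A01 : 1 <= A0 by rewrite A0E -natrM ler1n.
have A0le : 125 * 14 <= A0 by rewrite A0E.
clear A0E.
(* Then [16 X = b / 4 <= b ^ 4 / 4], the smallness that [occ_main] asks for. *)
pose X := A0 + ck + 3 * ck ^+ 2; pose b := 64 * X.
have X1 : 1 <= X by rewrite /X -addrA (le_trans A01)// lerDl addr_ge0// mulr_ge0// sqr_ge0.
have b1 : 1 <= b by rewrite /b (le_trans X1)// ler_peMl ?ler1n// (le_trans ler01).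
have b_gt0 : 0 < b by apply: lt_le_trans b1.
have hb : 16 * (A0 + ck + 3 * ck ^+ 2) / b ^+ 4 <= 1 / 4.
  rewrite -/X ler_pdivrMr ?exprn_gt0//.
  have : b <= b ^+ 4 by rewrite -{1}[b]expr1 ler_weXn2l.
  rewrite (_ : 16 * X = b / 4); last by rewrite /b; field.
  by lra.
pose b0 := 1 + 16 * La * EV / m ^+ 2 + 6 * La / m + b.
exists b0.
  apply: addr_ge0 (ltW b_gt0).
  by rewrite !addr_ge0 ?divr_ge0 ?sqr_ge0// !mulr_ge0// ltW.
move=> del del0.
(* Makes [K ^ q' >= s ^ 3]: a high moment at distance [K] beats every power of [s] lost in union
   bounds. *)
pose q' := (Num.truncn (3 / del)).+1.
have q'del : 3%:R <= del * q'%:R.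
  by rewrite mulrC -ler_pdivrMr// ltW// truncnS_gt.
have [cq cq0 hq] := muV_tail (q' + 2).
(* The cap at 1 gives [eta' / s <= 1 <= K], as the lower bound [u (1 + j)] in [tail_sum]
   requires. *)
pose eta' := Num.min eta 1.
have eta'0 : 0 < eta' by rewrite lt_min eta_gt0 ltr01.
have eta'1 : eta' <= 1 by rewrite ge_min lexx orbT.
have eta'e : eta' <= eta by rewrite ge_min lexx.
pose rho := 4 * La / m + 12 * La.
have rho0 : 0 <= rho by rewrite addr_ge0// ?divr_ge0// mulr_ge0// ltW.
pose sbig := 4 * rho ^+ 2 + 4 * m + 4 * cq * 2 ^+ (q' + 2) + 4 * cq / eta' ^+ 2 + 4.
exists (Num.truncn sbig).+1, (64 / m + 6) => s ss M d Omega P I D G Gm GI GT indep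
  c e x v c_inj e_inj ce cD eD x_sig v_sig x_law v_law K.
have {ss} : sbig <= s%:R by rewrite ltW// (lt_le_trans (truncnS_gt _))// ler_nat.
have t1 : 0 <= 4 * rho ^+ 2 by rewrite mulr_ge0// sqr_ge0.
have t2 : 0 <= 4 * m by rewrite mulr_ge0.
have t3 : 0 <= 4 * cq * 2 ^+ (q' + 2) by rewrite !mulr_ge0// exprn_ge0.
have t4 : 0 <= 4 * cq / eta' ^+ 2 by apply: divr_ge0; [exact: mulr_ge0|exact: sqr_ge0].
rewrite /sbig => hs.
have sb1 : 4 * rho ^+ 2 <= s%:R by lra.
have sb2 : 4 * m <= s%:R by lra.
have sb3 : 4 * cq * 2 ^+ (q' + 2) <= s%:R by lra.
have sb4 : 4 * cq / eta' ^+ 2 <= s%:R by lra.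
have sb5 : 4 <= s%:R :> R by lra.
have s1 : 1 <= s%:R :> R by lra.
have s_gt0 : 0 < s%:R :> R by lra.
clear t1 t2 t3 t4 hs sbig.
have [k [rs sr]] : exists k, ((2 ^+ k) ^+ 2 <= s%:R :> R) /\ (s%:R <= 4 * (2 ^+ k) ^+ 2 :> R).
  by apply: nat_scale; rewrite -(ltr0n R).
pose n := (4 ^ k)%N.
have [r rE] : exists r, r = 2 ^+ k :> R by eexists.
rewrite -rE in rs sr.
have rn : r ^+ 2 = n%:R by rewrite rE /n -!natrX -expnM mulnC expnM.
have r1 : 1 <= r by rewrite rE exprn_ege1// ler1n.
have r0 : 0 < r by apply: lt_le_trans r1.
have rrho : rho <= r.
  have : rho ^+ 2 <= r ^+ 2 by rewrite -(ler_pM2l (x := 4)) ?ltr0n//; apply: le_trans sb1 sr.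
  by rewrite ler_sqr ?nnegrE// ltW.
have q4 : 0 <= 4 * La / m by rewrite divr_ge0// mulr_ge0// ltW.
have rm : 4 * La / m <= r by apply: le_trans rrho; rewrite /rho lerDl mulr_ge0// ltW.
have rL : 12 * La <= r by apply: le_trans rrho; rewrite /rho lerDr.
have [hlo hhi ep0 ep4 h4] := spacing_bounds m_gt0 La1 r1 rs rm rL sb2.
have obound := occupancy_bound m_gt0 La1 r1 rs sr rm EV_ge0 (ltW b_gt0) erefl erefl.
set h := (m - 2 * La / r) / s%:R in hlo hhi h4 obound.
set ep := 3 * La * r / s%:R in ep0 ep4 obound.
have h0 : 0 < h by apply: lt_le_trans hlo; rewrite divr_gt0// mulr_gt0.
have K1 : 1 <= K.
  by have := @powR_pow s%:R del 1%N 0%N s1; rewrite expr0 expr1 mulr1; apply; rewrite ltW.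
have Ks : s%:R ^+ 3 <= K ^+ q' by apply: powR_pow.
have K0 : 0 < K by apply: lt_le_trans K1.
have Kq1 : 0 < K ^+ q' by rewrite exprn_gt0.
(* A block lasts at least [r ^ 2 h >= m / 8], so [32 K / m] blocks last [4 K]; one further block
   pays for the predecessor in [hNb], and [ep <= 1/4] is covered by the remaining [K]. *)
pose Nb := (Num.truncn (32 * K / m)).+2.
(* The largest number whose top threshold is still at most [K]; as [h <= 1/4], that threshold
   exceeds [K / 2]. *)
pose m0 := (Num.truncn ((K + ep) / h)).+1.
pose J := (Num.truncn (`|M| * s%:R / eta)).+1.
have Kep0 : 0 <= (K + ep) / h by rewrite divr_ge0 ?addr_ge0// ltW.
have thK2 : m0.-1%:R * h - ep <= K.
  by rewrite lerBlDr -ler_pdivlMr//= truncn_le.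
have thK1 : K / 2 <= m0.-1%:R * h - ep.
  have := truncnS_gt ((K + ep) / h); rewrite -/m0 -[m0]prednK// -natr1 => hy.
  have : (K + ep) / h * h <= (m0.-1%:R + 1) * h by rewrite ler_pM2r// ltW.
  by rewrite divfK ?gt_eqF// mulrDl mul1r; lra.
have htail : n%:R * pr muV `]K / 2, +oo[%classic <= 1 / 4.
  have K2 : 0 < K / 2 by rewrite divr_gt0.
  apply: le_trans (ler_wpM2l _ (hq _ K2)) _ => //.
  rewrite exprMn -rn invfM exprVn invrK.
  have kk : s%:R ^+ 2 <= K ^+ (q' + 2).
    apply: (@le_trans _ _ (K ^+ q')); last by rewrite exprD ler_peMr ?exprn_ege1// ltW.
    by apply: le_trans Ks; rewrite exprS ler_peMl// exprn_ge0// ltW.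
  have e1 : r ^+ 2 * (cq * ((K ^+ (q' + 2))^-1 * 2 ^+ (q' + 2))) <= s%:R * (cq * ((s%:R ^+ 2)^-1 * 2 ^+ (q' + 2))).
    apply: ler_pM => //; first by rewrite sqr_ge0.
      by rewrite !mulr_ge0 ?invr_ge0 ?exprn_ge0// ltW.
    rewrite ler_wpM2l// ler_wpM2r ?exprn_ge0// lef_pV2 ?posrE ?exprn_gt0//.
  apply: le_trans e1 _.
  have -> : s%:R * (cq * ((s%:R ^+ 2)^-1 * 2 ^+ (q' + 2))) = (4 * cq * 2 ^+ (q' + 2)) / s%:R * (1 / 4).
    by field; rewrite gt_eqF.
  by rewrite ler_piMl// ler_pdivrMr// mul1r.
have hVt : \sum_(j < J) pr muV `](K + eta * j%:R / s%:R), +oo[%classic <= 1 / 2.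
  have u0 : 0 < eta' / s%:R by rewrite divr_gt0.
  apply: le_trans (tail_sum (theta := fun j => K + eta * j%:R / s%:R) J K0 u0 cq0 hq _ _) _.
  - by move=> j; rewrite lerDl divr_ge0 ?mulr_ge0// ltW.
  - move=> j; rewrite mulrDr mulr1; apply: lerD.
      apply: le_trans K1; rewrite ler_pdivrMr// mul1r; exact: le_trans s1.
    by rewrite mulrAC ler_pM2r ?invr_gt0// ler_wpM2r.
  have e1 : 2 * cq / (K ^+ q' * (eta' / s%:R) ^+ 2) <= 2 * cq / (s%:R ^+ 3 * (eta' / s%:R) ^+ 2).
    have u2 : 0 < (eta' / s%:R) ^+ 2 by rewrite exprn_gt0.
    apply: ler_wpM2l; first by rewrite mulr_ge0.
    by rewrite lef_pV2 ?posrE ?(mulr_gt0 _ u2) ?exprn_gt0// ler_pM2r.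
  apply: le_trans e1 _.
  have -> : 2 * cq / (s%:R ^+ 3 * (eta' / s%:R) ^+ 2) = (4 * cq / eta' ^+ 2) / s%:R * (1 / 2).
    by field; rewrite !gt_eqF.
  by rewrite ler_piMl// ler_pdivrMr// mul1r.
have hinv : h^-1 <= 8 / m * r ^+ 2.
  apply: (@le_trans _ _ (2 * s%:R / m)).
    have e1 : 2 * s%:R / m * (m / (2 * s%:R)) = 1 by field; rewrite !gt_eqF.
    rewrite -[h^-1]mul1r ler_pdivrMr// -[leLHS]e1; apply: ler_wpM2l hlo.
    by rewrite divr_ge0// mulr_ge0.
  rewrite [leRHS](_ : _ = 2 * (4 * r ^+ 2) / m); last by ring.
  by rewrite ler_pM2r ?invr_gt0// ler_pM2l ?ltr0n.
have hck : 1 + (EV + ep) / h <= ck * r ^+ 2.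
  rewrite [leRHS](_ : _ = r ^+ 2 + (EV + 1) * (8 / m * r ^+ 2)); last by rewrite /ck; ring.
  apply: lerD; first by rewrite exprn_ege1.
  apply: ler_pM => //; [by rewrite addr_ge0|by rewrite invr_ge0 ltW|].
  by rewrite lerD2l; lra.
have Nn0 : (0 < Nb * n)%N by rewrite muln_gt0 expn_gt0.
have hNb : 3 * K <= (Nb * n).-1%:R * h - ep.
  have Nb1 : 32 * K / m + 1 <= Nb%:R.
    have := truncnS_gt (32 * K / m); rewrite -[Nb%:R]natr1; lra.
  have hl : m / (8 * r ^+ 2) <= h.
    apply: le_trans hlo; rewrite ler_pM2l// lef_pV2 ?posrE ?mulr_gt0 ?exprn_gt0//.
    by move: sr; lra.
  have rr : 1 <= r ^+ 2 by rewrite exprn_ege1.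
  have rr0 : 0 < r ^+ 2 by rewrite exprn_gt0.
  have i1 : 32 * K / m * r ^+ 2 <= (Nb * n).-1%:R.
    rewrite -subn1 natrB// natrM -rn lerBrDr.
    have : (32 * K / m + 1) * r ^+ 2 <= Nb%:R * r ^+ 2 by rewrite ler_pM2r.
    by rewrite mulrDl mul1r; lra.
  have i2 : 32 * K / m * r ^+ 2 * (m / (8 * r ^+ 2)) <= (Nb * n).-1%:R * h.
    apply: ler_pM => //; first by apply: mulr_ge0 (ltW rr0); rewrite divr_ge0// mulr_ge0// ltW.
    by rewrite divr_ge0// mulr_ge0// ltW.
  have e1 : 32 * K / m * r ^+ 2 * (m / (8 * r ^+ 2)) = 4 * K by field; rewrite !gt_eqF.
  by rewrite e1 in i2; lra.
have hJ : M <= eta * J%:R / s%:R.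
  apply: le_trans (ler_norm M) _; rewrite ler_pdivlMr// [eta * _]mulrC -ler_pdivrMr//.
  by apply: ltW; exact: truncnS_gt.
have [E [sE pE hE]] := @route_window _ _ _ P _ D G Gm GI GT indep muX muV c e x v c_inj e_inj ce cD eD
  x_sig v_sig x_law v_law s%:R K M m m2 EV eta0 eta b A0 ck r
  (EV / m * s%:R + b0 * Num.sqrt (s%:R)) k n m0 Nb J erefl rE s1 K1 m2_ge0 EV_ge0 h0 muX0 muXm muXm2 muVm
  eta0_gt0 drift isT thK1 thK2 htail hVt hck ck0 b_gt0 A0le hb obound isT hNb hJ.
exists (Nb * n)%N, J, E; split=> //.
apply: le_trans pE.
have NbK : (2 * Nb + 2)%:R <= (64 / m + 6) * K.
  have : Nb%:R <= 32 * K / m + 2.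
    rewrite /Nb -addn2 natrD lerD2r truncn_le.
    by rewrite divr_ge0// mulr_ge0// ltW.
  move=> hN; have -> : (2 * Nb + 2)%:R = 2 * Nb%:R + 2 :> R by rewrite natrD natrM.
  rewrite [leRHS](_ : _ = 2 * (32 * K / m) + 6 * K); last by ring.
  by lra.
apply: (@le_trans _ _ (expR (- (2 * Nb + 2)%:R))); first by rewrite ler_expR lerN2.
rewrite expr_div_n expr1n div1r expRN lef_pV2 ?posrE ?exprn_gt0 ?expR_gt0//.
rewrite -[X in expR X]mulr1 expRM_natl; apply: lerXn2r; rewrite ?nnegrE ?expR_ge0//.
by have := @expR_ge1Dx R 1.
Qed.

End route.

(** * Calm windows and the bound on tau' *)

Section pathwise.
Context {R : realType}.

(* [a] are the ages and [v] the service times of the jobs of one route.  In the second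
   clause the jobs of [js] are present at a common time of [[- (z + K), - z]]: pairwise
   overlap of intervals replaces the choice of that time. *)
Definition calm (z K M c : R) (N : nat) (a v : nat -> R) : Prop :=
  (forall i, (i < N)%N -> z + K <= a i -> a i < z + M -> v i <= a i - z) /\
  (forall js : seq nat, uniq js ->
     (forall i, i \in js -> [/\ (i < N)%N, z <= a i, a i < z + M, a i - v i < z + K &
        forall i', i' \in js -> a i - v i < a i']) -> (size js)%:R <= c).

(** [calm] looks only at ages below [z + M]. Hence it is decided by the indices before the passage
    of [z + M], which places earlier trials in the past of later ones. *)
Lemma calm_passage z K M c n a v : {homo a : i j / (i <= j)%N >-> i <= j} ->
  z + M <= a n -> calm z K M c n a v -> forall N, calm z K M c N a v.
Proof.
move=> ha an [h1 h2] N.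
have hn i : a i < z + M -> (i < n)%N.
  by move=> ai; rewrite ltnNge; apply/negP => /ha; lra.
split=> [i _ x1 x2|js ujs hjs]; first by apply: h1 => //; exact: hn.
by apply: h2 => // i /hjs [? ? ? ? ?]; split=> //; exact: hn.
Qed.

(** [N] is the passage index of [z]. The overshoot [a N - z] is harmless, since it only makes jobs
    older. Jobs from [I0] on end before the horizon [[- (z + K), - z]], so only the finely
    controlled indices are counted. *)
Lemma calm_window z K M c (a v S : nat -> R) N I0 I :
  (forall i, (i < N)%N -> a i < z) -> z <= a N -> (forall j, a (N + j)%N = a N + S j) ->
  {homo S : i j / (i <= j)%N >-> i <= j} -> S 0%N = 0 -> 0 <= K -> 0 <= c ->
  (forall j, (j < I0)%N -> v (N + j)%N <= K) ->
  (forall j, (I0 <= j < I)%N -> v (N + j)%N <= S j - K) -> M <= S I ->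
  (forall i0 js, uniq js -> (forall j, j \in js -> (i0 <= j < I0)%N /\ S j - S i0 < v (N + j)%N) ->
     (size js)%:R <= c) ->
  forall N', calm z K M c N' a v.
Proof.
move=> aN zN aS hS S0 K0 c0 w1 w2 w3 w4 N'.
have idx i : z <= a i -> a i < z + M -> exists2 j, i = (N + j)%N & (j < I)%N.
  move=> zi iM; have Ni : (N <= i)%N by rewrite leqNgt; apply/negP => /aN; lra.
  exists (i - N)%N; first by rewrite subnKC.
  rewrite ltnNge; apply/negP => /hS h; move: iM; rewrite -(subnKC Ni) aS; lra.
have Sge j : 0 <= S j by rewrite -S0; apply: hS.
split=> [i _ zi iM|js ujs hjs].
  have [|j ij jI] := idx i _ iM; first by lra.
  subst i; rewrite aS in zi iM *; have Sj := Sge j.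
  case: (ltnP j I0) => jI0; first by have := w1 _ jI0; lra.
  by have := w2 j; rewrite jI0 jI => /(_ isT); lra.
have {}idx i : i \in js -> exists2 j, i = (N + j)%N & (j < I0)%N.
  move=> ijs; have [_ zi iM iK _] := hjs i ijs.
  have [j ij jI] := idx i zi iM; exists j => //.
  rewrite ltnNge; apply/negP => jI0; have := w2 j; rewrite jI0 jI => /(_ isT).
  by move: iK; rewrite ij aS; lra.
case: js ujs hjs idx => [|i1 js'] ujs hjs idx; first by [].
set js := i1 :: js' in ujs hjs idx *.
pose ks := [seq (i - N)%N | i <- js].
have Nle i : i \in js -> (N <= i)%N by move=> /idx [j -> _]; exact: leq_addr.
have uks : uniq ks.
  rewrite map_inj_in_uniq// => i j /Nle Ni /Nle Nj ij.
  by rewrite -(subnKC Ni) ij subnKC.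
(* At the arrival of the youngest job of [js] all the others are present, by pairwise overlap; the
   occupancy bound is applied at that index. *)
have [i0 i0js i0min] : exists2 i0, i0 \in js & forall i, i \in js -> (i0 <= i)%N.
  have ex : exists i, i \in js by exists i1; rewrite mem_head.
  by case: (ex_minnP ex) => i0 ? ?; exists i0.
rewrite (_ : size js = size ks); last by rewrite size_map.
apply: (w4 (i0 - N)%N) => // j /mapP[i ijs ->].
rewrite leq_sub2r ?i0min// subnKC ?Nle//.
have [j' ij' j'I] := idx i ijs; have [j0 ij0 _] := idx i0 i0js.
have [_ _ _ _ /(_ i0 i0js)] := hjs i ijs.
by rewrite ij' ij0 !addKn !aS; split=> //; lra.
Qed.

Lemma tau_le {Omega : Type} {J L : nat} (Pr : 'I_L -> 'I_J -> bool) (Cs : 'I_J -> R)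
    (T V : 'I_L -> int -> Omega -> R) (w : Omega) (z K M : R) (c : 'I_L -> R) :
  let a l (i : nat) := - T l (- i%:Z) w in let v l (i : nat) := V l (- i%:Z) w in
  (forall l (n : int), 0 < n -> 0 < T l n w) ->
  (forall l N, calm z K M (c l) N (a l) (v l)) ->
  (forall l i, z + M <= a l i -> v l i <= a l i - (z + K)) ->
  0 < z -> 0 <= K -> (forall j, \sum_(l < L | Pr l j) c l <= Cs j) ->
  (`|tau' Pr Cs T V w| <= (z + K)%:E)%E.
Proof.
move=> a v Tpos hcalm hfar z0 K0 hc; set t := - (z + K).
(* Jobs present at a time before 0 have index at most 0, so reversed indices in [nat] see all of
   them. *)
have neg l (n : int) u : u <= 0 -> T l n w <= u -> exists i : nat, n = - i%:Z.
  move=> u0 Tu; case: (ltP 0 n) => [/(Tpos l)|n0]; first by lra.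
  by exists `|n|%N; lia.
have zKt : `|t| = z + K by rewrite normrN ger0_norm//; lra.
have hR : (Rmax T V w t <= K%:E)%E.
  apply: ge_ereal_sup => _ [->|[[l n] [/= h1 h2] <-]]; first by rewrite lee_fin.
  have [|i ni] := neg l n t _ h1; first by rewrite /t; lra.
  have ai : a l i = - T l n w by rewrite ni.
  have vi : v l i = V l n w by rewrite ni.
  rewrite lee_fin; case: (ltP (a l i) (z + M)) => aM.
    have [h _] := hcalm l i.+1; have := h i (ltnSn _) _ aM.
    by rewrite ai vi /t in h1 *; move=> /(_ ltac:(lra)); lra.
  by have := hfar l i aM; rewrite ai vi /t; lra.
have tin : [set t%:E | t in [set t : R | t < 0 /\
     (Rmax T V w t <= `|t|%:E)%E /\
     (forall u : R, t <= u -> (u%:E <= t%:E + Rmax T V w t)%E ->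
        forall j, Q_le Pr T V w j u (Cs j))]] t%:E.
  exists t => //; split; first by rewrite /t; lra.
  split; first by apply: le_trans hR _; rewrite lee_fin zKt; lra.
  move=> u tu uR j js ujs hjs.
  have uz : u <= - z.
    rewrite -lee_fin; apply: le_trans uR _; apply: le_trans (leeD2l _ hR) _.
    by rewrite -EFinD lee_fin /t; lra.
  have hneg x : x \in js -> exists i : nat, x.2 = - i%:Z.
    by move=> /hjs [_ [h1 _]]; apply: (neg x.1 x.2 u) h1; lra.
  apply: le_trans (hc j).
  have -> : size js = (\sum_(l < L) size [seq x <- js | x.1 == l])%N.
    under eq_bigr => l _ do rewrite size_filter -sum1_count.
    rewrite (exchange_big_dep predT)//= -sum1_size; apply: eq_bigr => x _.
    by rewrite (big_pred1 x.1)// => l /=; rewrite eq_sym.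
  rewrite natr_sum [leRHS]big_mkcond; apply: ler_sum => l _; case: ifP => Plj; last first.
    rewrite (_ : [seq x <- js | x.1 == l] = [::])//; apply/eqP; rewrite -(negbK (_ == _)) -has_filter.
    by apply/hasPn => x /hjs [h _]; apply: contraFN Plj => /eqP <-.
  (* Any bound above all indices occurring in [js] will do; this sum is one. *)
  have [_ h] := hcalm l (\sum_(x <- js) `|x.2|.+1)%N.
  rewrite -(size_map (fun x : 'I_L * int => `|x.2|%N)); apply: h.
    rewrite map_inj_in_uniq ?filter_uniq// => x y.
    rewrite !mem_filter => /andP[/eqP xl xjs] /andP[/eqP yl yjs] xy.
    have [i xi] := hneg _ xjs; have [i' yi] := hneg _ yjs.
    by case: x y xl yl xy xi yi {xjs yjs} => [? x] [? y] /= -> -> ? ? ?; congr (_, _); lia.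
  have key x : x \in [seq x <- js | x.1 == l] -> [/\ x \in js, a l `|x.2|%N = - T l x.2 w,
      v l `|x.2|%N = V l x.2 w, T l x.2 w <= u & u < T l x.2 w + V l x.2 w].
    rewrite mem_filter => /andP[/eqP xl xjs]; have [i xi] := hneg _ xjs.
    have [_ [h1 h2]] := hjs _ xjs; rewrite xl in h1 h2; split=> //.
      by rewrite /a xi abszN absz_nat.
    by rewrite /v xi abszN absz_nat.
  move=> _ /mapP[x xl ->]; have [xjs ax vx x1 x2] := key x xl.
  have aM : a l `|x.2|%N < z + M.
    by rewrite ltNge; apply/negP => /hfar; rewrite ax vx; rewrite /t in tu; lra.
  split=> //.
  - by rewrite (big_rem x)//= ltn_addr.
  - by rewrite ax; lra.
  - by rewrite ax vx; rewrite /t in tu; lra.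
  - by move=> _ /mapP[y yl ->]; have [yjs ay vy y1 y2] := key y yl; rewrite ax vx ay; lra.
have le0 : (tau' Pr Cs T V w <= 0)%E.
  by apply: ge_ereal_sup => _ [r [r0 _] <-]; rewrite lee_fin ltW.
have get : (t%:E <= tau' Pr Cs T V w)%E by exact: ereal_sup_ubound.
move: le0 get; case: (tau' _ _ _ _ _) => [r| |] //=; rewrite !lee_fin => r0 tr.
by rewrite ler0_norm//; rewrite /t in tr; lra.
Qed.

End pathwise.

(** * Events determined by a set of coordinates *)

Section sigma_predicates.
Context {Omega : pointedType} {R : realType} (GG : set (set Omega)).
Local Notation OmegaG := (g_sigma_algebraType GG).

(** Retyping [Omega] with the generated sigma-algebra makes the usual closure properties of
    measurable functions available for a sub-sigma-algebra. *)
Definition fsig (f : Omega -> R) := measurable_fun [set: OmegaG] (f : OmegaG -> R).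
Definition msig (Q : Omega -> Prop) := (<<s GG >>) [set w | Q w].

Let msigE Q : msig Q = measurable ([set w | Q w] : set OmegaG). Proof. by []. Qed.

Lemma fsigP f : fsig f <-> forall B, measurable B -> (<<s GG >>) (f @^-1` B).
Proof.
split=> [h B mB|h _ B mB]; first by have := h measurableT B mB; rewrite setTI.
by rewrite setTI; exact: h.
Qed.

Lemma msig_const (Q : Prop) : msig (fun=> Q).
Proof.
rewrite msigE; case: (pselect Q) => h.
  by rewrite (_ : [set _ | _] = setT)//; apply/seteqP; split.
by rewrite (_ : [set _ | _] = set0)//; apply/seteqP; split.
Qed.

Lemma msig_ext Q Q' : (forall w, Q w <-> Q' w) -> msig Q -> msig Q'.
Proof. by move=> h; rewrite /msig (_ : [set w | Q w] = [set w | Q' w])//; apply/seteqP; split => w /h. Qed.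

Lemma msig_not Q : msig Q -> msig (fun w => ~ Q w).
Proof. by rewrite !msigE => h; apply: measurableC h. Qed.

Lemma msig_and Q Q' : msig Q -> msig Q' -> msig (fun w => Q w /\ Q' w).
Proof. by rewrite !msigE => h h'; apply: measurableI h h'. Qed.

Lemma msig_imp Q Q' : msig Q -> msig Q' -> msig (fun w => Q w -> Q' w).
Proof.
move=> h h'; rewrite msigE (_ : [set w | _] = ~` [set w | Q w /\ ~ Q' w]).
  by apply: measurableC; apply: msig_and => //; exact: msig_not.
apply/seteqP; split=> w /= hw; first by case=> q; apply; exact: hw.
by move=> q; apply: contrapT => nq; apply: hw.
Qed.

Lemma msig_guard (Q : Prop) Q' : (Q -> msig Q') -> msig (fun w => Q -> Q' w).
Proof.
move=> h; case: (pselect Q) => q; first exact: msig_imp (msig_const Q) (h q).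
by apply: (@msig_ext (fun=> True)); [move=> w; split=> // _ /q|exact: msig_const].
Qed.

Lemma msig_forall (T : countType) (Q : T -> Omega -> Prop) :
  (forall t, msig (Q t)) -> msig (fun w => forall t, Q t w).
Proof.
move=> h; rewrite msigE (_ : [set w | _] =
    \bigcap_(n in [set: nat]) [set w | forall t, unpickle n = Some t -> Q t w]).
  apply: bigcap_measurable => // n _; rewrite -msigE.
  case E : (unpickle n) => [t|]; last first.
    by apply: (@msig_ext (fun=> True)); [move=> w; split|exact: msig_const].
  by apply: msig_ext (h t) => w; split=> [hw _ [<-]|]; [|apply].
apply/seteqP; split=> w /= hw; first by move=> n _ t _; exact: hw.
by move=> t; apply: (hw (pickle t)) => //; rewrite pickleK.
Qed.

Lemma msig_lt f g : fsig f -> fsig g -> msig (fun w => f w < g w).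
Proof.
move=> hf hg; rewrite msigE -[X in measurable X]setTI.
have := @measurable_fun_ltr _ OmegaG R setT f g hf hg.
by move=> /(_ measurableT [set true] I).
Qed.

Lemma msig_le f g : fsig f -> fsig g -> msig (fun w => f w <= g w).
Proof.
move=> hf hg; rewrite msigE -[X in measurable X]setTI.
have := @measurable_fun_ler _ OmegaG R setT f g hf hg.
by move=> /(_ measurableT [set true] I).
Qed.

Lemma fsig_cst c : fsig (fun=> c). Proof. exact: measurable_cst. Qed.
Lemma fsigD f g : fsig f -> fsig g -> fsig (fun w => f w + g w). Proof. exact: measurable_funD. Qed.
Lemma fsigB f g : fsig f -> fsig g -> fsig (fun w => f w - g w). Proof. exact: measurable_funB. Qed.
Lemma fsigM f g : fsig f -> fsig g -> fsig (fun w => f w * g w). Proof. exact: measurable_funM. Qed.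
Lemma fsig_norm f : fsig f -> fsig (fun w => `|f w|).
Proof. by move=> hf; apply: measurableT_comp => //; exact: normr_measurable. Qed.

Lemma fsig_sum n (f : nat -> Omega -> R) : (forall i, (i < n)%N -> fsig (f i)) ->
  fsig (fun w => \sum_(0 <= i < n) f i w).
Proof.
elim: n => [|n IH] h.
  under eq_fun => w do rewrite big_nil; exact: fsig_cst.
under eq_fun => w do rewrite big_nat_recr//=.
by apply: fsigD; [apply: IH => i /ltnW; exact: h|exact: h].
Qed.

(** All quantifiers in [calm] range over countable types, the continuum of times having been
    replaced by pairwise overlaps. Only coordinates below [N] are read. *)
Lemma calm_sig (z K M c : R) N (a v : nat -> Omega -> R) :
  (forall i, (i < N)%N -> fsig (a i)) -> (forall i, (i < N)%N -> fsig (v i)) ->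
  msig (fun w => calm z K M c N (a^~ w) (v^~ w)).
Proof.
move=> ha hv; apply: msig_and.
  apply: msig_forall => i; apply: msig_guard => iN.
  apply: msig_imp; first by apply: msig_le (fsig_cst _) (ha _ iN).
  apply: msig_imp; first by apply: msig_lt (ha _ iN) (fsig_cst _).
  by apply: msig_le (hv _ iN) _; apply: fsigB (ha _ iN) (fsig_cst _).
apply: msig_forall => js; apply: msig_guard => ujs.
apply: msig_imp; last exact: msig_const.
case: (boolP (all (fun i => i < N)%N js)) => [/allP jsN|/allPn [i ijs iN]]; last first.
  apply: (msig_ext (Q := fun=> False)); last exact: msig_const.
  by move=> w; split=> // /(_ i ijs) [iN']; rewrite iN' in iN.
apply: msig_forall => i; apply: msig_guard => ijs.
have ai := ha _ (jsN i ijs); have vi := hv _ (jsN i ijs).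
apply: (msig_ext (Q := fun w => (z <= a i w /\ a i w < z + M) /\ (a i w - v i w < z + K /\
    forall i', i' \in js -> a i w - v i w < a i' w))).
  move=> w; split=> [[[h1 h2] [h3 h4]]|[h0 h1 h2 h3 h4]]; last by split.
  by split=> //; exact: jsN.
apply: msig_and; apply: msig_and.
- exact: msig_le (fsig_cst _) ai.
- exact: msig_lt ai (fsig_cst _).
- by apply: msig_lt (fsig_cst _); exact: fsigB.
- apply: msig_forall => i'; apply: msig_guard => i'js.
  by apply: msig_lt (ha _ (jsN i' i'js)); exact: fsigB.
Qed.

End sigma_predicates.

(** * The equilibrium renewal law *)

Lemma layer_cake {R : realType} (mu : probability R R) (f : R -> R) :
  measurable_fun setT f -> (forall x, 0 <= f x) ->
  (\int[mu]_x (f x)%:E = \int[lebesgue_measure]_(r in `[0%R, +oo[) mu [set x | (r < f x)%R])%E /\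
  measurable_fun setT (fun r : R => mu [set x : R | r < f x]).
Proof.
move=> mf f0.
pose X : {RV mu >-> R} := mfun_Sub (mem_set mf : f \in mfun).
have e r : ccdf X r = mu [set x : R | r < f x].
  rewrite /ccdf /distribution /pushforward /=.
  by congr (mu _); apply/seteqP; split => x /=; rewrite in_itv /= andbT.
split; last by rewrite -(funext e); exact: ccdf_measurable.
have := @ge0_expectation_ccdf _ _ _ mu X f0; rewrite unlock => ->.
by apply: eq_integral => r _; rewrite e.
Qed.

Section equilibrium.
Context {R : realType} (mu : probability R R) (m s : R).
Hypothesis s_gt0 : 0 < s.
Hypothesis m_gt0 : 0 < m.
Hypothesis mu_pos : mu `]-oo, 0%R]%classic = 0%E.
Hypothesis mu_mean : (\int[mu]_x `|x|%:E = m%:E)%E.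

Let tail r := mu `](s * r), +oo[%classic.

Let measurable_gt (f : R -> R) r : measurable_fun setT f -> measurable [set x : R | r < f x].
Proof.
move=> mf; rewrite -[X in measurable X]setTI.
have := @measurable_fun_ltr _ R R setT (cst r) f (measurable_cst _) mf.
by move=> /(_ measurableT [set true] I).
Qed.

Let mabs : measurable_fun setT (fun x : R => `|x| / s).
Proof. by apply: measurable_funM => //; exact: normr_measurable. Qed.

Lemma ccdf_abs r : 0 <= r -> mu [set x : R | r < `|x| / s] = tail r.
Proof.
move=> r0.
have m1 : measurable (`](s * r), +oo[ : set R) by exact: measurable_itv.
have mN : measurable (`]-oo, (0 : R)] : set R) by exact: measurable_itv.
have sub : [set x : R | r < `|x| / s] `<=` `](s * r), +oo[%classic `|` `]-oo, (0 : R)]%classic.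
  move=> x /=; rewrite ltr_pdivlMr// !in_itv /= andbT mulrC => hx.
  by case: (ltP 0 x) => [x0|]; [left; rewrite gtr0_norm// in hx|right].
have mA := measurable_gt r mabs.
apply/eqP; rewrite eq_le; apply/andP; split.
  apply: le_trans (le_measure mu _ _ sub) _; rewrite ?inE//; first exact: measurableU.
  by apply: le_trans (measureU2 _ m1 mN) _; rewrite [X in (_ + X)%E]mu_pos adde0.
apply: le_measure; rewrite ?inE// => x /=; rewrite in_itv /= andbT => hx.
by rewrite ltr_pdivlMr// mulrC (lt_le_trans hx)// ler_norm.
Qed.

Lemma measurable_tail : measurable_fun (`[0%R, +oo[%classic : set R) tail.
Proof.
have [_ h] := layer_cake mu mabs (fun x => divr_ge0 (normr_ge0 x) (ltW s_gt0)).
apply: (eq_measurable_fun (fun r : R => mu [set x : R | r < `|x| / s] : \bar R)).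
  by move=> r; rewrite inE /= in_itv /= andbT => r0; exact: ccdf_abs.
exact: measurable_funTS.
Qed.

Lemma integral_tail : (\int[lebesgue_measure]_(x in `]0%R, +oo[) tail x = (m / s)%:E)%E.
Proof.
have mt := measurable_tail.
rewrite integral_itv_obnd_cbnd; last by apply: measurable_funS mt => //; apply: subset_itvr; rewrite bnd_simp.
have [h _] := layer_cake mu mabs (fun x => divr_ge0 (normr_ge0 x) (ltW s_gt0)).
transitivity (\int[mu]_x (`|x| / s)%:E)%E.
  rewrite h; apply: eq_integral => r; rewrite inE /= in_itv /= andbT => r0.
  by rewrite ccdf_abs.
under eq_integral => x _ do rewrite mulrC EFinM.
rewrite ge0_integralZl_EFin ?invr_ge0 ?(ltW s_gt0)//; first by rewrite mu_mean -EFinM mulrC.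
by apply/measurable_EFinP; exact: normr_measurable.
Qed.

(** Beyond [v] the tail is that of [|x| / s] set to 0 below [v], and this truncated variable is at
    most [x ^ 2 / (s ^ 2 v)]. Here the second moment of the gaps controls the equilibrium age. *)
Lemma integral_tail_far v m2 : 0 < v -> (\int[mu]_x (x ^+ 2)%:E <= m2%:E)%E ->
  (\int[lebesgue_measure]_(x in `]v, +oo[) tail x <= (m2 / (s ^+ 2 * v))%:E)%E.
Proof.
move=> v0 hm2.
pose f (x : R) : R := if v < `|x| / s then `|x| / s else 0.
have mf : measurable_fun setT f.
  apply: measurable_fun_ifT => //; exact: measurable_fun_ltr.
have f0 x : 0 <= f x by rewrite /f; case: ifP => // _; rewrite divr_ge0// ltW.
have [h mh] := layer_cake mu mf f0.
have sub : `]v, +oo[ `<=` `[(0 : R), +oo[.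
  by apply: subset_itvr; rewrite bnd_simp ltW.
have mt := measurable_tail.
apply: (@le_trans _ _ (\int[lebesgue_measure]_(r in `]v, +oo[) mu [set x : R | (r < f x)%R])%E).
  apply: ge0_le_integral => //.
  - exact: measurable_funS mt.
  - exact: measurable_funTS.
  move=> r /=; rewrite in_itv /= andbT => vr.
  rewrite -ccdf_abs; last by rewrite ltW// (lt_trans v0).
  apply: le_measure; rewrite ?inE; [exact: measurable_gt|exact: measurable_gt|].
  by move=> x /= hx; rewrite /f (lt_trans vr hx).
apply: (@le_trans _ _ (\int[lebesgue_measure]_(r in `[0%R, +oo[) mu [set x : R | (r < f x)%R])%E).
  apply: ge0_subset_integral => //; exact: measurable_funTS.
rewrite -h; apply: (@le_trans _ _ (\int[mu]_x ((s ^+ 2 * v)^-1%:E * (x ^+ 2)%:E))%E).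
  apply: ge0_le_integral => //.
  - by move=> x _; rewrite lee_fin.
  - exact/measurable_EFinP.
  - by apply/measurable_EFinP; apply: measurable_funM => //; exact: measurable_funX.
  move=> x _; rewrite -EFinM lee_fin /f; case: ifPn => hx; last first.
    by apply: mulr_ge0 (sqr_ge0 _); rewrite invr_ge0 mulr_ge0 ?sqr_ge0// ltW.
  rewrite [leRHS]mulrC ler_pdivlMr ?mulr_gt0 ?exprn_gt0// -[x ^+ 2]real_normK ?num_real//.
  move: hx; rewrite ltr_pdivlMr// => hx; rewrite (_ : `|x| / s * (s ^+ 2 * v) = `|x| * (v * s)).
    by rewrite [`|x| ^+ 2]expr2 ler_wpM2l// ltW.
  by field; rewrite gt_eqF.
rewrite ge0_integralZl_EFin//.
- rewrite (_ : (m2 / (s ^+ 2 * v))%:E = ((s ^+ 2 * v)^-1%:E * m2%:E)%E); last by rewrite -EFinM mulrC.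
  by apply: lee_wpmul2l => //; rewrite lee_fin invr_ge0 mulr_ge0 ?sqr_ge0// ltW.
- by move=> x _; rewrite lee_fin sqr_ge0.
- by apply/measurable_EFinP; exact: measurable_funX.
- by rewrite invr_ge0 mulr_ge0 ?sqr_ge0// ltW.
Qed.

(** The full integral is [m / s], and the part over []0, u]] is at most [u] because a tail is at
    most 1. *)
Lemma integral_tail_near u : 0 <= u ->
  ((m / s - u)%:E <= \int[lebesgue_measure]_(x in `]u, +oo[) tail x)%E.
Proof.
move=> u0; have mt := measurable_tail.
have e0 : `](0 : R), +oo[%classic = `]0, u] `|` `]u, +oo[.
  by rewrite -itv_bndbnd_setU// bnd_simp.
have mt0 : measurable_fun (`](0 : R), +oo[%classic) tail.
  by apply: measurable_funS mt => //; apply: subset_itvr; rewrite bnd_simp.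
have := integral_tail; rewrite e0 ge0_integral_setU//; first last.
- by rewrite disj_set2E; apply/eqP; apply/seteqP; split => // x /=; rewrite !in_itv /= andbT; case=> /andP[_]; lra.
- by rewrite -e0.
move=> e; rewrite EFinB -e leeBlDr// addeC; apply: leeD2l.
have mi : measurable (`](0 : R), u] : set R) by exact: measurable_itv.
apply: (@le_trans _ _ (\int[@lebesgue_measure R]_(x in `]0%R, u]) (cst 1 : R -> \bar R) x)%E).
  apply: ge0_le_integral => //.
  - by apply: measurable_funS mt => // x /=; rewrite !in_itv /= andbT => /andP[/ltW].
  - by move=> x _; apply: probability_le1; exact: measurable_itv.
by rewrite integral_cst// mul1e [leLHS]lebesgue_measure_itv /= lte_fin; case: ifP; rewrite ?oppr0 ?adde0 ?lee_fin.
Qed.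

End equilibrium.

(** * The stationary input *)

(** Reversed time: the [i]-th gap back from [T l 0] starts at index [- (i + 1)]. The gap straddling
    the origin, index 0, whose law differs, is never met. *)
Definition cX {L : nat} (l : 'I_L) (i : nat) : comp_idx L := inl (inr (l, - (i.+1)%:Z)).
Definition cV {L : nat} (l : 'I_L) (i : nat) : comp_idx L := inr (l, - i%:Z).
Definition c0 {L : nat} (l : 'I_L) : comp_idx L := inl (inl l).

Lemma idx_succ (i : nat) : - (i.+1)%:Z + 1 = - i%:Z :> int. Proof. lia. Qed.

Lemma cX_inj {L : nat} (l : 'I_L) : injective (cX l). Proof. by move=> i j []; lia. Qed.

Lemma cV_inj {L : nat} (l : 'I_L) : injective (cV l). Proof. by move=> i j []; lia. Qed.

Section stationary.
Context {d} {Omega : measurableType d} {R : realType} (P : probability Omega R) (L : nat) (s : R).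
Variables (muX muV : 'I_L -> probability R R) (mX : 'I_L -> R) (T V : 'I_L -> int -> Omega -> R).
Hypothesis s_gt0 : 0 < s.
Hypothesis hst : stationary_input P s muX muV mX T V.

Definition input_events : comp_idx L -> set (set Omega) :=
  fun i => match i with
           | inl (inl l) => rv2_events (T l 0%R) (T l 1%R)
           | inl (inr (l, n)) => rv_events (fun w => T l (n + 1)%R w - T l n w)
           | inr (l, n) => rv_events (V l n)
           end.

Lemma input_indep : mutual_indep P (@comp_dom L) input_events.
Proof. by case: hst => _ [_ []]. Qed.

Lemma mT l n : measurable_fun setT (T l n). Proof. by case: hst => h _; exact: h. Qed.
Lemma mV l n : measurable_fun setT (V l n). Proof. by case: hst => _ [h _]; exact: h. Qed.

Lemma preim_measurable (f : Omega -> R) B : measurable_fun setT f -> measurable B -> measurable (f @^-1` B).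
Proof. by move=> mf mB; rewrite -[X in measurable X]setTI; exact: mf. Qed.

Lemma input_measurable i A : input_events i A -> measurable A.
Proof.
case: i => [[l|[l n]]|[l n]] /=.
- by move=> [B [C [mB mC ->]]]; apply: measurableI; apply: preim_measurable => //; exact: mT.
- by move=> [B mB <-]; apply: preim_measurable => //; apply: measurable_funB; exact: mT.
- by move=> [B mB <-]; apply: preim_measurable => //; exact: mV.
Qed.

Lemma inputI i : setI_closed (input_events i).
Proof.
case: i => [[l|[l n]]|[l n]] /= A A'.
- move=> [B [C [mB mC ->]]] [B' [C' [mB' mC' ->]]]; exists (B `&` B'), (C `&` C').
  by split; [exact: measurableI|exact: measurableI|rewrite !preimage_setI setIACA].
- by move=> [B mB <-] [B' mB' <-]; exists (B `&` B'); rewrite ?preimage_setI//; exact: measurableI.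
- by move=> [B mB <-] [B' mB' <-]; exists (B `&` B'); rewrite ?preimage_setI//; exact: measurableI.
Qed.

Lemma inputT i : input_events i setT.
Proof.
case: i => [[l|[l n]]|[l n]] /=.
- by exists setT, setT; split=> //; rewrite !preimage_setT setIT.
- by exists setT; [exact: measurableT|exact: preimage_setT].
- by exists setT; [exact: measurableT|exact: preimage_setT].
Qed.

Local Notation sig S := (<<s gens input_events S >>).

Lemma sig_gen i A : input_events i A -> sig [set i] A.
Proof. by move=> iA; apply: sub_gen_smallest; exists i. Qed.

Definition gap l (i : nat) w := s * (T l (- i%:Z) w - T l (- (i.+1)%:Z) w).
Definition svc l (i : nat) w := V l (- i%:Z) w.

Lemma gap_sig l i B : measurable B -> sig [set cX l i] (gap l i @^-1` B).
Proof.
move=> mB; apply: sig_gen; exists (( *%R s) @^-1` B).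
  by rewrite /= -[X in measurable X]setTI; apply: measurable_funM => //; exact: measurableT.
by rewrite /gap idx_succ.
Qed.

Lemma svc_sig l i B : measurable B -> sig [set cV l i] (svc l i @^-1` B).
Proof. by move=> mB; apply: sig_gen; exists B. Qed.

Lemma T0_sig l B : measurable B -> sig [set c0 l] (T l 0 @^-1` B).
Proof.
move=> mB; apply: sig_gen; exists B, setT; split=> //.
by rewrite preimage_setT setIT.
Qed.

Lemma gap_law l i B : measurable B -> P (gap l i @^-1` B) = muX l B.
Proof.
case: hst => _ [_ [h _ _ _]] mB; rewrite -(h l (- (i.+1)%:Z) B)//.
by congr (P _); apply/seteqP; split=> w; rewrite /gap /= idx_succ ?inE.
Qed.

Lemma svc_law l i B : measurable B -> P (svc l i @^-1` B) = muV l B.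
Proof.
case: hst => _ [_ [_ h _ _]] mB; rewrite -(h l (- i%:Z) B)//.
by congr (P _); apply/seteqP; split=> w; rewrite /svc /= ?inE.
Qed.

Lemma cX_dom l i : @comp_dom L (cX l i). Proof. by []. Qed.

Definition regular w := forall l, [/\ T l 0 w < 0, 0 < T l 1 w &
   forall n : int, n != 0 -> 0 < T l (n + 1) w - T l n w].

Hypothesis X_pos : forall l, muX l `]-oo, 0%R]%classic = 0%E.
Hypothesis X_mean : forall l, (\int[muX l]_x `|x|%:E = (mX l)%:E)%E.
Hypothesis mX_gt0 : forall l, 0 < mX l.

Lemma equilibrium_law l a b : 0 <= a -> 0 <= b ->
  P [set w | a < - T l 0 w /\ b < T l 1 w] =
  ((s / mX l)%:E * \int[lebesgue_measure]_(x in `](a + b)%R, +oo[%classic)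
     muX l `](s * x)%R, +oo[%classic)%E.
Proof. by case: hst => _ [_ [_ _ h _]]; exact: h. Qed.

Lemma measurable_T01 l a b : measurable [set w | a < - T l 0 w /\ b < T l 1 w].
Proof.
rewrite (_ : [set w | _] = (T l 0 @^-1` `]-oo, (- a)[) `&` (T l 1 @^-1` `]b, +oo[)).
  by apply: measurableI; apply: preim_measurable; [exact: mT|exact: measurable_itv|exact: mT|exact: measurable_itv].
by apply/seteqP; split=> w /=; rewrite !in_itv /= andbT ltrNr.
Qed.

Lemma equilibrium_far l v m2 : 0 < v -> (\int[muX l]_x (x ^+ 2)%:E <= m2%:E)%E ->
  pr P [set w | v < - T l 0 w /\ 0 < T l 1 w] <= m2 / (mX l * s * v).
Proof.
move=> v0 hm2; rewrite -lee_fin -prE; last exact: measurable_T01.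
rewrite equilibrium_law// ?(ltW v0)// addr0.
have := integral_tail_far s_gt0 (X_pos l) v0 hm2.
have sm0 : 0 <= s / mX l by rewrite divr_ge0// ltW.
rewrite -lee_fin in sm0; move=> /(lee_wpmul2l sm0) /le_trans; apply.
rewrite -EFinM lee_fin le_eqVlt; apply/orP; left; apply/eqP.
by field; rewrite !gt_eqF.
Qed.

Lemma equilibrium_near l u : 0 <= u ->
  1 - s * u / mX l <= pr P [set w | u < - T l 0 w /\ 0 < T l 1 w].
Proof.
move=> u0; rewrite -lee_fin -prE; last exact: measurable_T01.
rewrite equilibrium_law// addr0.
have := integral_tail_near s_gt0 (X_pos l) (X_mean l) u0.
have sm0 : 0 <= s / mX l by rewrite divr_ge0// ltW.
rewrite -lee_fin in sm0; move=> /(lee_wpmul2l sm0); apply: le_trans.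
rewrite -EFinM lee_fin le_eqVlt; apply/orP; left; apply/eqP.
by field; rewrite !gt_eqF.
Qed.

Lemma regular_ae : exists N, [/\ measurable N, P N = 0%E & forall w, ~ N w -> regular w].
Proof.
pose T01 l := ~` [set w | 0 < - T l 0 w /\ 0 < T l 1 w].
pose Gp l (n : int) := [set w | s * (T l (n + 1) w - T l n w) \in `]-oo, 0%R]%classic].
have mGp l n : measurable (Gp l n).
  rewrite (_ : Gp l n = (fun w => s * (T l (n + 1) w - T l n w)) @^-1` `]-oo, 0%R]%classic).
    apply: preim_measurable; last exact: measurable_itv.
    by apply: measurable_funM => //; apply: measurable_funB; exact: mT.
  by apply/seteqP; split=> w; rewrite /Gp /= inE.
have mT01 l : measurable (T01 l) by apply: measurableC; exact: measurable_T01.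
pose A (k : nat) := if unpickle k is Some x then
  match x : 'I_L + 'I_L * int with inl l => T01 l
  | inr (l, n) => if n != 0 then Gp l n else set0 end else set0.
have mA k : measurable (A k).
  by rewrite /A; case: unpickle => // -[l|[l n]] //; case: ifP.
have A0 k : pr P (A k) = 0.
  rewrite /A; case: unpickle => [[l|[l n]]|]; rewrite ?pr0//.
    apply/eqP; rewrite eq_le pr_ge0 andbT prC; last exact: measurable_T01.
    (* At [u = 0] the lower bound equals 1, so the origin almost surely lies strictly between the
       initial points. *)
    by have := equilibrium_near l (lexx 0); rewrite mulr0 mul0r subr0; lra.
  case: ifPn => n0; rewrite ?pr0//; case: hst => _ [_ [h _ _ _]].
  by rewrite /pr h// X_pos.
exists (\bigcup_k A k); split; first exact: bigcup_measurable.
  rewrite prE; last exact: bigcup_measurable.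
  congr EFin; apply/eqP; rewrite eq_le pr_ge0 andbT.
  apply: pr_bigcup_le => // n; apply: le_trans (pr_big_le _ _ _) _ => //.
  by rewrite big1.
move=> w nA l.
have nAx x : ~ (match x : 'I_L + 'I_L * int with inl l => T01 l
  | inr (l, n) => if n != 0 then Gp l n else set0 end) w.
  by move=> h; apply: nA; exists (pickle x) => //; rewrite /A pickleK.
have := nAx (inl l); rewrite /T01 /= => /contrapT [h0 h1]; split=> //; first by rewrite -oppr_gt0.
move=> n n0; have := nAx (inr (l, n)); rewrite n0 /Gp /= inE /= in_itv /= => /negP.
by rewrite -ltNge pmulr_rgt0.
Qed.

(** Ages of the arrivals. The absolute values make them nonnegative and nondecreasing at every [w],
    so only the final comparison with [tau'] needs [regular]. *)
Definition arr l (n : nat) w := `|T l 0 w| + (\sum_(0 <= i < n) `|gap l i w|) / s.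

Lemma arrE l n w : regular w -> arr l n w = - T l (- n%:Z) w.
Proof.
move=> hw; have [T0 T1 g] := hw l; rewrite /arr ltr0_norm//.
elim: n => [|n IH]; first by rewrite big_nil mul0r addr0 oppr0.
rewrite big_nat_recr//= mulrDl addrA IH /gap.
have := g (- (n.+1)%:Z) isT; rewrite idx_succ => gn.
by rewrite gtr0_norm ?mulr_gt0// mulrAC divff ?gt_eqF// mul1r; ring.
Qed.

Lemma regular_future l (n : int) w : regular w -> 0 < n -> 0 < T l n w.
Proof.
move=> hw; have [T0 T1 g] := hw l; case: n => // -[|n] // _.
elim: n => [//|n IH]; have := g n.+1%:Z isT; rewrite subr_gt0 => /(lt_trans IH).
by rewrite (_ : n.+1%:Z + 1 = n.+2%:Z)// -[1]/(1%:Z) -PoszD addn1.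
Qed.

Lemma arr_homo l w : {homo (arr l)^~ w : i j / (i <= j)%N >-> i <= j}.
Proof.
move=> i j ij; rewrite /arr lerD2l ler_pM2r ?invr_gt0//.
rewrite [leRHS](big_cat_nat (n := i))//= lerDl.
exact: sumr_ge0.
Qed.

Lemma arr_shift l N j w : arr l (N + j) w =
  arr l N w + (\sum_(0 <= i < j) `|gap l (N + i) w|) / s.
Proof.
rewrite /arr -addrA -mulrDl (big_cat_nat (n := N))//= ?leq_addr//; congr (_ + (_ + _) / s).
by rewrite -{1}[N]add0n big_addn addKn; apply: eq_bigr => i _; rewrite addnC.
Qed.

End stationary.

(** * Consecutive trials *)

Lemma pr_big_disjoint {d} {Omega : measurableType d} {R : realType} (P : probability Omega R)
  (J : eqType) (r : seq J) (A : J -> set Omega) : uniq r ->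
  (forall j, measurable (A j)) -> (forall i j, i != j -> A i `&` A j = set0) ->
  pr P (\big[setU/set0]_(j <- r) A j) = \sum_(j <- r) pr P (A j).
Proof.
move=> + mA dA; elim: r => [|j r IH] /=; first by rewrite !big_nil pr0.
move=> /andP[jr ur]; rewrite !big_cons prU// ?IH//; first exact: bigsetU_measurable.
rewrite big_seq; apply: (big_ind (fun X => A j `&` X = set0)); first by rewrite setI0.
  by move=> X Y hX hY; rewrite setIUr hX hY setU0.
by move=> i ir; apply: dA; apply: contraNneq jr => ->.
Qed.

Section trials.
Context {d} {Omega : measurableType d} {R : realType} (P : probability Omega R) (L : nat) (s : R).
Variables (muX muV : 'I_L -> probability R R) (mX : 'I_L -> R) (T V : 'I_L -> int -> Omega -> R).
Hypothesis s_gt0 : 0 < s.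
Hypothesis hst : stationary_input P s muX muV mX T V.
Local Notation G := (input_events T V).
Local Notation sig S := (<<s gens G S >>).
Local Notation gap := (gap s T).
Local Notation svc := (svc V).
Local Notation arr := (arr s T).

Variables (K M : R) (cl : 'I_L -> R) (p : R).
Hypothesis M_gt0 : 0 < M.
Hypothesis p_ge0 : 0 <= p.
(** The event is chosen from [l] and [N] alone and works for every [z] whose passage index is [N];
    this is what permits conditioning on the passage. *)
Hypothesis window : forall l N, exists E,
  [/\ sig (range (fun i => cX l (N + i)) `|` range (fun i => cV l (N + i))) E, p <= pr P E &
   forall w z, E w -> (forall i, (i < N)%N -> arr l i w < z) -> z <= arr l N w ->
     forall N', calm z K M (cl l) N' ((arr l)^~ w) ((svc l)^~ w)].
Hypothesis reach : forall z e : R, 0 < e -> exists B : nat,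
  exists2 A, measurable A & 1 - e <= pr P A /\ forall w l, A w -> z <= arr l B w.

Definition success (k : nat) w := forall l N, calm (k%:R * M) K M (cl l) N ((arr l)^~ w) ((svc l)^~ w).
Definition failures (n : nat) w := forall k, (0 < k <= n)%N -> ~ success k w.

(** Coordinates revealed up to the passage indices. The age of arrival [nu l] uses the gaps below
    [nu l] only, whereas its service time already belongs to the window. *)
Definition past (nu : 'I_L -> nat) : set (comp_idx L) :=
  [set c | (exists l, c = c0 l) \/ exists l i, (i < nu l)%N /\ (c = cX l i \/ c = cV l i)].

Let pastD nu : past nu `<=` @comp_dom L.
Proof. by move=> c [[l ->]|[l [i [_ [->|->]]]]]. Qed.

Let fsig_T0 nu l : fsig (gens G (past nu)) (T l 0).
Proof.
apply/fsigP => B mB; apply: (sub_sig _ (T0_sig mB)).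
by move=> _ ->; left; exists l.
Qed.

Let fsig_gap nu l i : (i < nu l)%N -> fsig (gens G (past nu)) (gap l i).
Proof.
move=> il; apply/fsigP => B mB; apply: (sub_sig _ (gap_sig s mB)).
by move=> _ ->; right; exists l, i; split => //; left.
Qed.

Let fsig_svc nu l i : (i < nu l)%N -> fsig (gens G (past nu)) (svc l i).
Proof.
move=> il; apply/fsigP => B mB; apply: (sub_sig _ (svc_sig mB)).
by move=> _ ->; right; exists l, i; split => //; right.
Qed.

Let fsig_arr nu l i : (i <= nu l)%N -> fsig (gens G (past nu)) (arr l i).
Proof.
move=> il; apply: fsigD; first by apply: fsig_norm; exact: fsig_T0.
apply: fsigM; last exact: fsig_cst.
by apply: fsig_sum => j ji; apply: fsig_norm; apply: fsig_gap; apply: leq_trans il.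
Qed.

Let msig_measurable nu Q : msig (gens G (past nu)) Q -> measurable [set w | Q w].
Proof. by move=> h; apply: (sig_measurable (input_measurable hst)) h. Qed.

Lemma success_measurable k : measurable [set w | success k w].
Proof.
rewrite (_ : [set w | _] = \bigcap_(N in [set: nat]) [set w | forall l, calm (k%:R * M) K M (cl l) N ((arr l)^~ w) ((svc l)^~ w)]).
  apply: bigcap_measurable => // N _.
  apply: (@msig_measurable (fun=> N)); apply: msig_forall => l; apply: calm_sig => i iN.
    by apply: fsig_arr; exact: ltnW.
  exact: fsig_svc.
apply/seteqP; split=> w /= h; first by move=> N _ l; exact: h.
by move=> l N; apply: h.
Qed.

Lemma failures_measurable n : measurable [set w | failures n w].
Proof.
rewrite (_ : [set w | _] = \bigcap_(k in [set k | (0 < k <= n)%N]) ~` [set w | success k w]).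
  by apply: bigcap_measurableType => k _; apply: measurableC; exact: success_measurable.
by apply/seteqP; split=> w /= h.
Qed.

Definition passage (z : R) (nu : 'I_L -> nat) w :=
  forall l, (forall i, (i < nu l)%N -> arr l i w < z) /\ z <= arr l (nu l) w.

Lemma passage_sig z nu : msig (gens G (past nu)) (passage z nu).
Proof.
apply: msig_forall => l; apply: msig_and.
  apply: msig_forall => i; apply: msig_guard => il.
  by apply: (msig_lt _ (@fsig_cst _ _ _ _)); apply: fsig_arr; exact: ltnW.
by apply: (msig_le (@fsig_cst _ _ _ _)); exact: fsig_arr.
Qed.

(* Before the passage of [(n + 1) M] no arrival counted in the first [n] trials is missing. *)
Lemma failures_passage_sig n nu :
  msig (gens G (past nu)) (fun w => failures n w /\ passage (n.+1%:R * M) nu w).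
Proof.
apply: (msig_ext (Q := fun w => (forall k, (0 < k <= n)%N -> ~ forall l,
    calm (k%:R * M) K M (cl l) (nu l) ((arr l)^~ w) ((svc l)^~ w)) /\ passage (n.+1%:R * M) nu w)).
  move=> w; split=> -[h1 h2]; split=> // k kn h; apply: (h1 k kn).
    by move=> l; exact: h.
  move=> l N; apply: calm_passage (h l) N; first exact: arr_homo.
  have [_ h3] := h2 l; apply: le_trans h3.
  rewrite -{2}[M]mul1r -mulrDl ler_pM2r// natr1 ler_nat ltnS.
  by case/andP: kn.
apply: msig_and; last exact: passage_sig.
apply: msig_forall => k; apply: msig_guard => _; apply: msig_not; apply: msig_forall => l.
apply: calm_sig => i il; first by apply: fsig_arr; exact: ltnW.
exact: fsig_svc.
Qed.

(* On the cell where the routes pass age [(n + 1) M] at the indices [nu], the past of [nu]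
   is independent of the windows that make trial [n + 1] succeed. *)
Lemma failures_step n :
  pr P [set w | failures n.+1 w] <= (1 - p ^+ L) * pr P [set w | failures n w].
Proof.
set z := n.+1%:R * M; set F := [set w | failures n w].
have mF : measurable F by exact: failures_measurable.
have mS : measurable [set w | success n.+1 w] by exact: success_measurable.
have [W hW] := choice (fun x : 'I_L * nat => window x.1 x.2).
pose cell (nu : 'I_L -> nat) := [set w | failures n w /\ passage z nu w].
have scell nu : sig (past nu) (cell nu) by exact: failures_passage_sig.
have mcell nu : measurable (cell nu) := sig_measurable (input_measurable hst) (scell nu).
pose WW (nu : 'I_L -> nat) := \big[setI/setT]_(l <- enum 'I_L) W (l, nu l).
have mW x : measurable (W x) by have [h _ _] := hW x; exact: (sig_measurable (input_measurable hst) h).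
have mWW nu : measurable (WW nu) by apply: bigsetI_measurable.
have WWP nu w : WW nu w -> forall l, W (l, nu l) w.
  move=> h l; have : l \in enum 'I_L by rewrite mem_enum.
  move: h; rewrite /WW; elim: (enum _) => [|l' r IH]; rewrite ?big_nil// big_cons inE.
  by move=> [h1 h2] /orP[/eqP ->//|]; exact: IH.
have prcell nu : p ^+ L * pr P (cell nu) <= pr P (cell nu `&` WW nu).
  pose SS (x : 'I_L) := range (fun i => cX x (nu x + i)) `|` range (fun i => cV x (nu x + i)).
  rewrite (indep_sig_big (input_measurable hst) (inputI (V := V)) (inputT T V) (input_indep hst)
    (S := SS) (T := past nu) (A := fun l => W (l, nu l)) (enum_uniq _)).
  - rewrite mulrC ler_wpM2l ?pr_ge0// big_enum /=.
    have <- : \prod_(l in 'I_L) p = p ^+ L by rewrite prodr_const card_ord.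
    by apply: ler_prod => l _; have [_ h _] := hW (l, nu l); rewrite p_ge0.
  - by move=> l _ [[i _ <-]|[i _ <-]].
  - exact: pastD.
  - move=> l l' ll'; apply/seteqP; split=> // c [[[i _ <-]|[i _ <-]] [[j _]|[j _]]] // [] /esym e; by rewrite e eqxx in ll'.
  - move=> l _; apply/seteqP; split=> // c [[[l' ->]|[l' [i [il [->|->]]]]] [[j _]|[j _]]] //.
      by move=> /esym []; move=> e; subst l'; move=> e; have := il; lia.
    by move=> /esym []; move=> e; subst l'; move=> e; have := il; lia.
  - by move=> l; have [h _ _] := hW (l, nu l).
  - exact: scell.
have sub nu : cell nu `&` WW nu `<=` F `&` [set w | success n.+1 w].
  move=> w [[h1 h2] hw]; split=> // l; have [_ _ h] := hW (l, nu l).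
  by have [h3 h4] := h2 l; apply: (h w z) => //; exact: WWP.
have dcell nu nu' : (exists l, nu l != nu' l) -> cell nu `&` cell nu' = set0.
  move=> [l ll]; apply/seteqP; split => // w [[_ /(_ l) [h1 h2]] [_ /(_ l) [h3 h4]]].
  by case: ltngtP ll => // [/h3|/h1]; lra.
(* [reach] confines all passage indices below a common [B] up to probability [e], so that finitely
   many cells are summed. *)
have key e : 0 < e -> p ^+ L * (pr P F - e) <= pr P (F `&` [set w | success n.+1 w]).
  move=> e0; have [B [A mA [A1 A2]]] := reach z e0.
  pose J := {ffun 'I_L -> 'I_B.+1}; pose nu (j : J) (l : 'I_L) : nat := j l.
  have dJ (i j : J) : i != j -> exists l, nu i l != nu j l.
    move=> ij; apply: contrapT => /forallNP h; move/eqP: ij; apply; apply/ffunP => l.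
    by apply/val_inj/eqP/negP => /negP; exact: h.
  have cover : F `&` A `<=` \big[setU/set0]_(j <- enum J) cell (nu j).
    move=> w [Fw Aw].
    have ex l : exists k, z <= arr l k w by exists B; exact: A2.
    have lt l : (ex_minn (ex l) < B.+1)%N.
      by rewrite ltnS; case: ex_minnP => k _; apply; exact: A2.
    pose j : J := [ffun l => Ordinal (lt l)].
    have jin : j \in enum J by rewrite mem_enum.
    have cj : cell (nu j) w.
      split=> // l; rewrite /nu ffunE /=; case: ex_minnP => k hk kmin; split=> // i ik.
      by rewrite ltNge; apply/negP => /kmin; rewrite leqNgt ik.
    move: jin; elim: (enum J) => [|i r IH]; first by rewrite in_nil.
    by rewrite big_cons inE => /orP[/eqP <-|/IH]; [left|right].
  have mbig (A' : J -> set Omega) : (forall j, measurable (A' j)) ->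
      measurable (\big[setU/set0]_(j <- enum J) A' j) by move=> h; exact: bigsetU_measurable.
  have h1 : pr P F - e <= \sum_(j <- enum J) pr P (cell (nu j)).
    rewrite -(pr_big_disjoint P (enum_uniq J) (A := fun j => cell (nu j)))//; last first.
      by move=> i j /dJ; exact: dcell.
    apply: le_trans (le_pr P _ _ cover); [|exact: measurableI|exact: mbig].
    have := pr_leU P (measurableI _ _ mF mA) (measurableC mA).
    rewrite prC//; have : pr P F <= pr P (F `&` A `|` ~` A).
      apply: le_pr => //; first by apply: measurableU; [exact: measurableI|exact: measurableC].
      by move=> w Fw; case: (pselect (A w)); [left|right].
    by lra.
  apply: le_trans (_ : p ^+ L * (\sum_(j <- enum J) pr P (cell (nu j))) <= _).
    by rewrite ler_wpM2l// exprn_ge0.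
  rewrite mulr_sumr; apply: (@le_trans _ _ (\sum_(j <- enum J) pr P (cell (nu j) `&` WW (nu j)))).
    by apply: ler_sum => j _; exact: prcell.
  rewrite -(pr_big_disjoint P (enum_uniq J) (A := fun j => cell (nu j) `&` WW (nu j))).
  - apply: le_pr; [by apply: mbig => j; exact: measurableI|exact: measurableI|].
    apply: (big_ind (fun X => X `<=` F `&` [set w | success n.+1 w])) => //.
      by move=> X Y hX hY; rewrite subUset.
  - by move=> j; exact: measurableI.
  - move=> i j /dJ h; rewrite setIACA (dcell _ _ h) set0I//.
(* Letting [e] tend to 0: a deficit [D] is contradicted at [e = D / (2 (p ^ L + 1))], where at most
   [D / 2] is lost. *)
have le : p ^+ L * pr P F <= pr P (F `&` [set w | success n.+1 w]).
  rewrite leNgt; apply/negP => h.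
  set D := p ^+ L * pr P F - pr P (F `&` [set w | success n.+1 w]).
  have D0 : 0 < D by rewrite /D; lra.
  have pL : 0 <= p ^+ L by rewrite exprn_ge0.
  have := key (D / (2 * (p ^+ L + 1))) _.
  have q0 : 0 < 2 * (p ^+ L + 1) by lra.
  move=> /(_ (divr_gt0 D0 q0)); rewrite mulrBr.
  have : p ^+ L * (D / (2 * (p ^+ L + 1))) <= D / 2.
    rewrite mulrA ler_pdivrMr//; nra.
  by rewrite {2}/D; lra.
have -> : [set w | failures n.+1 w] = F `\` (F `&` [set w | success n.+1 w]).
  apply/seteqP; split=> w /=.
    move=> h; split; last by move=> [_ hs]; apply: (h n.+1) hs; rewrite leqnn.
    by move=> k /andP[k0 kn]; apply: h; rewrite k0 leqW.
  move=> [h1 h2] k /andP[k0]; rewrite leq_eqVlt => /orP[/eqP -> hs|kn]; first by apply: h2.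
  by apply: h1; rewrite k0.
rewrite pr_setD//; last exact: measurableI.
by rewrite mulrBl mul1r lerD2l lerN2.
Qed.

Lemma failures_prob n : p <= 1 -> pr P [set w | failures n w] <= (1 - p ^+ L) ^+ n.
Proof.
move=> p1; have q0 : 0 <= 1 - p ^+ L by rewrite subr_ge0 exprn_ile1.
elim: n => [|n IH]; first by rewrite expr0; apply: pr_le1; exact: failures_measurable.
by rewrite exprS; apply: le_trans (failures_step n) _; rewrite ler_wpM2l.
Qed.

End trials.

(** * Old jobs *)

Section far.
Context {d} {Omega : measurableType d} {R : realType} (P : probability Omega R) (L : nat) (s : R).
Variables (muX muV : 'I_L -> probability R R) (mX : 'I_L -> R) (T V : 'I_L -> int -> Omega -> R).
Hypothesis s_ge1 : 1 <= s.
Let s_gt0 : 0 < s := lt_le_trans ltr01 s_ge1.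
Hypothesis hst : stationary_input P s muX muV mX T V.
Local Notation G := (input_events T V).
Local Notation sig S := (<<s gens G S >>).
Local Notation gap := (gap s T).
Local Notation svc := (svc V).
Local Notation arr := (arr s T).

Variables (eta0 eta cq : 'I_L -> R).
Hypothesis eta0_gt0 : forall l, 0 < eta0 l.
Hypothesis eta_gt0 : forall l, 0 < eta l.
Hypothesis drift : forall l, pr (muX l) `]eta0 l, +oo[%classic * expR (eta l - eta0 l) +
  (1 - pr (muX l) `]eta0 l, +oo[%classic) * expR (eta l) <= 1.
Hypothesis cq_ge0 : forall l, 0 <= cq l.
Hypothesis muV_tail : forall l y, 0 < y -> pr (muV l) `]y, +oo[%classic <= cq l / y ^+ (5 + 2).

Lemma measurable_gap l i : measurable_fun setT (gap l i).
Proof. by apply: measurable_funM => //; apply: measurable_funB; exact: (mT hst). Qed.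

Lemma measurable_svc l i : measurable_fun setT (svc l i).
Proof. exact: (mV hst). Qed.

Lemma measurable_arr l i : measurable_fun setT (arr l i).
Proof.
apply: measurable_funD.
  by apply: measurableT_comp (mT hst _ _); exact: normr_measurable.
apply: measurable_funM => //; apply: measurable_sum => j.
by apply: measurableT_comp (measurable_gap _ _); exact: normr_measurable.
Qed.

Lemma measurable_lt (f g : Omega -> R) : measurable_fun setT f -> measurable_fun setT g ->
  measurable [set w | f w < g w].
Proof.
move=> mf mg; rewrite -[X in measurable X]setTI.
by have := measurable_fun_ltr mf mg; move=> /(_ measurableT [set true] I).
Qed.

Definition slow_arrivals (y : R) l := \bigcup_i [set w | arr l i w < (eta l * i%:R - y) / s].

Lemma measurable_slow y l : measurable (slow_arrivals y l).
Proof.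
apply: bigcup_measurable => i _; apply: measurable_lt; first exact: measurable_arr.
exact: measurable_cst.
Qed.

(** [walk_tail] bounds any finite number of indices with the same constant, so continuity from below
    gives all of them for one price. *)
Lemma slow_arrivals_pr y l : pr P (slow_arrivals y l) <= expR (- y).
Proof.
have mi i : measurable [set w | arr l i w < (eta l * i%:R - y) / s].
  by apply: measurable_lt; [exact: measurable_arr|exact: measurable_cst].
apply: pr_bigcup_le => // n.
have [E [sE pE hE]] := walk_tail (input_measurable hst) (inputI (V := V)) (inputT T V) (input_indep hst)
  (@cX_inj _ l) (@cX_dom _ l) (fun i B mB => gap_sig s mB) (gap_law hst l) y n (eta0_gt0 l) (drift l).
have mE : measurable E by exact: (sig_measurable (input_measurable hst) sE).
apply: (@le_trans _ _ (pr P (~` E))); last by rewrite prC//; lra.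
apply: le_pr; [exact: bigsetU_measurable|exact: measurableC|].
move=> w; rewrite -(bigcup_mkord n (fun i => [set w | arr l i w < (eta l * i%:R - y) / s])) => -[i /= ilt hi] Ew.
have := hE w Ew i (ltnW ilt); move: hi; rewrite ltr_pdivlMr// /arr mulrDl divfK ?gt_eqF//.
by have := mulr_ge0 (normr_ge0 (T l 0 w)) (ltW s_gt0); lra.
Qed.

(* Trials reach age [M ^ 2]; the slope in [i] makes the tails summable while staying
   below the slope [eta / s] of the ages. *)
Definition load (M : R) l (i : nat) := M / 4 * (1 + eta l * i%:R / (8 * s * M ^+ 2)).
Definition long_services M l := \bigcup_i [set w | load M l i < svc l i w].

Lemma measurable_long M l : measurable (long_services M l).
Proof.
apply: bigcup_measurable => i _; apply: measurable_lt; first exact: measurable_cst.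
exact: measurable_svc.
Qed.

(** With this constant [load M l i >= kappa l / (s * M) * (1 + i)]: the slope of [load] is
    [eta / (32 s M)], and its constant term is [M / 4]. *)
Definition kappa l := Num.min (1 / 4) (eta l / 32).

Lemma kappa_gt0 l : 0 < kappa l.
Proof. by rewrite /kappa lt_min !divr_gt0. Qed.

(** [tail_sum] with [A = M / 4], [u = kappa / (s M)] and seven moments: five powers of [M] are
    gained and two lost, and the remaining three are what makes the series over [M] converge. *)
Lemma long_services_pr M l : 1 <= M ->
  pr P (long_services M l) <= 2 * 4 ^+ 5 * cq l / kappa l ^+ 2 * s ^+ 2 / M ^+ 3.
Proof.
move=> M1; have M0 : 0 < M by apply: lt_le_trans M1.
have k0 := kappa_gt0 l.
have mi i : measurable [set w | load M l i < svc l i w].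
  by apply: measurable_lt; [exact: measurable_cst|exact: measurable_svc].
apply: pr_bigcup_le => // n.
apply: le_trans (pr_big_le _ _ _) _ => //.
have A0 : 0 < M / 4 by rewrite divr_gt0.
have u0 : 0 < kappa l / (s * M) by rewrite divr_gt0// mulr_gt0.
have e0 := eta_gt0 l.
rewrite [leRHS](_ : _ = 2 * cq l / ((M / 4) ^+ 5 * (kappa l / (s * M)) ^+ 2)); last first.
  by field; rewrite !gt_eqF.
apply: le_trans (tail_sum n A0 u0 (cq_ge0 l) (@muV_tail l) (theta := load M l) _ _).
- apply: ler_sum => i _; rewrite /pr -(svc_law hst l i (B := `]load M l i, +oo[%classic)).
    by rewrite le_eqVlt; apply/orP; left; apply/eqP; congr (fine (P _)); apply/seteqP; split=> w /=; rewrite in_itv /= andbT.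
  exact: measurable_itv.
- move=> i; rewrite /load ler_peMr ?(ltW A0)// lerDl divr_ge0 ?mulr_ge0 ?sqr_ge0 ?(ltW e0) ?(ltW s_gt0) ?(ltW M0)//.
- move=> i; have -> : load M l i = M / 4 + eta l / 32 / (s * M) * i%:R.
    by rewrite /load; field; rewrite !gt_eqF.
  rewrite mulrDr mulr1; apply: lerD.
    rewrite ler_pdivrMr ?mulr_gt0//; apply: (@le_trans _ _ (1 / 4)); first by rewrite ge_min lexx.
    rewrite [leRHS](_ : _ = 1 / 4 * (M * (s * M))); last by ring.
    rewrite ler_peMr ?divr_ge0//; rewrite -[1 in leLHS]mulr1 ler_pM//.
    by rewrite -[1 in leLHS]mulr1 ler_pM.
  rewrite ler_wpM2r// ler_pM2r ?invr_gt0 ?mulr_gt0//.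
  by rewrite ge_min lexx orbT.
Qed.

Lemma far_services (M K : R) w k : 1 <= M -> 0 <= K -> 2 * K <= M -> (0 < k)%N -> k%:R <= M ->
  (forall l, ~ slow_arrivals M l w) -> (forall l, ~ long_services M l w) ->
  forall l i, k%:R * M + M <= arr l i w -> svc l i w <= arr l i w - (k%:R * M + K).
Proof.
move=> M1 K0 KM k0 kM hslow hlong l i ha.
have M0 : 0 < M by apply: lt_le_trans M1.
have hv : svc l i w <= load M l i.
  by rewrite leNgt; apply/negP => h; apply: (hlong l); exists i.
have har : (eta l * i%:R - M) / s <= arr l i w.
  by rewrite leNgt; apply/negP => h; apply: (hslow l); exists i.
apply: le_trans hv _.
set u := eta l * i%:R / s.
have lE : load M l i = M / 4 + u / (32 * M).
  by rewrite /load /u; field; rewrite !gt_eqF.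
rewrite lE; case: (lerP u (8 * M ^+ 2)) => hu.
  have : u / (32 * M) <= M / 4.
    by rewrite ler_pdivrMr ?mulr_gt0//; move: hu; rewrite expr2; lra.
  by lra.
have h1 : u - M <= arr l i w.
  apply: le_trans har; rewrite mulrBl lerD2l lerN2 ler_pdivrMr//.
  by rewrite ler_peMr// ltW.
have u0 : 0 <= u by apply: le_trans (ltW hu); rewrite mulr_ge0// sqr_ge0.
have h2 : u / (32 * M) <= u / 32.
  by rewrite ler_wpM2l// lef_pV2 ?posrE ?mulr_gt0// ler_peMr.
have h3 : k%:R * M <= M ^+ 2 by rewrite expr2 ler_pM2r.
have h4 : M <= M ^+ 2 by rewrite expr2 ler_peMr// ltW.
by lra.
Qed.

Lemma slow_reach z e : 0 < e -> exists B : nat,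
  exists2 A, measurable A & 1 - e <= pr P A /\ forall w l, A w -> z <= arr l B w.
Proof.
(* Gives [L * expR (- y) <= e], from [expR y >= 1 + y]. *)
move=> e0; pose y := L%:R / e.
have y0 : 0 <= y by rewrite divr_ge0// ltW.
pose S := \big[setU/set0]_(l <- enum 'I_L) slow_arrivals y l.
have mS : measurable S by apply: bigsetU_measurable => l _; exact: measurable_slow.
exists (\sum_(l < L) (Num.truncn ((s * `|z| + y) / eta l)).+1)%N, (~` S); first exact: measurableC.
split.
  rewrite prC// lerD2l lerN2; apply: le_trans (pr_big_le _ _ _) _; first by move=> l; exact: measurable_slow.
  apply: (@le_trans _ _ (\sum_(l <- enum 'I_L) expR (- y))).
    by apply: ler_sum => l _; exact: slow_arrivals_pr.
  rewrite big_enum /= sumr_const card_ord -mulr_natl expRN ler_pdivrMr ?expR_gt0//.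
  have := expR_ge1Dx y; rewrite -(ler_pM2l e0) mulrDr mulr1 mulrC.
  by rewrite [y * e]divfK ?gt_eqF//; lra.
move=> w l Sw; set B := (\sum_(_ < L) _)%N.
have hB : (s * `|z| + y) / eta l <= B%:R.
  apply: le_trans (ltW (truncnS_gt _)) _; rewrite ler_nat /B (bigD1 l)//=.
  by rewrite leq_addr.
have : ~ slow_arrivals y l w.
  move=> h; apply: Sw; have : l \in enum 'I_L by rewrite mem_enum.
  rewrite /S; elim: (enum _) => [|l' r IH]; first by rewrite in_nil.
  by rewrite big_cons inE => /orP[/eqP <-|/IH]; [left|right].
move=> h; have : (eta l * B%:R - y) / s <= arr l B w.
  by rewrite leNgt; apply/negP => h'; apply: h; exists B.
apply: le_trans; rewrite ler_pdivlMr//; move: hB; rewrite ler_pdivrMr//.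
have := ler_norm z; rewrite -(ler_pM2r s_gt0); lra.
Qed.

End far.

(** * Tail of [tau'] *)

Section tail_bound.
Context {d} {Omega : measurableType d} {R : realType} (P : probability Omega R) (J L : nat) (s : R).
Variables (muX muV : 'I_L -> probability R R) (mX : 'I_L -> R) (T V : 'I_L -> int -> Omega -> R).
Hypothesis s_ge1 : 1 <= s.
Let s_gt0 : 0 < s := lt_le_trans ltr01 s_ge1.
Hypothesis hst : stationary_input P s muX muV mX T V.
Local Notation gap := (gap s T).
Local Notation svc := (svc V).
Local Notation arr := (arr s T).

Variables (eta0 eta cq : 'I_L -> R).
Hypothesis eta0_gt0 : forall l, 0 < eta0 l.
Hypothesis eta_gt0 : forall l, 0 < eta l.
Hypothesis drift : forall l, pr (muX l) `]eta0 l, +oo[%classic * expR (eta l - eta0 l) +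
  (1 - pr (muX l) `]eta0 l, +oo[%classic) * expR (eta l) <= 1.
Hypothesis cq_ge0 : forall l, 0 <= cq l.
Hypothesis muV_tail : forall l y, 0 < y -> pr (muV l) `]y, +oo[%classic <= cq l / y ^+ (5 + 2).

Definition far_const := \sum_(l < L) (6 + 2 * 4 ^+ 5 * cq l / kappa eta l ^+ 2).

Lemma expR_le_cube (M : R) : 0 < M -> expR (- M) <= 6 / M ^+ 3.
Proof.
move=> M0; have := @expR_ge1Dxn R M 2 (ltW M0); rewrite expRN => h.
rewrite -[leRHS]invrK lef_pV2 ?posrE ?expR_gt0 ?invr_gt0 ?divr_gt0 ?exprn_gt0//.
rewrite invfM invrK mulrC; apply: le_trans h.
by rewrite (_ : 3`!%:R = 6 :> R)// lerDr.
Qed.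

(** [M] serves both as number and as length of the trials, whence the bound [M ^ 2 + K <= 2 M ^ 2].
    Lengthening the trials with their number is what keeps the interference of old jobs summable. *)
Lemma tail_bound (K p : R) (cl : 'I_L -> R) (Pr : 'I_L -> 'I_J -> bool) (Cs : 'I_J -> R) (M : nat) :
  0 <= p <= 1 -> 0 <= K -> (0 < M)%N -> 2 * K <= M%:R ->
  (forall j, \sum_(l < L | Pr l j) cl l <= Cs j) ->
  (forall l N, exists E,
    [/\ <<s gens (input_events T V) (range (fun i => cX l (N + i)) `|` range (fun i => cV l (N + i))) >> E,
     p <= pr P E &
     forall w z, E w -> (forall i, (i < N)%N -> arr l i w < z) -> z <= arr l N w ->
       forall N', calm z K M%:R (cl l) N' ((arr l)^~ w) ((svc l)^~ w)]) ->
  exists B, [/\ measurable B, pr P B <= (1 - p ^+ L) ^+ M + far_const * s ^+ 2 / M%:R ^+ 3 &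
    forall w, regular T w -> ~ B w -> (`|tau' Pr Cs T V w| <= (2 * M%:R ^+ 2)%:E)%E].
Proof.
move=> /andP[p0 p1] K0 M0 KM hc hwin.
have M1 : 1 <= M%:R :> R by rewrite ler1n.
have Mgt0 : 0 < M%:R :> R by rewrite ltr0n.
pose F := [set w | failures s T V K M%:R cl M w].
pose S := \big[setU/set0]_(l <- enum 'I_L) (slow_arrivals s T eta M%:R l `|` long_services s V eta M%:R l).
have mF : measurable F by exact: (failures_measurable hst).
have mA l : measurable (slow_arrivals s T eta M%:R l `|` long_services s V eta M%:R l).
  by apply: measurableU; [exact: (measurable_slow hst)|exact: (measurable_long hst)].
have mS : measurable S by exact: bigsetU_measurable.
exists (F `|` S); split; first exact: measurableU.
  apply: le_trans (pr_leU _ mF mS) _; apply: lerD.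
    apply: (failures_prob s_gt0 hst Mgt0 p0 hwin) => //.
    exact: (slow_reach s_ge1 hst eta0_gt0 eta_gt0 drift).
  apply: le_trans (pr_big_le _ _ mA) _; rewrite big_enum /= /far_const -mulrA mulr_suml.
  apply: ler_sum => l _; apply: le_trans (pr_leU _ (measurable_slow hst _ _ _) (measurable_long hst _ _ _)) _.
  rewrite mulrDl; apply: lerD; last first.
    rewrite mulrA; exact: (long_services_pr s_ge1 hst eta_gt0 cq_ge0 muV_tail).
  apply: le_trans (slow_arrivals_pr s_ge1 hst eta0_gt0 drift _ _) _.
  apply: le_trans (expR_le_cube Mgt0) _; rewrite ler_wpM2l//.
  by rewrite ler_peMl ?invr_ge0 ?exprn_ge0// exprn_ege1.
move=> w hw nB.
have [k [/andP[k0 kM] hk]] : exists k, (0 < k <= M)%N /\ success s T V K M%:R cl k w.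
  apply: contrapT => /forallNP h; apply: nB; left => k kM hk; exact: (h k).
have nS l : ~ (slow_arrivals s T eta M%:R l `|` long_services s V eta M%:R l) w.
  move=> h; apply: nB; right; have : l \in enum 'I_L by rewrite mem_enum.
  rewrite /S; elim: (enum _) => [|l' r IH]; first by rewrite in_nil.
  by rewrite big_cons inE => /orP[/eqP <-|/IH]; [left|right].
have kMR : k%:R <= M%:R :> R by rewrite ler_nat.
have hfar := far_services s_ge1 M1 K0 KM k0 kMR
  (fun l h => nS l (or_introl h)) (fun l h => nS l (or_intror h)).
have aE l : (fun i : nat => - T l (- i%:Z) w) = (arr l)^~ w.
  by apply/funext => i; rewrite (arrE s_gt0).
apply: (@le_trans _ _ (k%:R * M%:R + K)%:E).
  apply: (tau_le (M := M%:R) (c := cl)) => //.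
  - by move=> l n n0; exact: (regular_future l hw).
  - by move=> l N; rewrite aE; exact: hk.
  - by move=> l i; rewrite -(arrE s_gt0 l i hw); exact: hfar.
  - by rewrite mulr_gt0// ltr0n.
rewrite lee_fin; have : k%:R * M%:R <= M%:R ^+ 2 :> R by rewrite expr2 ler_pM2r.
have : M%:R <= M%:R ^+ 2 :> R by rewrite expr2 ler_peMr// ltW.
by lra.
Qed.

End tail_bound.

(** * From tail bounds to the expectation *)

Section expectation_bound.
Context {d} {Omega : measurableType d} {R : realType} (P : probability Omega R).

(* No measurability: [\int] of a nonnegative function is then a lower integral. *)
Lemma le_integral_nonneg (f g : Omega -> \bar R) : (forall w, 0 <= f w)%E ->
  (forall w, f w <= g w)%E -> (\int[P]_w f w <= \int[P]_w g w)%E.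
Proof.
move=> f0 fg.
have g0 w : (0 <= g w)%E by apply: le_trans (fg w).
rewrite !ge0_integralTE//; apply: ereal_sup_le => _ [h hf <-]; exists h => // w.
exact: le_trans (hf w) (fg w).
Qed.

(** [f] is dominated by the measurable function [2 M0 ^ 2] plus the sum of [6 (M0 + j)] over the bad
    events that occur. If [j] is the first good index, the terms before it already reach
    [2 (M0 + j) ^ 2], because [2 (x + 1) ^ 2 - 2 x ^ 2 <= 6 x] for [x >= 1]. *)
Lemma expectation_bound (f : Omega -> \bar R) (M0 : nat) (B : nat -> set Omega) (N : set Omega)
    (b : nat -> R) (S : R) :
  (forall w, 0 <= f w)%E -> (0 < M0)%N -> measurable N -> P N = 0%E ->
  (forall j, measurable (B j)) -> (forall j, pr P (B j) <= b j) ->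
  (forall j w, ~ N w -> ~ B j w -> (f w <= (2 * (M0 + j)%:R ^+ 2)%:E)%E) ->
  (forall n, \sum_(j < n) 6 * (M0 + j)%:R * b j <= S) ->
  (\int[P]_w f w <= (2 * M0%:R ^+ 2 + S)%:E)%E.
Proof.
move=> f0 M00 mN N0 mB hB hf hS.
pose A j := B j `|` N.
have mA j : measurable (A j) by exact: measurableU.
have prA j : pr P (A j) <= b j.
  by apply: le_trans (pr_leU _ (mB j) mN) _; rewrite {2}/pr N0 addr0.
pose c j : R := 6 * (M0 + j)%:R.
have c0 j : 0 <= c j by rewrite /c mulr_ge0.
pose u j (w : Omega) : \bar R := ((c j)%:E * (\1_(A j) w)%:E)%E.
have u0 j w : (0 <= u j w)%E by rewrite /u -EFinM lee_fin mulr_ge0// indicE.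
have mu j : measurable_fun setT (u j).
  by apply: measurable_funeM; apply/measurable_EFinP; exact: measurable_indic.
pose g w : \bar R := ((2 * M0%:R ^+ 2)%:E + \sum_(j <oo) u j w)%E.
have partial n w : (forall j, (j < n)%N -> A j w) ->
    ((2 * (M0 + n)%:R ^+ 2)%:E <= g w)%E.
  move=> h; apply: le_trans (_ : ((2 * M0%:R ^+ 2)%:E + \sum_(0 <= j < n) u j w <= _)%E); last first.
    by apply: leeD2l; apply: nneseries_lim_ge => j _ _; exact: u0.
  have -> : (\sum_(0 <= j < n) u j w = (\sum_(0 <= j < n) c j)%:E)%E.
    rewrite -sumEFin big_nat [RHS]big_nat; apply: eq_bigr => j /andP[_ jn].
    by rewrite /u indicE mem_set ?mule1//; exact: h.
  rewrite -EFinD lee_fin; elim: n {h} => [|n IH]; first by rewrite addn0 big_geq// addr0.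
  rewrite big_nat_recr//= addrA; apply: le_trans (lerD IH (lexx _)).
  rewrite /c addnS -[(M0 + n).+1%:R]natr1; set x : R := (M0 + n)%:R.
  have x1 : 1 <= x by rewrite ler1n addn_gt0 M00.
  by rewrite sqrrD expr1n mulr1; lra.
have fg w : (f w <= g w)%E.
  case: (pselect (exists j, ~ A j w)) => [ex|nex].
    have exb : exists j, ~~ `[< A j w >] by case: ex => j hj; exists j; apply/asboolPn.
    case: (ex_minnP exb) => j /asboolPn nA jmin.
    apply: le_trans (hf j w _ _) (partial j w _).
    - by move=> h; apply: nA; right.
    - by move=> h; apply: nA; left.
    - move=> i ij; apply: contrapT => /asboolPn /jmin; by rewrite leqNgt ij.
  (* Where every event is bad the dominating series diverges, so domination holds trivially. *)
  have all j : A j w by apply: contrapT => h; apply: nex; exists j.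
  suff -> : g w = +oo%E by exact: leey.
  apply/eqyP => r r0; apply: le_trans (partial (Num.truncn r).+1 w (fun j _ => all j)).
  rewrite lee_fin; have h1 := truncnS_gt r; set k := (Num.truncn r).+1 in h1 *.
  have h2 : k%:R <= (M0 + k)%:R :> R by rewrite ler_nat leq_addl.
  have h3 : 1 <= (M0 + k)%:R :> R by rewrite ler1n addn_gt0 M00.
  have : (M0 + k)%:R <= (M0 + k)%:R ^+ 2 :> R by rewrite expr2 ler_peMr// (le_trans ler01).
  by lra.
apply: le_trans (le_integral_nonneg f0 fg) _.
rewrite ge0_integralD//; first last.
- by apply: ge0_emeasurable_sum => // j w _ _; exact: u0.
- by move=> w _; apply: nneseries_ge0 => j _ _; exact: u0.
rewrite integral_cst// EFinD; apply: leeD.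
  by rewrite [X in (_ * X)%E](_ : _ = 1%E) ?mule1//; exact: probability_setT.
rewrite integral_nneseries//.
apply: lime_le; first by apply: is_cvg_nneseries => j _ _; apply: integral_ge0 => w _; exact: u0.
near=> n; apply: le_trans (_ : ((\sum_(j < n) c j * b j)%:E <= _)%E); last by rewrite lee_fin; exact: hS.
rewrite -sumEFin big_mkord; apply: lee_sum => j _.
rewrite ge0_integralZl_EFin//; first last.
- by apply/measurable_EFinP; exact: measurable_indic.
have -> : (\int[P]_x (\1_(A j) x)%:E = (pr P (A j))%:E)%E.
  by rewrite integral_indic// setIT; exact: prE.
by rewrite -EFinM lee_fin ler_wpM2l.
Unshelve. all: by end_near. Qed.

End expectation_bound.

(** * The upper bound *)

Section law_facts.
Context {R : realType} (mu : probability R R).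

Lemma abs_mean : mu `]-oo, 0%R[%classic = 0%E -> (\int[mu]_x `|x|%:E < +oo)%E ->
  (\int[mu]_x `|x|%:E = (fine (\int[mu]_x x%:E))%:E)%E.
Proof.
move=> mu0 fin.
have mN : measurable_fun setT (EFin \o (fun x : R => `|x|)).
  by apply/measurable_EFinP; exact: normr_measurable.
have mI : measurable_fun setT (EFin \o (fun x : R => x)).
  by apply/measurable_EFinP; exact: measurable_id.
have e : (\int[mu]_x `|x|%:E = \int[mu]_x x%:E)%E.
  apply: (ae_eq_integral (EFin \o (fun x : R => x))) => //.
  exists (`]-oo, 0%R[%classic : set R); split=> //.
  move=> x /= hx; rewrite in_itv /= ltNge; apply/negP => x0; apply: hx => _.
  by rewrite ger0_norm.
rewrite -e fineK// ge0_fin_numE//; apply: integral_ge0 => x _; exact: normr_ge0.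
Qed.

Lemma second_moment_abs : (\int[mu]_x (x ^+ 2)%:E < +oo)%E -> (\int[mu]_x `|x|%:E < +oo)%E.
Proof.
move=> fin; have fin' : (\int[mu]_x (x ^+ 2)%:E <= (fine (\int[mu]_x (x ^+ 2)%:E))%:E)%E.
  by rewrite fineK// ge0_fin_numE//; apply: integral_ge0 => x _; rewrite lee_fin sqr_ge0.
have msq : measurable_fun setT (fun x : R => x ^+ 2) by exact: measurable_funX.
have := integral_affine (mu := mu) ler01 ler01 msq (fun x => sqr_ge0 x) fin'.
move=> /le_lt_trans /(_ (ltry _)); apply: le_lt_trans.
apply: ge0_le_integral => //.
- by apply/measurable_EFinP; exact: normr_measurable.
- by apply/measurable_EFinP; apply: measurable_funD => //; exact: measurable_funM.
- move=> x _; rewrite lee_fin mul1r -[x ^+ 2]real_normK ?num_real//.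
  by have := sqr_ge0 (`|x| - 1); nra.
Qed.

(** The mass above [e0] is positive, for otherwise the drift inequality would read [expR e <= 1];
    Markov's inequality at [e0] concludes. *)
Lemma mean_gt0 m : mu `]-oo, 0%R]%classic = 0%E -> (\int[mu]_x `|x|%:E = m%:E)%E -> 0 < m.
Proof.
move=> mu0 hm; have [e0 [e [e00 e_gt0 he]]] := drift_exists mu0.
have : pr mu `]e0, +oo[%classic <= m / e0 ^+ 1.
  by apply: tail_moment => //; rewrite -hm.
have hp : 0 < pr mu `]e0, +oo[%classic.
  rewrite lt_neqAle pr_ge0 andbT; apply/eqP => p0; move: he; rewrite -p0 mul0r add0r subr0 mul1r.
  by rewrite leNgt expR_gt1 e_gt0.
by move=> /(lt_le_trans hp); rewrite expr1 pmulr_lgt0// invr_gt0.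
Qed.

Lemma moment_tail : (forall q : R, 0 < q -> (\int[mu]_x (`|x| `^ q)%:E < +oo)%E) ->
  forall q : nat, exists2 cq : R, 0 <= cq &
    forall y, 0 < y -> pr mu `]y, +oo[%classic <= cq / y ^+ q.
Proof.
move=> hq [|q].
  by exists 1 => // y _; rewrite expr0 divr1; apply: pr_le1; exact: measurable_itv.
have h0 : (0 <= \int[mu]_x (`|x| ^+ q.+1)%:E)%E.
  by apply: integral_ge0 => x _; rewrite lee_fin exprn_ge0.
have fin : (\int[mu]_x (`|x| ^+ q.+1)%:E < +oo)%E.
  have := hq q.+1%:R (ltr0Sn _ _).
  by under eq_integral do rewrite powR_mulrn//.
exists (fine (\int[mu]_x (`|x| ^+ q.+1)%:E)); first by rewrite fine_ge0.
move=> y y0; apply: tail_moment => //; rewrite fineK// ge0_fin_numE//.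
Qed.

End law_facts.

(** * Summation over the number of trials *)

Section series.
Context {R : realType}.

Lemma arithmetic_geometric (q : R) n : 0 <= q < 1 ->
  \sum_(i < n) i%:R * q ^+ i <= (1 - q) ^- 2.
Proof.
move=> /andP[q0 q1]; have u0 : 0 < 1 - q by lra.
have e : (\sum_(i < n) i%:R * q ^+ i) * (1 - q) ^+ 2 =
    q - n%:R * q ^+ n + (n%:R - 1) * q ^+ n.+1.
  elim: n => [|n IH]; first by rewrite big_ord0; ring.
  by rewrite big_ord_recr /= mulrDl IH !exprS -[n.+1%:R]natr1; ring.
rewrite -[leRHS]mul1r ler_pdivlMr ?exprn_gt0// e.
case: n {e} => [|n]; first by rewrite mulr0n expr1; lra.
have qn : 0 <= q ^+ n.+1 by rewrite exprn_ge0.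
have h : n.+1%:R * q ^+ n.+2 <= n.+1%:R * q ^+ n.+1.
  by rewrite ler_wpM2l// [q ^+ n.+2]exprS ler_piMl// ltW.
have h2 : 0 <= q ^+ n.+2 by rewrite exprn_ge0.
have gen (x y z : R) : x <= y -> 0 <= z -> q - y + (x - z) <= 1 by lra.
by rewrite mulrBl mul1r; exact: gen h h2.
Qed.

Lemma ln_le_powR (s del : R) : 1 <= s -> 0 < del -> ln s <= s `^ del / del.
Proof.
move=> s1 d0; rewrite ler_pdivlMr// mulrC -ln_powR.
have h := powR_gt0 del (lt_le_trans ltr01 s1).
by have := expR_ge1Dx (ln (s `^ del)); rewrite lnK ?posrE//; lra.
Qed.

End series.

Section trial_series.
Context {R : realType}.

(** The failure part is an arithmetic-geometric sum, of size [p ^ -2] however large [M0] is; the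
    rare events leave an inverse square after multiplication by [M0 + j]. *)
Lemma trial_series (p u : R) (M0 n : nat) : 0 < p <= 1 -> 0 <= u -> (0 < M0)%N ->
  \sum_(j < n) 6 * (M0 + j)%:R * ((1 - p) ^+ (M0 + j) + u / (M0 + j)%:R ^+ 3) <=
  6 * p ^- 2 + 12 * u.
Proof.
move=> /andP[p0 p1] u0 M00.
have q0 : 0 <= 1 - p by lra.
rewrite (_ : 12 * u = 6 * (u * 2)); last by ring.
rewrite -mulrDr; under eq_bigr do rewrite -mulrA.
rewrite -mulr_sumr ler_pM2l//.
under eq_bigr do rewrite mulrDr.
rewrite big_split /=; apply: lerD.
  have q01 : 0 <= 1 - p < 1 by rewrite q0 gtrBl.
  have := arithmetic_geometric (M0 + n) q01; rewrite subKr; apply: le_trans.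
  rewrite big_split_ord /= lerDr; apply: sumr_ge0 => i _.
  by rewrite mulr_ge0// exprn_ge0.
apply: (@le_trans _ _ (\sum_(j < n) u * (1 + j%:R) ^- 2)); last first.
  by rewrite -mulr_sumr ler_wpM2l// inv_square_sum.
apply: ler_sum => j _; rewrite mulrCA ler_wpM2l//.
have h1 : 1 + j%:R <= (M0 + j)%:R :> R by rewrite natrD lerD2r ler1n.
have h0 : 0 < 1 + j%:R :> R by rewrite ltr_pwDl// ler0n.
set x := (M0 + j)%:R in h1 *; have x0 : 0 < x by apply: lt_le_trans h1.
rewrite (_ : x / x ^+ 3 = x ^- 2); last by rewrite exprS invfM mulrA divff ?mul1r// gt_eqF.
by rewrite lef_pV2 ?posrE ?exprn_gt0// lerXn2r ?nnegrE// ltW.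
Qed.

Lemma trial_budget (K A F G : R) (s : R) (M0 : nat) : 1 <= K -> 0 <= A -> 0 <= F -> 0 <= G ->
  s ^+ 2 <= expR (G * K) -> M0%:R <= 3 * K ->
  2 * M0%:R ^+ 2 + (6 * expR (- (A * K)) ^- 2 + 12 * (F * s ^+ 2)) <=
  (24 + 12 * F) * expR ((2 + 2 * A + G) * K).
Proof.
move=> K1 A0 F0 G0 hs hM; have K0 : 0 <= K := le_trans ler01 K1.
have hle x : 0 <= x -> x <= 2 + 2 * A + G -> expR (x * K) <= expR ((2 + 2 * A + G) * K).
  by move=> x0 hx; rewrite ler_expR ler_wpM2r.
have h1 : 2 * M0%:R ^+ 2 <= 18 * expR ((2 + 2 * A + G) * K).
  apply: (@le_trans _ _ (18 * expR (2 * K))); last first.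
    by rewrite ler_pM2l// hle//; lra.
  rewrite (_ : 2 * K = K + K) ?expRD; last by ring.
  have hK : K <= expR K by have := expR_ge1Dx K; lra.
  have : K * K <= expR K * expR K by rewrite ler_pM.
  have : M0%:R ^+ 2 <= (3 * K) ^+ 2 by rewrite lerXn2r ?nnegrE// mulr_ge0.
  by rewrite exprMn; lra.
have h2 : expR (- (A * K)) ^- 2 <= expR ((2 + 2 * A + G) * K).
  rewrite expRN exprVn invrK -expRM_natl mulrA; apply: hle; last by lra.
  by rewrite mulr_ge0.
have h3 : F * s ^+ 2 <= F * expR ((2 + 2 * A + G) * K).
  by rewrite ler_wpM2l//; apply: le_trans hs _; apply: hle => //; lra.
by rewrite mulrDl; lra.
Qed.

End trial_series.

Section network.
Context {R : realType} (J L : nat) (Pr : 'I_L -> 'I_J -> bool).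
Variables (muX muV : 'I_L -> probability R R) (m m2 EV : 'I_L -> R).
Hypothesis m_gt0 : forall l, 0 < m l.
Hypothesis m2_ge0 : forall l, 0 <= m2 l.
Hypothesis EV_ge0 : forall l, 0 <= EV l.
Hypothesis muX0 : forall l, muX l `]-oo, 0%R]%classic = 0%E.
Hypothesis muXm : forall l, (\int[muX l]_x `|x|%:E = (m l)%:E)%E.
Hypothesis muXm2 : forall l, (\int[muX l]_x (x ^+ 2)%:E <= (m2 l)%:E)%E.
Hypothesis muVm : forall l, (\int[muV l]_x `|x|%:E <= (EV l)%:E)%E.
Hypothesis muV_tail : forall l (q : nat), exists2 cq : R, 0 <= cq &
  forall y, 0 < y -> pr (muV l) `]y, +oo[%classic <= cq / y ^+ q.

(** All constants are uniform over the probability space and over the server numbers [Cs]; the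
    latter enter only through the occupancy that a good window guarantees. *)
Theorem upper_bound : exists2 b0 : 'I_L -> R, forall l, 0 <= b0 l &
  forall del, 0 < del -> exists s0 : nat, exists D c : R, [/\ 0 <= D, 0 < c &
  forall s : nat, (s0 <= s)%N -> forall Cs : 'I_J -> R,
  (forall j, \sum_(l < L | Pr l j) (EV l / m l * s%:R + b0 l * Num.sqrt (s%:R)) <= Cs j) ->
  forall d (Omega : measurableType d) (P : probability Omega R) (T V : 'I_L -> int -> Omega -> R),
  stationary_input P s%:R muX muV m T V ->
  (\int[P]_w `|tau' Pr Cs T V w| <= (c * expR (D * s%:R `^ del))%:E)%E].
Proof.
have /choice[eta0 /choice[eta heta]] := fun l => drift_exists (muX0 l).
have eta0_gt0 l : 0 < eta0 l by case: (heta l).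
have eta_gt0 l : 0 < eta l by case: (heta l).
have drift l := let: And3 _ _ h := heta l in h.
have trial l := cid2 (route_trial (m_gt0 l) (m2_ge0 l) (EV_ge0 l) (muX0 l) (muXm l) (muXm2 l)
  (muVm l) (eta0_gt0 l) (eta_gt0 l) (drift l) (muV_tail l)).
pose b0 l := s2val (trial l).
exists b0 => [l|del del0]; first exact: (s2valP (trial l)).
have /choice[s0 /choice[Cc win]] := fun l => s2valP' (trial l) del del0.
have /choice[cq hcq] : forall l, exists cq : R, 0 <= cq /\
    forall y, 0 < y -> pr (muV l) `]y, +oo[%classic <= cq / y ^+ (5 + 2).
  by move=> l; have [cq ? ?] := muV_tail l (5 + 2); exists cq.
pose CC := \sum_(l < L) `|Cc l|.
have CC0 : 0 <= CC by exact: sumr_ge0.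
have Cc_le l : Cc l <= CC.
  apply: le_trans (ler_norm _) _; rewrite /CC (bigD1 l)//= lerDl; exact: sumr_ge0.
pose F := far_const eta cq.
have F0 : 0 <= F.
  apply: sumr_ge0 => l _; rewrite addr_ge0// divr_ge0 ?sqr_ge0// mulr_ge0 ?mulr_ge0 ?exprn_ge0//.
  by case: (hcq l).
(* The three terms of the exponent: [M0 ^ 2] is of order [K ^ 2 <= expR (2 K)], the series gives
   [(p ^ L) ^ -2], and [s ^ 2 <= expR (2 K / del)]. *)
exists (\sum_(l < L) s0 l).+1, (2 + 2 * (L%:R * CC) + 2 / del), (24 + 12 * F); split.
- by rewrite !addr_ge0 ?mulr_ge0 ?invr_ge0 ?(ltW del0).
- by rewrite ltr_wpDr// mulr_ge0.
move=> s hs Cs hCs d Omega P T V hst; set K := s%:R `^ del.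
have s_ge1 : 1 <= s%:R :> R by rewrite ler1n (leq_trans _ hs).
have K1 : 1 <= K.
  by have := @ge0_ler_powR R del (ltW del0) 1 s%:R; rewrite powR1; apply => //; rewrite nnegrE//.
have K0 : 0 <= K := le_trans ler01 K1.
pose p := expR (- (CC * K)).
have p01 : 0 <= p <= 1 by rewrite expR_ge0 expR_le1 oppr_le0 mulr_ge0.
have pL : p ^+ L = expR (- (L%:R * CC * K)) by rewrite -expRM_natl mulrN mulrA.
(* The least size the far-job estimate admits, [2 K <= M]; staying below [3 K] keeps the initial
   term harmless. *)
pose M0 := (Num.truncn (2 * K)).+1.
have M02 : 2 * K <= M0%:R by rewrite ltW// truncnS_gt.
have M03 : M0%:R <= 3 * K.
  have : (Num.truncn (2 * K))%:R <= 2 * K by rewrite truncn_le// mulr_ge0.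
  have gen (k x : R) : 1 <= k -> x <= 2 * k -> x + 1 <= 3 * k by lra.
  by rewrite /M0 -[X in X <= 3 * _]natr1; exact: gen.
pose cl l := EV l / m l * s%:R + b0 l * Num.sqrt (s%:R).
have cl0 l : 0 <= cl l.
  apply: addr_ge0; apply: mulr_ge0 => //; last exact: (s2valP (trial l)).
  by rewrite divr_ge0// ltW.
have bad (j : nat) : exists B, [/\ measurable B,
    pr P B <= (1 - p ^+ L) ^+ (M0 + j) + F * s%:R ^+ 2 / (M0 + j)%:R ^+ 3 &
    forall w, regular T w -> ~ B w -> (`|tau' Pr Cs T V w| <= (2 * (M0 + j)%:R ^+ 2)%:E)%E].
  apply: (tail_bound s_ge1 hst eta0_gt0 eta_gt0 drift (fun l => proj1 (hcq l))
    (fun l => proj2 (hcq l)) p01 K0 _ _ (hCs : forall j, \sum_(l < L | Pr l j) cl l <= Cs j)) => //.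
    by apply: le_trans M02 _; rewrite ler_nat leq_addr.
  move=> l N; have sl : (s0 l <= s)%N.
    by apply: leq_trans hs; rewrite (bigD1 l)//= leqW// leq_addr.
  have [|||||||||I0 [I' [E [sE pE hE]]]] := win l s sl (M0 + j)%:R d Omega P _ (@comp_dom L)
    (input_events T V) (input_measurable hst) (@inputI _ _ _ _ T V) (@inputT _ _ _ _ T V)
    (input_indep hst) (fun i => cX l (N + i)) (fun i => cV l (N + i))
    (fun i => gap s%:R T l (N + i)) (fun i => svc V l (N + i)).
  - by move=> i i' /cX_inj /addnI.
  - by move=> i i' /cV_inj /addnI.
  - by [].
  - by [].
  - by [].
  - by move=> i B mB; exact: gap_sig.
  - by move=> i B mB; exact: svc_sig.
  - by move=> i B mB; exact: (gap_law hst).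
  - by move=> i B mB; exact: (svc_law hst).
  exists E; split=> //.
    by apply: le_trans pE; rewrite ler_expR lerN2 ler_wpM2r.
  move=> w z Ew hz zN; have [w1 w2 w3 w4] := hE w Ew.
  apply: (calm_window hz zN _ _ _ K0 (cl0 l) w1 w2 w3 w4).
  - by move=> i; rewrite arr_shift.
  - move=> i i' ii'; rewrite ler_pM2r ?invr_gt0 ?(lt_le_trans ltr01)//.
    by rewrite [leRHS](big_cat_nat (n := i))//= lerDl sumr_ge0.
  - by rewrite big_geq// mul0r.
have /choice[B hB] := bad.
have [N [mN N0 hN]] := regular_ae (lt_le_trans ltr01 s_ge1) hst muX0 muXm m_gt0.
have pL01 : 0 < p ^+ L <= 1 by rewrite pL expR_gt0 expR_le1 oppr_le0 !mulr_ge0.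
apply: le_trans (expectation_bound (M0 := M0) (B := B) (N := N) (P := P)
  (b := fun j => (1 - p ^+ L) ^+ (M0 + j) + F * s%:R ^+ 2 / (M0 + j)%:R ^+ 3)
  (S := 6 * (p ^+ L) ^- 2 + 12 * (F * s%:R ^+ 2)) _ _ _ _ _ _ _ _) _ => //.
- by move=> j; case: (hB j).
- by move=> j; case: (hB j).
- by move=> j w /hN hw nB; case: (hB j) => _ _; exact.
- by move=> n; apply: trial_series => //; rewrite mulr_ge0// sqr_ge0.
rewrite lee_fin pL; apply: trial_budget => //.
- by rewrite mulr_ge0.
- by rewrite divr_ge0// ltW.
have := ln_le_powR s_ge1 del0; rewrite -/K => h.
rewrite -[s%:R ^+ 2]lnK ?posrE ?exprn_gt0 ?(lt_le_trans ltr01)//.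
by rewrite ler_expR lnXn ?(lt_le_trans ltr01)// -mulrA [del^-1 * K]mulrC mulr_natl ler_pMn2r.
Qed.

End network.

(** * The lower bound *)

Section pathwise_lower.
Context {R : realType} {Omega : Type} {J L : nat} (Pr : 'I_L -> 'I_J -> bool) (Cs : 'I_J -> R)
  (T V : 'I_L -> int -> Omega -> R) (w : Omega).

(* A job still in service at time 0 keeps R(t) > |t| from its arrival on. *)
Lemma tau_ge l : T l 0 w < 0 -> 0 < T l 0 w + V l 0 w ->
  ((- T l 0 w)%:E <= `|tau' Pr Cs T V w|)%E.
Proof.
move=> T0 TV.
have : (tau' Pr Cs T V w <= (T l 0 w)%:E)%E.
  apply: ge_ereal_sup => _ [t [t0 [hR _]] <-]; rewrite lee_fin leNgt; apply/negP => Tt.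
  have : ((T l 0 w + V l 0 w - t)%:E <= Rmax T V w t)%E.
    apply: ereal_sup_ubound; right; exists (l, 0) => //.
    by split=> /=; [exact: ltW|lra].
  by move=> /le_trans /(_ hR); rewrite lee_fin ltr0_norm//; lra.
case: (tau' _ _ _ _ _) => [r| |] //=; rewrite ?leey// !lee_fin => h.
by rewrite ler0_norm; lra.
Qed.

(** No job is ever present, so every [t < 0] qualifies and the supremum is 0, though not
    attained. *)
Lemma tau_eq0 : (forall j, 0 <= Cs j) -> (forall l n, V l n w <= 0) ->
  tau' Pr Cs T V w = 0%E.
Proof.
move=> hC hV.
have np t x : ~ present T V w t x.
  by move=> [h1 h2]; have := hV x.1 x.2; lra.
have R0 t : Rmax T V w t = 0%E.
  apply/eqP; rewrite eq_le; apply/andP; split; last by apply: ereal_sup_ubound; left.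
  by apply: ge_ereal_sup => y [->|[x /np]].
apply/eqP; rewrite eq_le; apply/andP; split.
  by apply: ge_ereal_sup => _ [t [t0 _] <-]; rewrite lee_fin ltW.
apply/lee_subgt0Pr => e e0; rewrite sub0e; apply: ereal_sup_ubound; exists (- e) => //.
split; first by rewrite oppr_lt0.
split=> [|u _ _ j [|x js] _ hjs]; first by rewrite R0 lee_fin.
  exact: hC.
by have [_ /np] := hjs x (mem_head _ _).
Qed.

End pathwise_lower.

Section lower_bound.
Context {d} {Omega : measurableType d} {R : realType} (P : probability Omega R) (J L : nat) (s : R).
Variables (muX muV : 'I_L -> probability R R) (mX : 'I_L -> R) (T V : 'I_L -> int -> Omega -> R).
Hypothesis s_gt0 : 0 < s.
Hypothesis hst : stationary_input P s muX muV mX T V.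
Variables (Pr : 'I_L -> 'I_J -> bool) (Cs : 'I_J -> R).

Lemma no_service : (forall l, muV l `]0%R, +oo[%classic = 0%E) -> (forall j, 0 <= Cs j) ->
  (\int[P]_w `|tau' Pr Cs T V w| = 0)%E.
Proof.
move=> V0 hC.
pose A (k : nat) := if unpickle k is Some x then
  V (x : 'I_L * int).1 x.2 @^-1` `]0%R, +oo[ else set0.
have mA k : measurable (A k).
  rewrite /A; case: unpickle => // x; apply: preim_measurable; last exact: measurable_itv.
  exact: (mV hst).
have A0 k : pr P (A k) = 0.
  rewrite /A; case: unpickle => [x|]; last exact: pr0.
  case: hst => _ [_ [_ h _ _]]; rewrite /pr -[RHS]/(fine 0%E) -(V0 x.1) -(h _ x.2); last exact: measurable_itv.
  by congr (fine (P _)); apply/seteqP; split=> w /=; rewrite inE.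
have mN : measurable (\bigcup_k A k) by exact: bigcup_measurable.
have N0 : P (\bigcup_k A k) = 0%E.
  rewrite prE//; congr EFin; apply/eqP; rewrite eq_le pr_ge0 andbT.
  apply: pr_bigcup_le => // n; apply: le_trans (pr_big_le _ _ _) _ => //.
  by rewrite big1.
apply/eqP; rewrite eq_le; apply/andP; split; last exact: integral_ge0.
(* Dominating by [+oo] on a null set and 0 elsewhere avoids an almost everywhere argument on
   [tau']. *)
apply: (@le_trans _ _ (\int[P]_w (+oo * (\1_(\bigcup_k A k) w)%:E)%E)%E).
  apply: le_integral_nonneg => // w; rewrite indicE.
  case: (pselect ((\bigcup_k A k) w)) => h; first by rewrite mem_set// mule1 leey.
  rewrite memNset// mule0 tau_eq0 ?abse0// => l n; rewrite leNgt; apply/negP => Vn; apply: h.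
  by exists (pickle (l, n)) => //; rewrite /A pickleK /= in_itv /= Vn.
rewrite ge0_integralZl//.
- by rewrite integral_indic// setIT [X in (_ * X)%E](_ : _ = 0%E) ?mule0.
- by apply/measurable_EFinP; exact: measurable_indic.
Qed.

Hypothesis X_pos : forall l, muX l `]-oo, 0%R]%classic = 0%E.
Hypothesis X_mean : forall l, (\int[muX l]_x `|x|%:E = (mX l)%:E)%E.
Hypothesis mX_gt0 : forall l, 0 < mX l.

(** With [u = mX / (2 s)], the last arrival is older than [u] with probability at least 1/2 and
    older than [y] with probability at most 1/4. With probability at least 1/4 its age is thus in
    []u, y]], and an independent service longer than [y] keeps it present at time 0. *)
Lemma lower_bound l m2 y : (\int[muX l]_x (x ^+ 2)%:E <= m2%:E)%E -> 0 < y ->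
  4 * m2 <= mX l * s * y ->
  ((mX l / (8 * s) * pr (muV l) `]y, +oo[%classic)%:E <= \int[P]_w `|tau' Pr Cs T V w|)%E.
Proof.
move=> hm2 y0 hy; pose u := mX l / (2 * s).
have u0 : 0 < u by rewrite divr_gt0// mulr_gt0.
pose A := (T l 0 @^-1` `[(- y)%R, (- u)%R[) `&` (T l 1 @^-1` `]0%R, +oo[).
pose B := svc V l 0 @^-1` `]y, +oo[.
have sA : <<s gens (input_events T V) [set c0 l] >> A.
  by apply: sig_gen; exists `[(- y)%R, (- u)%R[%classic, `]0%R, +oo[%classic; split=> //; exact: measurable_itv.
have sB : <<s gens (input_events T V) [set cV l 0] >> B.
  by apply: svc_sig; exact: measurable_itv.
have mA := sig_measurable (input_measurable hst) sA.
have mB := sig_measurable (input_measurable hst) sB.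
have PAB : P (A `&` B) = (P A * P B)%E.
  by apply: (indep_sig (input_measurable hst) (@inputI _ _ _ _ T V) (@inputT _ _ _ _ T V) (input_indep hst) _ _ _ sA sB);
    [move=> _ ->|move=> _ ->|apply/seteqP; split=> // i [/= -> ]].
have PB : pr P B = pr (muV l) `]y, +oo[%classic.
  by rewrite /pr (svc_law hst)//; exact: measurable_itv.
have PA : 1 / 4 <= pr P A.
  have m1 := measurable_T01 hst l u 0; have m2' := measurable_T01 hst l y 0.
  have h1 := equilibrium_near s_gt0 hst X_pos X_mean mX_gt0 l (ltW u0).
  have h2 := equilibrium_far s_gt0 hst X_pos mX_gt0 y0 hm2.
  have h3 : m2 / (mX l * s * y) <= 1 / 4.
    rewrite ler_pdivrMr ?mulr_gt0//; lra.
  have h4 : s * u / mX l = 1 / 2 by rewrite /u; field; rewrite !gt_eqF.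
  have : pr P [set w | u < - T l 0 w /\ 0 < T l 1 w] <=
      pr P (A `|` [set w | y < - T l 0 w /\ 0 < T l 1 w]).
    apply: le_pr => //; first exact: measurableU.
    move=> w [/= h5 h6]; case: (ltP y (- T l 0 w)) => h7; [by right|left; split=> /=].
      by rewrite in_itv /=; apply/andP; split; lra.
    by rewrite in_itv /= h6.
  have := pr_leU P mA m2'; lra.
apply: (@le_trans _ _ (\int[P]_w (u%:E * (\1_(A `&` B) w)%:E)%E)%E); last first.
  apply: le_integral_nonneg => w.
    by rewrite -EFinM lee_fin mulr_ge0 ?(ltW u0)// indicE.
  rewrite indicE; case: (pselect ((A `&` B) w)) => h; last by rewrite memNset// mule0 abse_ge0.
  rewrite mem_set// mule1; move: h => [[]]; rewrite /B /= !in_itv /= !andbT => /andP[h1 h2] _ h3.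
  apply: le_trans (@tau_ge _ _ _ _ Pr Cs T V w l _ _); last by have h4 : y < V l 0 w := h3; lra.
    by rewrite lee_fin; lra.
  by lra.
rewrite ge0_integralZl_EFin//; first last.
- exact: ltW.
- by apply/measurable_EFinP; apply: measurable_indic; exact: measurableI.
rewrite integral_indic// ?setIT; last exact: measurableI.
rewrite (_ : (u%:E * _ = u%:E * (pr P A * pr P B)%:E)%E); last first.
  by congr (_ * _)%E; rewrite EFinM -!prE.
rewrite -EFinM lee_fin PB mulrA ler_wpM2r ?pr_ge0//.
rewrite (_ : mX l / (8 * s) = u * (1 / 4)); last by rewrite /u; field; rewrite gt_eqF.
by rewrite ler_pM2l.
Qed.

End lower_bound.

(** Both bounds give [ln x = O (K)] with [K = s ^ del], and doubling the exponent turns this into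
    [o]: [H K <= e K ^ 2] as soon as [K >= H / e]. The lower bound [a / s] costs only
    [ln s <= K / del]. *)
Lemma ln_growth (R : realType) (a c D del e : R) : 0 < a -> 0 < c -> 0 <= D -> 0 < del -> 0 < e ->
  exists N : nat, forall s x : R, N%:R <= s -> 1 <= s -> a / s <= x -> x <= c * expR (D * s `^ del) ->
    `|ln x| <= e * s `^ (2 * del).
Proof.
move=> a0 c0 D0 del0 e0.
pose H := `|ln a| + `|ln c| + D + del^-1.
have H0 : 0 <= H by rewrite !addr_ge0 ?invr_ge0 ?(ltW del0).
exists (Num.truncn ((H / e) `^ del^-1)).+1 => s x Ns s1 hx1 hx2.
have s0 : 0 < s := lt_le_trans ltr01 s1.
set K := s `^ del in hx2.
have K1 : 1 <= K.
  by have := @ge0_ler_powR R del (ltW del0) 1 s; rewrite powR1; apply => //; rewrite nnegrE ltW.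
have HK : H <= e * K.
  rewrite mulrC -ler_pdivrMr//.
  have He : 0 <= H / e by rewrite divr_ge0// ltW.
  have h : (H / e) `^ del^-1 <= s by apply: le_trans Ns; rewrite ltW// truncnS_gt.
  have := @ge0_ler_powR R del (ltW del0) _ _ _ _ h; rewrite -powRrM mulVf ?gt_eqF// powRr1//.
  by apply; rewrite nnegrE ?powR_ge0// ltW.
have x0 : 0 < x by apply: lt_le_trans hx1; rewrite divr_gt0.
have low : ln a - K / del <= ln x.
  have : ln (a / s) <= ln x by rewrite ler_ln ?posrE ?divr_gt0.
  rewrite ln_div ?posrE//; have := ln_le_powR s1 del0; rewrite -/K; lra.
have up : ln x <= ln c + D * K.
  have : ln x <= ln (c * expR (D * K)) by rewrite ler_ln ?posrE ?mulr_gt0 ?expR_gt0.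
  by rewrite lnM ?posrE ?expR_gt0// expRK.
have -> : s `^ (2 * del) = K * K by rewrite mulrC powRrM powR_mulrn ?powR_ge0// expr2.
have HKK : H * K <= e * (K * K).
  by rewrite mulrA ler_wpM2r// (le_trans ler01).
apply: le_trans HKK; rewrite /H !mulrDl.
have ka : `|ln a| <= `|ln a| * K by rewrite ler_peMr.
have kc : `|ln c| <= `|ln c| * K by rewrite ler_peMr.
have DK : 0 <= D * K by rewrite mulr_ge0// (le_trans ler01).
have dK : 0 <= K / del by rewrite divr_ge0 ?(ltW del0)// (le_trans ler01).
have la := ler_norm (- ln a); rewrite normrN in la; have lc := ler_norm (ln c).
have na := normr_ge0 (ln a); have nc := normr_ge0 (ln c).
have e1 : del^-1 * K = K / del by rewrite mulrC.
by rewrite e1 ler_norml; apply/andP; split; lra.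
Qed.

Theorem theorem3 (R : realType) (J L : nat)
  (Pr : 'I_L -> 'I_J -> bool) (C : 'I_J -> R)
  (muX muV : 'I_L -> probability R R)
  (hX0 : forall l, muX l `]-oo, 0%R]%classic = 0%E)
  (hV0 : forall l, muV l `]-oo, 0%R[%classic = 0%E)
  (hX2 : forall l, (\int[muX l]_x ((x ^+ 2)%:E) < +oo)%E)
  (hVq : forall l (q : R), 0 < q -> (\int[muV l]_x ((`|x| `^ q)%:E) < +oo)%E)
  (hbal : forall j : 'I_J,
     \sum_(l < L | Pr l j)
        fine (\int[muV l]_x (x%:E)) / fine (\int[muX l]_x (x%:E)) = C j) :
  exists B : R, forall beta : 'I_J -> R, (forall j, 0 < beta j /\ B < beta j) ->
  forall (d : measure_display) (Omega : nat -> measurableType d)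
    (P : forall s, probability (Omega s) R)
    (T V : forall s, 'I_L -> int -> Omega s -> R),
  (forall s : nat, (0 < s)%N ->
     stationary_input (P s) s%:R muX muV
       (fun l => fine (\int[muX l]_x (x%:E))) (T s) (V s)) ->
  forall delta : R, 0 < delta ->
  forall eps : R, 0 < eps ->
  exists N : nat, forall s : nat, (N <= s)%N ->
    let E := (\int[P s]_w
               `| tau' Pr (fun j => (s%:R * C j + beta j * Num.sqrt (s%:R))%R)
                      (T s) (V s) w |)%E in
    (E < +oo)%E /\ `|ln (fine E)| <= eps * (s%:R `^ delta).
Proof.
pose m l := fine (\int[muX l]_x (x%:E)); pose EV l := fine (\int[muV l]_x (x%:E)).
have muX0 l : muX l `]-oo, 0%R[%classic = 0%E.
  apply/eqP; rewrite eq_le measure_ge0 andbT -(hX0 l) le_measure// ?inE//; try exact: measurable_itv.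
  by move=> x /=; rewrite !in_itv /=; exact: ltW.
have muXm l : (\int[muX l]_x `|x|%:E = (m l)%:E)%E by exact/abs_mean/second_moment_abs.
have m_gt0 l : 0 < m l by exact: mean_gt0 (hX0 l) (muXm l).
have muVm l : (\int[muV l]_x `|x|%:E = (EV l)%:E)%E.
  apply: abs_mean => //; have := hVq l 1 ltr01.
  by under eq_integral do rewrite powRr1//.
have EV_ge0 l : 0 <= EV l.
  by rewrite -lee_fin -muVm; apply: integral_ge0 => x _; rewrite lee_fin.
pose m2 l := fine (\int[muX l]_x ((x ^+ 2)%:E)).
have m2E l : (\int[muX l]_x ((x ^+ 2)%:E) = (m2 l)%:E)%E.
  by rewrite fineK// ge0_fin_numE//; apply: integral_ge0 => x _; rewrite lee_fin sqr_ge0.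
have m2_ge0 l : 0 <= m2 l.
  by rewrite -lee_fin -m2E; apply: integral_ge0 => x _; rewrite lee_fin sqr_ge0.
have eqle (x y : \bar R) : x = y -> (x <= y)%E by move=> ->.
have [b0 b0_ge0 up] := upper_bound Pr m_gt0 m2_ge0 EV_ge0 hX0 muXm
  (fun l => eqle _ _ (m2E l)) (fun l => eqle _ _ (muVm l)) (fun l => moment_tail (hVq l)).
(* The sum over all routes dominates the sum over those through any given station, so one bound
   serves every [j]. *)
exists (\sum_l b0 l) => beta hbeta d Omega P T V hst delta delta0 eps eps0.
have Cs_ge s j : \sum_(l < L | Pr l j) (EV l / m l * s%:R + b0 l * Num.sqrt (s%:R)) <=
    s%:R * C j + beta j * Num.sqrt (s%:R).
  rewrite big_split /= -!mulr_suml -hbal [s%:R * _]mulrC lerD2l ler_wpM2r ?sqrtr_ge0//.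
  have [_ /ltW] := hbeta j; apply: le_trans.
  by rewrite [leRHS](bigID (fun l => Pr l j)) /= lerDl sumr_ge0.
(* If no route has positive service times, the expectation is 0 and the claim rests on the
   convention [ln 0 = 0]. *)
case: (pselect (exists l, 0 < pr (muV l) `]0%R, +oo[%classic)) => [[l hl]|nV]; last first.
  exists 1%N => s s0 E; suff -> : E = 0%E by rewrite ltry ln0// normr0 mulr_ge0 ?powR_ge0 ?(ltW eps0).
  apply: (no_service (hst s s0)) => [l|j].
    rewrite prE; last exact: measurable_itv.
    by congr EFin; apply/eqP; rewrite eq_le pr_ge0 andbT leNgt; apply/negP => h; apply: nV; exists l.
  apply: le_trans (Cs_ge s j); apply: sumr_ge0 => l _.
  by rewrite addr_ge0// mulr_ge0 ?sqrtr_ge0 ?divr_ge0 ?(ltW (m_gt0 l)).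
have [y y0 py] := positive_tail hl.
have del0 : 0 < delta / 2 by rewrite divr_gt0.
have [s0 [D [c [D0 c0 hup]]]] := up _ del0.
pose a := m l / 8 * pr (muV l) `]y, +oo[%classic.
have a0 : 0 < a by rewrite mulr_gt0 ?divr_gt0.
have [N hN] := ln_growth a0 c0 D0 del0 eps0.
exists (maxn 1 (maxn s0 (maxn N (Num.truncn (4 * m2 l / (m l * y))).+1))) => s.
rewrite !geq_max => /and4P[s1 ss0 sN sy] E.
have s1R : 1 <= s%:R :> R by rewrite ler1n.
have s_gt0 : 0 < s%:R :> R := lt_le_trans ltr01 s1R.
have hE1 : (E <= (c * expR (D * s%:R `^ (delta / 2)))%:E)%E.
  by apply: hup (hst s s1) => // j; exact: Cs_ge.
have hE2 : ((a / s%:R)%:E <= E)%E.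
  rewrite (_ : a / s%:R = m l / (8 * s%:R) * pr (muV l) `]y, +oo[%classic); last first.
    by rewrite /a; field; rewrite gt_eqF.
  apply: (lower_bound s_gt0 (hst s s1) Pr _ hX0 muXm m_gt0 (m2 := m2 l)) => //.
    by rewrite m2E.
  have : 4 * m2 l / (m l * y) <= s%:R.
    by apply: (@le_trans _ _ (Num.truncn (4 * m2 l / (m l * y))).+1%:R); rewrite ?ler_nat// ltW// truncnS_gt.
  by rewrite ler_pdivrMr ?mulr_gt0// mulrCA mulrA.
have EF : E = (fine E)%:E.
  rewrite fineK// ge0_fin_numE; first exact: le_lt_trans hE1 (ltry _).
  by apply: le_trans hE2; rewrite lee_fin ltW// divr_gt0.
split; first exact: le_lt_trans hE1 (ltry _).
have := hN s%:R (fine E); rewrite [2 * _]mulrC divfK//; apply => //.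
- by rewrite ler_nat.
- by rewrite -lee_fin -EF.
- by rewrite -lee_fin -EF.
Qed.
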